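(* Let $\Gamma$ be a countable abelian semigroup and $\mathcal A$ a countable abelian group with a coloring map $\theta$, such that every element of $\Gamma\times\mathcal A$ can be written as a sum of elements of $\Gamma\times\mathcal A$ in only finitely many ways. Let $\mathfrak L=\bigoplus_{(\alpha,a)\in\Gamma\times\mathcal A}\mathfrak L_{(\alpha,a)}$ be a $(\Gamma\times\mathcal A)$-graded $\theta$-colored Lie superalgebra over $\mathbb C$ with $\dim\mathfrak L_{(\alpha,a)}<\infty$ for all $(\alpha,a)$, and let a group $G$ act on $\mathfrak L$ by Lie superalgebra automorphisms preserving the $(\Gamma\times\mathcal A)$-gradation. Then for every $g\in G$ the following identity of formal series (the generalized denominator identity) holds: $$\prod_{(\alpha,a)\in\Gamma\times\mathcal A}\exp\Big(-\sum_{r=1}^{\infty}\frac1r\,\mathrm{str}(g^r|\mathfrak L_{(\alpha,a)})\,E^{r(\alpha,a)}\Big)=1-\sum_{(\alpha,a)\in\Gamma\times\mathcal A}\mathrm{str}(g|H(\mathfrak L)_{(\alpha,a)})\,E^{(\alpha,a)}.$$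
   Context: Coloring map: $\theta:\mathcal A\times\mathcal A\to\mathbb C^\times$ with $\theta(a+b,c)=\theta(a,c)\theta(b,c)$, $\theta(a,b+c)=\theta(a,b)\theta(a,c)$, $\theta(a,b)\theta(b,a)=1$. The sign map is $\psi(a)=\theta(a,a)\in\{\pm1\}$ (a group homomorphism); $a$ is even if $\psi(a)=1$ and odd if $\psi(a)=-1$. A $(\Gamma\times\mathcal A)$-graded $\theta$-colored Lie superalgebra is a graded space with a bilinear bracket satisfying $[\mathfrak L_{(\alpha,a)},\mathfrak L_{(\beta,b)}]\subset\mathfrak L_{(\alpha+\beta,a+b)}$, $[x,y]=-\theta(a,b)[y,x]$ and $[x,[y,z]]=[[x,y],z]+\theta(a,b)[y,[x,z]]$ for $x\in\mathfrak L_{(\alpha,a)}$, $y\in\mathfrak L_{(\beta,b)}$, $z\in\mathfrak L$. Its universal enveloping algebra $U(\mathfrak L)$ is the quotient of the tensor algebra by the relations $[x,y]=xy-\theta(a,b)yx$. Supertrace: if $G$ acts on a finite-dimensional homogeneous space $V_{(\alpha,a)}$, then $\mathrm{str}(g|V_{(\alpha,a)})=\psi(a)\,\mathrm{tr}(g|V_{(\alpha,a)})$. Homology: $H_k(\mathfrak L)=\mathrm{Tor}^{U(\mathfrak L)}_k(\mathbb C,\mathbb C)$ ($\mathbb C$ trivial); it is the homology of the standard complex with terms $C_k(\mathfrak L)=\bigoplus_{p+q=k}\Lambda^p(\mathfrak L_0)\otimes S^q(\mathfrak L_1)$, where $\mathfrak L_0,\mathfrak L_1$ are the sums of the even, resp.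 odd, homogeneous components, and it inherits the $(\Gamma\times\mathcal A)$-gradation and the $G$-action. $H(\mathfrak L)=\sum_{k\ge1}(-1)^{k+1}H_k(\mathfrak L)$ is the alternating direct sum, i.e. $\mathrm{str}(g|H(\mathfrak L)_{(\alpha,a)})=\sum_{k\ge1}(-1)^{k+1}\mathrm{str}(g|H_k(\mathfrak L)_{(\alpha,a)})$ (a finite sum). The $E^{(\alpha,a)}$ are the basis elements of the (completed) semigroup algebra of $\Gamma\times\mathcal A$, with $E^{(\alpha,a)}E^{(\beta,b)}=E^{(\alpha+\beta,a+b)}$; a unit $1$ is adjoined and infinite formal sums are allowed. *)

(* Defs.v *)
From HB Require Import structures.
From mathcomp Require Import all_boot all_order all_algebra.
From mathcomp Require Import generic_quotient ring_quotient.
From mathcomp Require Import finmap monalg.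
From mathcomp Require Import all_classical reals.
From mathcomp Require Import complex.
From mathcomp Require Import zify.

Set Implicit Arguments.
Unset Strict Implicit.
Unset Printing Implicit Defensive.

Import Order.TTheory GRing.Theory Num.Theory.
Local Open Scope classical_set_scope.
Local Open Scope ring_scope.
Local Open Scope quotient_scope.

Section Subspaces.
Variables (F : fieldType) (V : lmodType F).

Definition subspace (S : set V) : Prop :=
  S 0 /\ forall a x y, S x -> S y -> S (a *: x + y).

Definition span (X : set V) : set V := smallest subspace X.

(* [b] represents a basis of the quotient S / T; take T = [set 0] for a basis
   of S itself. *)
Definition basis_mod (S T : set V) (n : nat) (b : 'I_n -> V) : Prop :=
  (forall i, S (b i)) /\
  forall x, S x -> exists! c : 'rV[F]_n, T (x - \sum_i c 0 i *: b i).

Definition finite_dim (S : set V) : Prop :=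
  exists n (b : 'I_n -> V), basis_mod S [set 0] b.

(* Trace of the endomorphism of S / T induced by f. The default value 0 is
   only taken when S / T is not finite-dimensional. *)
Definition trace_mod (S T : set V) (f : V -> V) : F :=
  xget 0 [set t | exists n (b : 'I_n -> V) (M : 'M[F]_n),
    [/\ basis_mod S T b,
        forall j, T (f (b j) - \sum_i M i j *: b i) &
        t = \tr M]].

Definition trace_on (S : set V) (f : V -> V) : F := trace_mod S [set 0] f.

(* V is the direct sum of the subspaces Vg d. *)
Record grading (D : choiceType) (Vg : D -> set V) : Prop := {
  grading_subspace : forall d, subspace (Vg d);
  grading_span : forall x, exists s : seq (D * V),
    (forall p, p \in s -> Vg p.1 p.2) /\ x = \sum_(p <- s) p.2;
  grading_direct : forall (s : seq D) (x : D -> V), uniq s ->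
    (forall d, Vg d (x d)) -> \sum_(d <- s) x d = 0 ->
    forall d, d \in s -> x d = 0 }.

End Subspaces.

Section AlgebraQuotient.
Variables (F : fieldType) (B : algType F).

Definition two_sided (J : set B) : Prop :=
  subspace J /\ forall a x, J x -> J (a * x) /\ J (x * a).

Definition ideal_gen (X : set B) : set B := smallest two_sided X.

Lemma two_sided_gen X : two_sided (ideal_gen X).
Proof.
split; first split.
- by move=> J [[[]]].
- by move=> a x y hx hy J hJ; apply: hJ.1.1.2; [exact: hx|exact: hy].
- by move=> a x hx; split=> J hJ; apply (hJ.1.2 a x); exact: hx.
Qed.

Lemma sub_ideal_gen X : X `<=` ideal_gen X.
Proof. by move=> x hx J [_]; apply. Qed.

Record proper_two_sided := ProperTwoSided {
  pts_set : set B;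
  pts_ideal : two_sided pts_set;
  pts_proper : ~ pts_set 1 }.

Definition pts_pred (J : proper_two_sided) : B -> bool := fun x => `[< pts_set J x >].

Lemma pts_zmod (J : proper_two_sided) : zmod_closed (pts_pred J).
Proof.
case: (pts_ideal J) => -[J0 JD] _; split=> [|x y]; rewrite !unfold_in.
  exact/asboolP.
move=> /asboolP hx /asboolP hy; apply/asboolP.
by rewrite addrC -scaleN1r; apply: JD.
Qed.
HB.instance Definition _ J :=
  GRing.isZmodClosed.Build B (pts_pred J) (pts_zmod J).

Definition quotalg (J : proper_two_sided) :=
  Quotient.quot (GRing.ZmodClosed.clone B (pts_pred J) _).

Section Instances.
Variable J : proper_two_sided.
HB.instance Definition _ := GRing.Zmodule.on (quotalg J).
HB.instance Definition _ := Quotient.on (quotalg J).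

Definition qpi (x : B) : quotalg J := \pi_(quotalg J) x.

Lemma qpi_eq x y : qpi x = qpi y <-> pts_set J (x - y).
Proof.
have := Quotient.idealrBE (GRing.ZmodClosed.clone B (pts_pred J) _) x y.
rewrite unfold_in => h; split=> [e|e].
  by apply/asboolP; rewrite /pts_pred in h; rewrite h; apply/eqP.
by apply/eqP; rewrite -[_ == _]h; apply/asboolP.
Qed.

Lemma qpi_reprK x : qpi (repr x) = x.
Proof. exact: reprK. Qed.

Lemma repr_qpi x : pts_set J (repr (qpi x) - x).
Proof. by apply/qpi_eq; rewrite qpi_reprK. Qed.

Lemma qpiD x y : qpi (x + y) = qpi x + qpi y.
Proof. by rewrite /qpi !piE. Qed.

(* Locked so that unification does not unfold products in quotient algebras. *)
Fact quotalg_key : unit. Proof. exact: tt. Qed.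
Definition qscale : F -> quotalg J -> quotalg J :=
  locked_with quotalg_key (fun a x => qpi (a *: repr x)).
Definition qmul : quotalg J -> quotalg J -> quotalg J :=
  locked_with quotalg_key (fun x y => qpi (repr x * repr y)).

Lemma qpiZ a x : qpi (a *: x) = qscale a (qpi x).
Proof.
rewrite /qscale unlock; apply/esym/qpi_eq; rewrite -scalerBr -[_ *: _]addr0.
by case: (pts_ideal J) => -[J0 JD] _; apply: JD => //; exact: repr_qpi.
Qed.

Lemma qpiM x y : qpi (x * y) = qmul (qpi x) (qpi y).
Proof.
rewrite /qmul unlock; apply/esym/qpi_eq; case: (pts_ideal J) => -[J0 JD] JM.
have -> : repr (qpi x) * repr (qpi y) - x * y =
  1 *: (repr (qpi x) * (repr (qpi y) - y)) + (repr (qpi x) - x) * y.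
  by rewrite scale1r mulrBr mulrBl addrA subrK.
by apply: JD; [exact: (JM _ _ (repr_qpi y)).1|exact: (JM _ _ (repr_qpi x)).2].
Qed.

Lemma qscaleA a b x : qscale a (qscale b x) = qscale (a * b) x.
Proof. by rewrite -[x]qpi_reprK -!qpiZ scalerA. Qed.
Lemma qscale1 : left_id 1 qscale.
Proof. by move=> x; rewrite -[x]qpi_reprK -!qpiZ scale1r. Qed.
Lemma qscaleDr : right_distributive qscale +%R.
Proof.
by move=> a x y; rewrite -[x]qpi_reprK -[y]qpi_reprK -qpiD -!qpiZ -qpiD scalerDr.
Qed.
Lemma qscaleDl x : {morph qscale^~ x : a b / a + b}.
Proof. by move=> a b; rewrite -[x]qpi_reprK -!qpiZ -qpiD scalerDl. Qed.
HB.instance Definition _ := GRing.Zmodule_isLmodule.Build F (quotalg J)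
  qscaleA qscale1 qscaleDr qscaleDl.

Lemma qmulA : associative qmul.
Proof.
by move=> x y z; rewrite -[x]qpi_reprK -[y]qpi_reprK -[z]qpi_reprK -!qpiM mulrA.
Qed.
Lemma qmul1 : left_id (qpi 1) qmul.
Proof. by move=> x; rewrite -[x]qpi_reprK -qpiM mul1r. Qed.
Lemma qmulr1 : right_id (qpi 1) qmul.
Proof. by move=> x; rewrite -[x]qpi_reprK -qpiM mulr1. Qed.
Lemma qmulDl : left_distributive qmul +%R.
Proof.
move=> x y z; rewrite -[x]qpi_reprK -[y]qpi_reprK -[z]qpi_reprK.
by rewrite -qpiD -!qpiM -qpiD mulrDl.
Qed.
Lemma qmulDr : right_distributive qmul +%R.
Proof.
move=> x y z; rewrite -[x]qpi_reprK -[y]qpi_reprK -[z]qpi_reprK.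
by rewrite -qpiD -!qpiM -qpiD mulrDr.
Qed.
Lemma qone_neq0 : qpi 1 != 0.
Proof.
apply/eqP; rewrite (_ : 0 = qpi 0); last by rewrite /qpi !piE.
by move/qpi_eq; rewrite subr0; exact: pts_proper.
Qed.
HB.instance Definition _ := GRing.Zmodule_isNzRing.Build (quotalg J)
  qmulA qmul1 qmulr1 qmulDl qmulDr qone_neq0.

Lemma qpi_is_linear : linear qpi.
Proof. by move=> a x y; rewrite qpiD qpiZ. Qed.
HB.instance Definition _ := GRing.isLinear.Build F B (quotalg J) _ qpi qpi_is_linear.
Lemma qpi_is_monoid_morphism : monoid_morphism qpi.
Proof. by split=> // x y; rewrite qpiM. Qed.
HB.instance Definition _ :=
  GRing.isMonoidMorphism.Build B (quotalg J) qpi qpi_is_monoid_morphism.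

Lemma qscaleAl (a : F) (x y : quotalg J) : a *: (x * y) = a *: x * y.
Proof.
rewrite -[x]qpi_reprK -[y]qpi_reprK.
by rewrite -rmorphM -!linearZ -rmorphM scalerAl.
Qed.
HB.instance Definition _ := GRing.Lmodule_isLalgebra.Build F (quotalg J) qscaleAl.

Lemma qscaleAr (a : F) (x y : quotalg J) : a *: (x * y) = x * (a *: y).
Proof.
rewrite -[x]qpi_reprK -[y]qpi_reprK.
by rewrite -rmorphM -!linearZ -rmorphM scalerAr.
Qed.
HB.instance Definition _ := GRing.Lalgebra_isAlgebra.Build F (quotalg J) qscaleAr.

End Instances.
End AlgebraQuotient.

Section TensorAlgebra.
Variables (F : fieldType) (V : lmodType F).

Definition freealg := {malg F[{fmonom V}]}.
HB.instance Definition _ := GRing.Lalgebra.on freealg.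

Definition fgen (v : V) : freealg := mkmalgU (fmu v) 1.

(* Linear extension to the free algebra of a function of words. *)
Definition word_ext (W : lmodType F) (h : seq V -> W) (r : freealg) : W :=
  \sum_(w <- msupp r) r@_w *: h w.

Lemma word_extEw (W : lmodType F) (h : seq V -> W) (d : {fset {fmonom V}})
  (r : freealg) : (msupp r `<=` d)%fset -> word_ext h r = \sum_(w <- d) r@_w *: h w.
Proof.
move=> le; rewrite /word_ext (big_fset_incl _ le) //= => x _ /mcoeff_outdom ->.
by rewrite scale0r.
Qed.

Lemma word_ext_is_linear (W : lmodType F) (h : seq V -> W) : linear (word_ext h).
Proof.
move=> a x y; pose d := (msupp (a *: x + y) `|` msupp x `|` msupp y)%fset.
rewrite (@word_extEw _ h d) ?(@word_extEw _ h d x) ?(@word_extEw _ h d y).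
- rewrite scaler_sumr -big_split /=; apply: eq_bigr => w _.
  by rewrite mcoeffD mcoeffZ scalerDl scalerA.
- by rewrite /d; exact: fsubsetUr.
- by rewrite /d fsetUAC; exact: fsubsetUr.
- by rewrite /d -fsetUA; exact: fsubsetUl.
Qed.
HB.instance Definition _ (W : lmodType F) (h : seq V -> W) :=
  GRing.isLinear.Build F freealg W _ (word_ext h) (word_ext_is_linear h).

Lemma word_extU (W : lmodType F) (h : seq V -> W) (w : {fmonom V}) :
  word_ext h (mkmalgU w 1) = h w.
Proof. by rewrite /word_ext msuppU1 big_seq_fset1 mcoeffU1 eqxx scale1r. Qed.

Lemma freealgE (r : freealg) :
  r = \sum_(w <- msupp r) r@_w *: (mkmalgU w 1 : freealg).
Proof.
rewrite [LHS]monalgE; apply: eq_bigr => w _; apply/malgP => k.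
by rewrite mcoeffZ mcoeffU mcoeffU mulrnAr mulr1.
Qed.

Lemma mulUU (v w : {fmonom V}) :
  (mkmalgU v 1 : freealg) * mkmalgU w 1 = mkmalgU (mmul v w) 1.
Proof. by rewrite malgM_def fgmulUU mulr1. Qed.

Lemma freealg_scaleAr (a : F) (x y : freealg) : a *: (x * y) = x * (a *: y).
Proof.
rewrite -[a *: y]mul_malgC mulrA scalerAl; congr (_ * y).
rewrite malgM_def fgmulgU [x in LHS]monalgE scaler_sumr.
apply: eq_bigr => w _; rewrite mulm1 mulrC.
by apply/malgP => k; rewrite mcoeffZ mcoeffU mcoeffU mulrnAr.
Qed.
HB.instance Definition _ :=
  GRing.Lalgebra_isAlgebra.Build F freealg freealg_scaleAr.

(* The relations making [fgen] linear. *)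
Definition linear_rel : set freealg :=
  [set r | exists a x y, r = fgen (a *: x + y) - (a *: fgen x + fgen y)].

Definition multilinear (W : lmodType F) (h : seq V -> W) : Prop :=
  forall s t a x y,
    h (s ++ (a *: x + y) :: t) = a *: h (s ++ x :: t) + h (s ++ y :: t).

Lemma word_extMl (W : lmodType F) (h : seq V -> W) (v : {fmonom V}) (r : freealg) :
  word_ext h ((mkmalgU v 1 : freealg) * r) = word_ext (fun w => h (v ++ w)) r.
Proof.
rewrite [r in LHS]freealgE mulr_sumr linear_sum; apply: eq_bigr => w _.
by rewrite -scalerAr linearZ /= mulUU word_extU fmM.
Qed.

Lemma word_extMr (W : lmodType F) (h : seq V -> W) (v : {fmonom V}) (r : freealg) :
  word_ext h (r * (mkmalgU v 1 : freealg)) = word_ext (fun w => h (w ++ v)) r.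
Proof.
rewrite [r in LHS]freealgE mulr_suml linear_sum; apply: eq_bigr => w _.
by rewrite -scalerAl linearZ /= mulUU word_extU fmM.
Qed.

Lemma word_ext_ideal (W : lmodType F) (h : seq V -> W) :
  multilinear h -> forall r, ideal_gen linear_rel r -> word_ext h r = 0.
Proof.
move=> hM r hr.
suff : [set r : freealg | forall s t, word_ext (fun w => h (s ++ w ++ t)) r = 0] r.
  move=> /(_ [::] [::]) <-; congr word_ext; apply/funext => w.
  by rewrite cats0.
apply: hr; split; first split; first split.
- by move=> s t; rewrite linear0.
- by move=> a x y hx hy s t; rewrite linearP /= hx hy scaler0 addr0.
- move=> a x hx; split=> s t.
    rewrite [a]freealgE mulr_suml linear_sum big1 // => v _.
    rewrite -scalerAl linearZ /= word_extMl -[RHS](scaler0 _ a@_v) -(hx (s ++ v) t).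
    by congr (_ *: word_ext _ _); apply/funext => w; rewrite !catA.
  rewrite [a]freealgE mulr_sumr linear_sum big1 // => v _.
  rewrite -scalerAr linearZ /= word_extMr -[RHS](scaler0 _ a@_v) -(hx s (v ++ t)).
  by congr (_ *: word_ext _ _); apply/funext => w; rewrite !catA.
- move=> _ [a [x [y ->]]] s t.
  rewrite linearB linearP /= !word_extU !fmU hM.
  by rewrite subrr.
Qed.

Lemma linear_rel_proper : ~ ideal_gen linear_rel 1.
Proof.
pose h (w : seq V) : F^o := (size w == 0)%:R.
have hM : multilinear h.
  move=> s t a x y; rewrite /h !size_cat /= !addnS.
  by rewrite scaler0 addr0.
have h1 : word_ext h 1 = 1 by rewrite word_extU fm1.
by move=> /(word_ext_ideal hM) /eqP; rewrite h1 oner_eq0.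
Qed.

Definition tensor_ideal :=
  ProperTwoSided (two_sided_gen linear_rel) linear_rel_proper.

Definition tensoralg := quotalg tensor_ideal.
HB.instance Definition _ := GRing.Algebra.on tensoralg.

Definition tgen (v : V) : tensoralg := qpi tensor_ideal (fgen v).

Definition tword (s : seq V) : tensoralg := \prod_(v <- s) tgen v.

(* The linear map on T(V) given on decomposable tensors by a multilinear h
   (see [tensor_ext_word]). *)
Definition tensor_ext (W : lmodType F) (h : seq V -> W) (x : tensoralg) : W :=
  word_ext h (repr (x : quotalg tensor_ideal)).

Lemma tgen_is_linear : linear tgen.
Proof.
move=> a x y; rewrite -linearP; apply/qpi_eq; apply: sub_ideal_gen.
by exists a, x, y.
Qed.
HB.instance Definition _ :=
  GRing.isLinear.Build F V tensoralg _ tgen tgen_is_linear.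

Lemma tensor_ext_pi (W : lmodType F) (h : seq V -> W) (r : freealg) :
  multilinear h -> tensor_ext h (qpi tensor_ideal r) = word_ext h r.
Proof.
move=> hM; apply/subr0_eq; rewrite -linearB; apply: word_ext_ideal => //.
exact: (repr_qpi tensor_ideal).
Qed.

Lemma tensor_ext_linear (W : lmodType F) (h : seq V -> W) :
  multilinear h -> linear (tensor_ext h).
Proof.
move=> hM a x y; rewrite -[x]qpi_reprK -[y]qpi_reprK -linearP.
by rewrite !tensor_ext_pi // linearP.
Qed.

Lemma tensor_ext_word (W : lmodType F) (h : seq V -> W) (s : seq V) :
  multilinear h -> tensor_ext h (tword s) = h s.
Proof.
move=> hM; have -> : tword s = qpi tensor_ideal (mkmalgU (FMonom s) 1 : freealg).
  rewrite /tword; elim: s => [|v s IH].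
    rewrite big_nil -[LHS](rmorph1 (qpi tensor_ideal)); congr qpi.
    by congr mkmalgU; apply/val_inj; rewrite /= fm1.
  rewrite big_cons IH -rmorphM mulUU; congr (qpi tensor_ideal (mkmalgU _ _)).
  by apply/val_inj; rewrite /= fmM fmU.
by rewrite tensor_ext_pi // word_extU.
Qed.

(* The algebra morphism extending a linear f. *)
Definition tensor_lift (B : algType F) (f : V -> B) : tensoralg -> B :=
  tensor_ext (fun s => \prod_(v <- s) f v).

Lemma prod_multilinear (B : algType F) (f : V -> B) :
  linear f -> multilinear (fun s => \prod_(v <- s) f v).
Proof.
move=> fL s t a x y; rewrite !big_cat !big_cons /= fL.
by rewrite mulrDl mulrDr -scalerAl -scalerAr.
Qed.

Lemma tensor_lift_linear (B : algType F) (f : V -> B) :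
  linear f -> linear (tensor_lift f).
Proof. by move=> fL; apply/tensor_ext_linear/prod_multilinear. Qed.

Lemma tensor_lift_gen (B : algType F) (f : V -> B) (v : V) :
  linear f -> tensor_lift f (tgen v) = f v.
Proof.
move=> fL; have := tensor_ext_word [:: v] (prod_multilinear fL).
by rewrite /tword !big_seq1.
Qed.

Lemma tensor_lift_morph (B : algType F) (f : V -> B) :
  linear f -> monoid_morphism (tensor_lift f).
Proof.
move=> fL; have fM := prod_multilinear fL; split.
  have := tensor_ext_word [::] fM; rewrite /tword !big_nil; exact.
move=> x y; rewrite -[x]qpi_reprK -[y]qpi_reprK -rmorphM.
rewrite /tensor_lift !tensor_ext_pi //; set r := repr x; set q := repr y.
rewrite [r]freealgE mulr_suml !linear_sum mulr_suml.
apply: eq_bigr => v _; rewrite -scalerAl !linearZ /= word_extMl word_extU.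
rewrite -scalerAl; congr (_ *: _).
rewrite [q]freealgE !linear_sum mulr_sumr; apply: eq_bigr => w _.
by rewrite !linearZ /= !word_extU big_cat scalerAr.
Qed.

End TensorAlgebra.

Section SemigroupSums.
Variable D : addSemigroupType.

(* The monoid obtained by adjoining a neutral element None to D. *)
Definition oadd (x y : option D) : option D :=
  match x, y with
  | Some d, Some e => Some (d + e)
  | Some d, None => Some d
  | None, _ => y
  end.

Definition osum (s : seq D) : option D := \big[oadd/None]_(d <- s) Some d.

(* Only the empty sequence has osum None, so nonempty sums are meant here. *)
Definition finite_decompositions : Prop :=
  forall d : D, finite_set [set s : seq D | osum s = Some d].

(* (r + 1) d *)
Definition mulS (d : D) (r : nat) : D := iter r (+%R d) d.

End SemigroupSums.

Section HomogeneousProducts.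
Variables (F : fieldType) (D : addSemigroupType).
Variables (V : lmodType F) (B : algType F) (f : V -> B) (Vg : D -> set V).

Definition homog_words (d : D) (k : nat) : set B :=
  [set t | exists s : seq (D * V),
    [/\ size s = k, forall p, p \in s -> Vg p.1 p.2,
        osum [seq p.1 | p <- s] = Some d & t = \prod_(p <- s) f p.2]].

End HomogeneousProducts.

(* Tor^B(F, F) for an algebra B with augmentation eps, as the homology of the
   reduced bar complex
     ... -> I (x) I (x) I -> I (x) I -> I -> F,   I = ker eps,
   which is F (x)_B P for the normalized bar resolution P of F, where
   P_k = B (x) I^(x)k. The k-th term is realized inside T(B) as the span of the
   tensors u_1 (x) ... (x) u_k with u_i in I, and
     d (u_1 (x) ... (x) u_k) =
       sum_i (-1)^(i-1) u_1 (x) ... (x) u_i u_(i+1) (x) ... (x) u_k. *)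
Section BarComplex.
Variables (F : fieldType) (B : algType F) (eps : B -> F).

Definition bar_merge (s : seq B) (i : nat) : seq B :=
  take i s ++ (s`_i * s`_i.+1) :: drop i.+2 s.

Definition bar_word (s : seq B) : tensoralg B :=
  \sum_(0 <= i < (size s).-1) (-1) ^+ i *: tword (bar_merge s i).

Lemma bar_merge_linear (s t : seq B) (i : nat) a x y :
  (i.+1 < (size s + size t).+1)%N ->
  tword (bar_merge (s ++ (a *: x + y) :: t) i) =
  a *: tword (bar_merge (s ++ x :: t) i) + tword (bar_merge (s ++ y :: t) i).
Proof.
have tM := prod_multilinear (@tgen_is_linear F B).
move=> hi; rewrite /bar_merge !take_cat !drop_cat !nth_cat.
have [si|si] := ltnP i (size s); have [si1|si1] := ltnP i.+1 (size s).
- have [si2|si2] := ltnP i.+2 (size s); last first.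
    have -> : (i.+2 - size s = 0)%N by lia.
    by have := tM (take i s ++ [:: s`_i * s`_i.+1]) t a x y; rewrite -!catA.
  have := tM (take i s ++ (s`_i * s`_i.+1) :: drop i.+2 s) t a x y.
  by rewrite -!catA.
- have -> : (i.+1 - size s = 0)%N by lia.
  have -> : (i.+2 < size s)%N = false by lia.
  have -> : (i.+2 - size s = 1)%N by lia.
  rewrite /= drop0 mulrDr -scalerAr; exact: tM.
- lia.
- have -> : (i.+2 < size s)%N = false by lia.
  case e: (i - size s)%N => [|j].
    have -> : (i.+1 - size s = 1)%N by lia.
    have -> : (i.+2 - size s = 2)%N by lia.
    by rewrite /= cats0 mulrDl -scalerAl; exact: tM.
  have -> : (i.+1 - size s = j.+2)%N by lia.
  have -> : (i.+2 - size s = j.+3)%N by lia.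
  by rewrite /= -!catA; exact: tM.
Qed.
Lemma bar_word_multilinear : multilinear (bar_word).
Proof.
move=> s t a x y; rewrite /bar_word !size_cat /= scaler_sumr -big_split /=.
rewrite !addnS; apply: eq_big_nat => i /andP[_ hi].
by rewrite bar_merge_linear // scalerDr !scalerA [a * _]mulrC.
Qed.

(* See [tensor_ext_word]. *)
Definition bar_diff : tensoralg B -> tensoralg B := tensor_ext bar_word.

Definition bar (k : nat) : set (tensoralg B) :=
  span [set t | exists s : seq B,
    [/\ size s = k, forall u, u \in s -> eps u = 0 & t = tword s]].

Definition tor_cycles (k : nat) : set (tensoralg B) :=
  [set x | bar k x /\ bar_diff x = 0].

Definition tor_boundaries (k : nat) : set (tensoralg B) :=
  bar_diff @` bar k.+1.

End BarComplex.

Section ColorLie.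
Variables (F : fieldType) (Gam : addSemigroupType) (A : zmodType).

Record coloring (theta : A -> A -> F) : Prop := {
  coloring_neq0 : forall a b, theta a b != 0;
  coloring_addl : forall a b c, theta (a + b) c = theta a c * theta b c;
  coloring_addr : forall a b c, theta a (b + c) = theta a b * theta a c;
  coloring_skew : forall a b, theta a b * theta b a = 1 }.

Definition psi (theta : A -> A -> F) (a : A) : F := theta a a.

Variables (theta : A -> A -> F) (L : lmodType F).
Variables (Lg : Gam * A -> set L) (br : L -> L -> L).

Record color_lie : Prop := {
  color_lie_grading : grading Lg;
  color_lie_linearl : forall y, linear (br^~ y);
  color_lie_linearr : forall x, linear (br x);
  color_lie_degree : forall d e x y, Lg d x -> Lg e y -> Lg (d + e) (br x y);
  color_lie_skew : forall d e x y, Lg d x -> Lg e y ->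
    br x y = - (theta d.2 e.2 *: br y x);
  color_lie_jacobi : forall d e x y z, Lg d x -> Lg e y ->
    br x (br y z) = br (br x y) z + theta d.2 e.2 *: br y (br x z) }.

Record graded_action (G : groupType) (rho : G -> L -> L) : Prop := {
  action1 : forall x, rho 1%g x = x;
  actionM : forall g h x, rho (g * h)%g x = rho g (rho h x);
  action_linear : forall g, linear (rho g);
  action_br : forall g x y, rho g (br x y) = br (rho g x) (rho g y);
  action_graded : forall g d x, Lg d x -> Lg d (rho g x) }.

Definition uea_rel : set (tensoralg L) :=
  [set t | exists d e x y, [/\ Lg d x, Lg e y &
    t = tgen (br x y) - (tgen x * tgen y - theta d.2 e.2 *: (tgen y * tgen x))]].

Lemma uea_rel_proper : ~ ideal_gen uea_rel 1.
Proof.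
pose f (x : L) : F^o := 0.
have fL : linear f by move=> a x y; rewrite /f scaler0 addr0.
have mL := tensor_lift_linear fL; have [m1 mM] := tensor_lift_morph fL.
have mg x : tensor_lift f (tgen x) = 0 by exact: tensor_lift_gen.
have mZ a x : tensor_lift f (a *: x) = a *: tensor_lift f x.
  by rewrite -[a *: x]addr0 mL [tensor_lift f 0](_ : _ = 0) ?addr0 //;
     have := mL (-1) 0 0; rewrite scaler0 addr0 scaleN1r addNr.
have mB x y : tensor_lift f (x - y) = tensor_lift f x - tensor_lift f y.
  by rewrite addrC -scaleN1r mL scaleN1r addrC.
move=> /(_ [set t | tensor_lift f t = 0]) h.
have : tensor_lift f 1 = 0.
  apply: h; split; first split; first split.
  - by move: (mB 1 1); rewrite !subrr.
  - by move=> a x y hx hy; rewrite /mkset mL hx hy scaler0 addr0.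
  - by move=> a x hx; split; rewrite /mkset mM [tensor_lift f x]hx ?mulr0 ?mul0r.
  - move=> _ [d [e [x [y [_ _ ->]]]]].
    by rewrite /mkset mB mB mZ mM mM !mg mulr0 scaler0 !subr0.
by rewrite m1 => /eqP; rewrite oner_eq0.
Qed.

Definition uea_ideal := ProperTwoSided (two_sided_gen uea_rel) uea_rel_proper.

(* U(L) *)
Definition uea := quotalg uea_ideal.
HB.instance Definition _ := GRing.Algebra.on uea.

Definition ugen (x : L) : uea := qpi uea_ideal (tgen x).

(* The algebra morphism U(L) -> B extending f, for f linear and compatible with
   the brackets; it does not depend on the representative. *)
Definition uea_lift (B : algType F) (f : L -> B) (u : uea) : B :=
  tensor_lift f (repr (u : quotalg uea_ideal)).

(* The augmentation, i.e. the action of U(L) on the trivial module. *)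
Definition counit : uea -> F := @uea_lift F^o (fun=> 0).

Definition uea_deg (d : Gam * A) : set uea :=
  span (\bigcup_k homog_words ugen Lg d k).

(* Degree d part of the k-th term of the bar complex. *)
Definition bar_deg (k : nat) (d : Gam * A) : set (tensoralg uea) :=
  span (homog_words (@tgen F uea) uea_deg d k).

(* The action on the bar complex of U(L) induced by an automorphism f of L. *)
Definition bar_act (f : L -> L) : tensoralg uea -> tensoralg uea :=
  tensor_lift (fun u => tgen (uea_lift (fun x => ugen (f x)) u)).

Definition str_Lie (f : L -> L) (d : Gam * A) : F :=
  psi theta d.2 * trace_on (Lg d) f.

(* str(f | H_k(L)_d) with H_k(L) = Tor_k^U(L)(F, F). *)
Definition str_homology (f : L -> L) (k : nat) (d : Gam * A) : F :=
  psi theta d.2 *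
  trace_mod (tor_cycles counit k `&` bar_deg k d)
            (tor_boundaries counit k `&` bar_deg k d) (bar_act f).

(* str(f | H(L)_d); only finitely many terms are nonzero. *)
Definition str_H (f : L -> L) (d : Gam * A) : F :=
  \sum_(k \in [set k | (0 < k)%N]) (-1) ^+ k.+1 * str_homology f k d.

End ColorLie.

(* Formal series over the semigroup D with a unit adjoined: [s (Some d)] is the
   coefficient of E^d and [s None] that of 1. The sums below are sums of the
   nonzero terms, which are finitely many in all intended uses. *)
Section FormalSeries.
Variables (F : fieldType) (D : addSemigroupType).

Definition fseries := option D -> F.

Definition fmono (x : option D) : fseries := fun y => (y == x)%:R.
Definition fone : fseries := fmono None.
Definition fscale (a : F) (s : fseries) : fseries := fun x => a * s x.
Definition fsub (s t : fseries) : fseries := fun x => s x - t x.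

Definition fsum (T : choiceType) (s : T -> fseries) : fseries :=
  fun x => \sum_(i \in [set: T]) s i x.

Definition fmul (s t : fseries) : fseries :=
  fun x => \sum_(p \in [set p : option D * option D | oadd p.1 p.2 = x])
    s p.1 * t p.2.

Definition fpow (s : fseries) (n : nat) : fseries := iter n (fmul s) fone.

Definition fexp (s : fseries) : fseries :=
  fsum (fun n : nat => fscale (n`!%:R^-1) (fpow s n)).

(* The infinite product of the s_d, d in D, converges to t: each coefficient of
   the finite partial products is eventually constant. *)
Definition is_fprod (s : D -> fseries) (t : fseries) : Prop :=
  forall x, exists r0 : seq D, forall r : seq D, uniq r -> {subset r0 <= r} ->
    (\big[fmul/fone]_(d <- r) s d) x = t x.

End FormalSeries.

Arguments fmono {F D} x.
Arguments fone {F D}.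

(* Main.v *)
(* Finite decompositions give every degree d a height, the maximal number of terms
   in a decomposition of d, and height (d + e) > height d. Choose in each L_d a basis
   which makes g triangular and order all basis letters by height first: then the
   bracket of two letters only involves later letters, and the Poincare-Birkhoff-Witt
   theorem for U(L) follows by iterating Ore extensions, i.e. by a structural recursion
   on ordered monomials. The diagonal coefficient of g at an ordered monomial is the
   product of the eigenvalues of its letters, so the supertrace series u of g on U(L)
   is a product of factors of the form (1 - lam E^d)^(-1) (even letters) or
   1 - lam E^d (odd letters); grouping letters by degree, the logarithmic derivative
   in E^d identifies the inverse of u with the product of exponentials.
   On the other side the reduced bar complex has as k-th term the k-th tensor power of
   the augmentation ideal, so by the Euler-Poincare principle 1 - str(g|H(L)) is the
   alternating sum of the powers of u - 1, that is, 1 / u. *)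
From HB Require Import structures.
From mathcomp Require Import all_boot all_order all_algebra.
From mathcomp Require Import generic_quotient ring_quotient finmap monalg.
From mathcomp Require Import all_classical reals complex.
From mathcomp Require Import ssrAC zify ring.
Require Import Defs.

Set Implicit Arguments.
Unset Strict Implicit.
Unset Printing Implicit Defensive.

Import Order.TTheory GRing.Theory Num.Theory.
Local Open Scope classical_set_scope.
Local Open Scope ring_scope.
Local Open Scope quotient_scope.

(** * Traces on subquotients *)

(** The Poincare-Birkhoff-Witt part works with functions rather than elements: [act f i N] is the
    value at x_i z_N of the linear map that should send each ordered monomial z_M to [f M]. Letting
    [f] vary is what makes a recursion on [N] alone possible, since moving x_i past a first letter j
    replaces [f] by w -> f (j :: w). Consistency becomes an identity between functions
    ([relation_at]), and the resulting maps [phi] on U(L) are the coordinates of ordered monomials.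
    Two unrelated orders on letters occur: [key] decides which monomials are ordered, [idx] makes g
    triangular inside each component. Monomials of equal length are compared through [rank], the sum
    of the [idx] of their letters; shorter ones do not contribute. Signs never enter the
    combinatorics: psi is multiplicative on degrees, so it is absorbed into the weight of each
    letter ([signed]). Since [trace_mod] is a choice with default value 0, traces are first
    exhibited through the relation [has_trace]. *)

Section SubspaceTheory.
Variables (F : fieldType) (V : lmodType F).
Implicit Types (S T K : set V).

Lemma subspace_0 S : subspace S -> S 0. Proof. by case. Qed.

Lemma subspaceD S x y : subspace S -> S x -> S y -> S (x + y).
Proof. by move=> [_ h] hx hy; rewrite -[x]scale1r; apply: h. Qed.

Lemma subspaceZ S a x : subspace S -> S x -> S (a *: x).
Proof. by move=> [h0 h] hx; rewrite -[_ *: _]addr0; apply: h. Qed.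

Lemma subspaceN S x : subspace S -> S x -> S (- x).
Proof. by move=> hS hx; rewrite -scaleN1r; apply: subspaceZ. Qed.

Lemma subspaceB S x y : subspace S -> S x -> S y -> S (x - y).
Proof. by move=> hS hx hy; apply: subspaceD => //; apply: subspaceN. Qed.

Lemma subspace_sum S (I : eqType) (r : seq I) (P : pred I) (f : I -> V) :
  subspace S -> (forall i, i \in r -> P i -> S (f i)) -> S (\sum_(i <- r | P i) f i).
Proof.
move=> hS h; rewrite big_seq_cond; elim/big_ind: _ => //; first exact: subspace_0.
  by move=> x y; exact: subspaceD.
by move=> i /andP[]; exact: h.
Qed.

Lemma subspace_set0 : subspace [set (0 : V)].
Proof. by split=> // a x y -> ->; rewrite scaler0 addr0. Qed.

Lemma subspaceI S T : subspace S -> subspace T -> subspace (S `&` T).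
Proof.
move=> [S0 hS] [T0 hT]; split=> // a x y [? ?] [? ?].
by split; [exact: hS|exact: hT].
Qed.

Lemma span_subspace (X : set V) : subspace (span X).
Proof.
split=> [S [[]]//|a x y hx hy S hS]; have [[_ h] _] := hS.
by apply: h; [exact: hx|exact: hy].
Qed.

Lemma sub_span (X : set V) : X `<=` span X.
Proof. by move=> x hx S [_]; apply. Qed.

Lemma span_min (X S : set V) : subspace S -> X `<=` S -> span X `<=` S.
Proof. by move=> hS XS x; apply. Qed.

Lemma span_ind (X : set V) (P : V -> Prop) x : span X x ->
  subspace (P : set V) -> (forall y, X y -> P y) -> P x.
Proof. by move=> hx hP hX; apply: hx; split. Qed.

Lemma span_mono (X Y : set V) : X `<=` Y -> span X `<=` span Y.
Proof.
by move=> XY; apply: span_min; [exact: span_subspace|move=> x /XY; exact: sub_span].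
Qed.

Lemma span_image_sub (T : Type) (e : T -> V) (P : set T) (S : set V) :
  subspace S -> (forall j, P j -> S (e j)) -> span (e @` P) `<=` S.
Proof. by move=> hS h; apply: span_min => // _ [j Pj <-]; exact: h. Qed.

End SubspaceTheory.

Section LinearFacts.
Variables (F : fieldType) (V W : lmodType F) (f : V -> W).
Hypothesis fL : linear f.

Lemma lin0 : f 0 = 0.
Proof. by have := fL (-1) 0 0; rewrite scaler0 addr0 scaleN1r addNr. Qed.
Lemma linD x y : f (x + y) = f x + f y.
Proof. by rewrite -[x in LHS]scale1r fL scale1r. Qed.
Lemma linZ a x : f (a *: x) = a *: f x.
Proof. by rewrite -[_ *: x]addr0 fL lin0 addr0. Qed.
Lemma linN x : f (- x) = - f x.
Proof. by rewrite -scaleN1r linZ scaleN1r. Qed.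
Lemma linB x y : f (x - y) = f x - f y.
Proof. by rewrite linD linN. Qed.
Lemma lin_sum I (r : seq I) (P : pred I) (g : I -> V) :
  f (\sum_(i <- r | P i) g i) = \sum_(i <- r | P i) f (g i).
Proof. by apply: (big_morph f linD lin0). Qed.

Lemma preim_subspace (S : set W) : subspace S -> subspace (f @^-1` S).
Proof. by move=> [S0 hS]; split=> [|a x y ? ?]; rewrite /preimage /= ?lin0// fL; exact: hS. Qed.

Lemma image_subspace (S : set V) : subspace S -> subspace (f @` S).
Proof.
move=> [S0 hS]; split; first by exists 0; rewrite ?lin0.
by move=> a _ _ [x hx <-] [y hy <-]; exists (a *: x + y); [exact: hS|rewrite fL].
Qed.

Lemma span_lin (X : set V) (S : set W) : subspace S ->
  (forall y, X y -> S (f y)) -> forall x, span X x -> S (f x).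
Proof.
move=> hS hX x hx.
exact: (span_ind (P := fun x => S (f x)) hx (preim_subspace hS) hX).
Qed.

End LinearFacts.

Section TraceTheory.
Variables (F : fieldType) (V : lmodType F).
Implicit Types (S T K : set V) (f : V -> V).

Definition comb n (b : 'I_n -> V) (c : 'rV[F]_n) : V := \sum_i c 0 i *: b i.

Lemma comb_linear n (b : 'I_n -> V) : linear (comb b).
Proof.
move=> a c d; rewrite /comb scaler_sumr -big_split; apply: eq_bigr => i _ /=.
by rewrite !mxE scalerDl scalerA.
Qed.

Lemma comb_mul n m (b : 'I_n -> V) (c : 'rV_m) (A : 'M_(m, n)) :
  comb b (c *m A) = \sum_i c 0 i *: comb b (row i A).
Proof.
by rewrite mulmx_sum_row (lin_sum (comb_linear b)); apply: eq_bigr => i _;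
   rewrite (linZ (comb_linear b)).
Qed.

Lemma comb_sub S n (b : 'I_n -> V) c : subspace S -> (forall i, S (b i)) -> S (comb b c).
Proof. by move=> hS hb; apply: subspace_sum => // i _ _; apply: subspaceZ. Qed.

Lemma basis_modP S T n (b : 'I_n -> V) : subspace S -> subspace T ->
  basis_mod S T b <-> [/\ forall i, S (b i),
    forall x, S x -> exists c, T (x - comb b c) &
    forall c, T (comb b c) -> c = 0].
Proof.
move=> hS hT; split=> [[bS h]|[bS h1 h2]].
  split=> // [x /h [c [hc _]]|c hc]; first by exists c.
  have /h [d [_ hd]] := comb_sub c hS bS.
  have dc : d = c by apply: hd; rewrite -/(comb b c) subrr; exact: subspace_0.
  by rewrite -dc; apply: hd; rewrite -/(comb b 0) (lin0 (comb_linear b)) subr0.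
split=> // x /h1 [c hc]; exists c; split=> // d hd; apply/esym/eqP.
rewrite -subr_eq0; apply/eqP/h2; rewrite (linB (comb_linear b)).
have -> : comb b d - comb b c = (x - comb b c) - (x - comb b d).
  by rewrite opprB [RHS]addrC addrA subrK.
exact: subspaceB.
Qed.

(** The relation behind the choice in [trace_mod]. Additivity and images are proved for it;
    [trace_modE] returns to the chosen value. *)
Definition has_trace S T f t := exists n (b : 'I_n -> V) (M : 'M[F]_n),
    [/\ basis_mod S T b,
        forall j, T (f (b j) - \sum_i M i j *: b i) &
        t = \tr M].

(** Transposing the matrix lets its rows hold the images of the basis vectors, so that f acts on
    coordinates by right multiplication of row vectors. *)
Lemma has_traceP S T f t : has_trace S T f t <->
  exists n (b : 'I_n -> V) (M : 'M[F]_n), [/\ basis_mod S T b,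
    forall j, T (f (b j) - comb b (row j M)) & t = \tr M].
Proof.
split=> -[n [b [M [h1 h2 ->]]]]; exists n, b, M^T; split=> //; rewrite ?mxtrace_tr // => j.
  rewrite (_ : comb _ _ = \sum_i M i j *: b i) //.
  by apply: eq_bigr => i _; rewrite !mxE.
rewrite (_ : \sum_i _ = comb b (row j M)) //.
by apply: eq_bigr => i _; rewrite !mxE.
Qed.

Section Mod.
Variable T : set V.
Hypothesis hT : subspace T.
Definition eqm x y := T (x - y).
Lemma eqm_sym x y : eqm x y -> eqm y x.
Proof. by move=> h; rewrite /eqm -opprB; exact: subspaceN. Qed.
Lemma eqm_trans x y z : eqm x y -> eqm y z -> eqm x z.
Proof. by move=> h1 h2; rewrite /eqm -(subrK y x) -addrA; exact: subspaceD. Qed.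
Lemma eqm_comb n (b b' : 'I_n -> V) (c : 'rV_n) :
  (forall i, eqm (b i) (b' i)) -> eqm (comb b c) (comb b' c).
Proof.
move=> h; rewrite /eqm /comb -sumrB; apply: subspace_sum => // i _ _.
by rewrite -scalerBr; exact: (subspaceZ _ hT (h i)).
Qed.
Lemma eqm_lin f x y : linear f -> T `<=` f @^-1` T -> eqm x y -> eqm (f x) (f y).
Proof. by move=> fL fT h; rewrite /eqm -(linB fL); exact: fT. Qed.
End Mod.

(** Two bases are related modulo T by rectangular matrices P and Q with QP = 1 and PQ = 1, and f
    gives NP = PM; hence tr N = tr(PMQ) = tr M. Cyclicity of the trace covers bases of a priori
    different lengths. *)
Lemma has_trace_uniq S T f t t' : subspace S -> subspace T ->
  linear f -> T `<=` f @^-1` T ->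
  has_trace S T f t -> has_trace S T f t' -> t = t'.
Proof.
move=> hS hT fL fT /has_traceP[n [b [M [/basis_modP []// bS b1 b2 hM ->]]]].
move=> /has_traceP[m [c [N [/basis_modP []// cS c1 c2 hN ->]]]].
have h1 i : exists d, eqm T (c i) (comb b d) by exact: b1.
have h2 i : exists d, eqm T (b i) (comb c d) by exact: c1.
have {h1} [p hp] := choice h1; have {h2} [q hq] := choice h2.
pose P := \matrix_i p i; pose Q := \matrix_i q i.
have hP d : eqm T (comb c d) (comb b (d *m P)).
  by rewrite comb_mul; apply: eqm_comb => // i; rewrite rowK.
have hQ d : eqm T (comb b d) (comb c (d *m Q)).
  by rewrite comb_mul; apply: eqm_comb => // i; rewrite rowK.
have bE d d' : eqm T (comb b d) (comb b d') -> d = d'.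
  by rewrite /eqm -(linB (comb_linear b)) => /b2 /eqP; rewrite subr_eq0 => /eqP.
have cE d d' : eqm T (comb c d) (comb c d') -> d = d'.
  by rewrite /eqm -(linB (comb_linear c)) => /c2 /eqP; rewrite subr_eq0 => /eqP.
have QP : Q *m P = 1%:M.
  apply/row_matrixP => i; rewrite row_mul rowE -mulmxA rowE; apply: bE.
  rewrite mulmx1 mulmxA; apply: eqm_sym => //.
  by apply: (eqm_trans hT (hQ _)); exact: hP.
have PQ : P *m Q = 1%:M.
  apply/row_matrixP => i; rewrite row_mul rowE -mulmxA rowE; apply: cE.
  rewrite mulmx1 mulmxA; apply: eqm_sym => //.
  by apply: (eqm_trans hT (hP _)); exact: hQ.
have fcomb k (e : 'I_k -> V) (E : 'M_k) d :
    (forall j, T (f (e j) - comb e (row j E))) -> eqm T (f (comb e d)) (comb e (d *m E)).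
  move=> hE; rewrite comb_mul /comb (lin_sum fL).
  rewrite (eq_bigr (fun i => d 0 i *: f (e i))); last by move=> i _; rewrite (linZ fL).
  exact: (@eqm_comb T hT k (fun i => f (e i))).
have NPPM : N *m P = P *m M.
  apply/row_matrixP => i; rewrite 2!rowE !mulmxA; apply: bE.
  apply: (@eqm_trans T hT _ (f (comb c (delta_mx 0 i)))).
    apply: eqm_sym => //; apply: (eqm_trans hT (fcomb _ _ _ _ hN)).
    exact: hP.
  apply: (@eqm_trans T hT _ (f (comb b (delta_mx 0 i *m P)))).
    by apply: eqm_lin => //; exact: hP.
  exact: fcomb.
by rewrite -[N]mulmx1 -PQ mulmxA NPPM mxtrace_mulC mulmxA QP mul1mx.
Qed.

Lemma trace_modE S T f t : subspace S -> subspace T ->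
  linear f -> T `<=` f @^-1` T -> has_trace S T f t -> trace_mod S T f = t.
Proof.
move=> hS hT fL fT ht; rewrite /trace_mod; case: xgetP => [x _ hx|/(_ t)//].
exact: has_trace_uniq hx ht.
Qed.

Definition catf n m (A : Type) (u : 'I_n -> A) (v : 'I_m -> A) (i : 'I_(n + m)) : A :=
  match fintype.split i with inl j => u j | inr j => v j end.

Lemma catf_l n m (A : Type) (u : 'I_n -> A) (v : 'I_m -> A) i :
  catf u v (lshift m i) = u i.
Proof. by rewrite /catf (fintype.unsplitK (inl i)). Qed.

Lemma catf_r n m (A : Type) (u : 'I_n -> A) (v : 'I_m -> A) i :
  catf u v (rshift n i) = v i.
Proof. by rewrite /catf (fintype.unsplitK (inr i)). Qed.

Lemma basis_mod_cat S K T n m (b : 'I_n -> V) (c : 'I_m -> V) :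
  subspace S -> subspace K -> subspace T -> T `<=` K -> K `<=` S ->
  basis_mod S K b -> basis_mod K T c ->
  basis_mod S T (catf b c).
Proof.
move=> hS hK hT TK KS /basis_modP []// bS b1 b2 /basis_modP []// cK c1 c2.
set e := catf _ _.
have eE d : comb e d = comb b (lsubmx d) + comb c (rsubmx d).
  rewrite /comb big_split_ord; congr (_ + _); apply: eq_bigr => i _;
  by rewrite /e ?catf_l ?catf_r mxE.
apply/basis_modP => //; split.
- by move=> i; rewrite /e /catf; case: fintype.split => j; [exact: bS|exact/KS/cK].
- move=> x /b1 [d /c1 [d' h]]; exists (row_mx d d').
  by rewrite eE row_mxKl row_mxKr opprD addrA.
- move=> d; rewrite eE => h.
  have l0 : lsubmx d = 0.
    apply: b2; rewrite -[comb b _](addrK (comb c (rsubmx d))).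
    by apply: subspaceB => //; [exact: TK|exact: comb_sub].
  have r0 : rsubmx d = 0.
    by apply: c2; move: h; rewrite l0 (lin0 (comb_linear b)) add0r.
  by rewrite -[d]hsubmxK l0 r0 row_mx0.
Qed.

(** In a basis of S / K followed by one of K / T the matrix of f is block triangular, because f
    preserves K. *)
Lemma has_traceD S K T f t1 t2 :
  subspace S -> subspace K -> subspace T -> T `<=` K -> K `<=` S ->
  S `<=` f @^-1` S ->
  has_trace S K f t1 -> has_trace K T f t2 -> has_trace S T f (t1 + t2).
Proof.
move=> hS hK hT TK KS fS /has_traceP[n [b [M [hb hM ->]]]].
move=> /has_traceP[m [c [N [hc hN ->]]]].
move: (hb) => /basis_modP []// bS b1 b2; move: (hc) => /basis_modP []// cK c1 c2.
have h j : exists d, T ((f (b j) - comb b (row j M)) - comb c d) by exact/c1/hM.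
have {h} [p hp] := choice h.
apply/has_traceP; exists (n + m)%N; eexists; exists (block_mx M (\matrix_i p i) 0 N).
split; [exact: (basis_mod_cat hS hK hT TK KS hb hc) | | by rewrite mxtrace_block].
move=> j; rewrite /comb big_split_ord /=.
case: (splitP j) => k jk.
  rewrite (_ : j = lshift m k); last exact/val_inj.
  have := hp k; rewrite -addrA -opprD catf_l.
  set A := (X in T (_ - X) -> _); set B := (X in _ -> T (_ - X)).
  rewrite (_ : A = B) // /A /B; congr (_ + _); apply: eq_bigr => i _.
    by rewrite catf_l [row _ _ _ _]mxE [row _ _ _ _]mxE block_mxEul.
  by rewrite catf_r [row _ _ _ _]mxE block_mxEur mxE.
rewrite (_ : j = rshift n k); last exact/val_inj.
have := hN k; rewrite catf_r.
set A := (X in T (_ - X) -> _); set B := (X in _ -> T (_ - X)).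
rewrite (_ : A = B) // /A /B -[LHS]add0r; congr (_ + _).
  by rewrite big1 // => i _; rewrite catf_l [row _ _ _ _]mxE block_mxEdl mxE scale0r.
by apply: eq_bigr => i _; rewrite catf_r [row _ _ _ _]mxE [row _ _ _ _]mxE block_mxEdr.
Qed.

(* Bases of subquotients of a finitely spanned space, by induction on a spanning
   list: adding the vector [v] enlarges the part of [K] inside the span by at
   most one dimension. *)
Fixpoint span_list (T : set V) (s : seq V) : set V :=
  if s is v :: s' then [set x | exists a, span_list T s' (x - a *: v)] else T.

Lemma span_list_subspace T s : subspace T -> subspace (span_list T s).
Proof.
move=> hT; elim: s => //= v s IH; split.
  by exists 0; rewrite scale0r subr0; exact: subspace_0.
move=> a x y [b hb] [c hc]; exists (a * b + c).
have -> : a *: x + y - (a * b + c) *: v = a *: (x - b *: v) + (y - c *: v).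
  by rewrite scalerBr scalerA scalerDl opprD addrACA.
by apply: subspaceD => //; exact: subspaceZ.
Qed.

Lemma subset_span_list T s : T `<=` span_list T s.
Proof.
by elim: s => //= v s IH x /IH hx; exists 0; rewrite scale0r subr0.
Qed.

Lemma basis_mod_nil T (b : 'I_0 -> V) : subspace T -> basis_mod T T b.
Proof.
move=> hT; apply/basis_modP => //; split=> [[]//|x hx|c _]; last by rewrite thinmx0.
by exists 0; rewrite (lin0 (comb_linear b)) subr0.
Qed.

Lemma exists_basis_mod s K T : subspace K -> subspace T -> T `<=` K ->
  K `<=` span_list T s -> exists n (b : 'I_n -> V), basis_mod K T b.
Proof.
elim: s K => [|v s IH] K hK hT TK /= Ks.
  have -> : K = T by apply/seteqP.
  by exists 0%N, (fun=> 0); exact: basis_mod_nil.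
pose K' := K `&` span_list T s.
have hK' : subspace K' by apply: subspaceI => //; exact: span_list_subspace.
have TK' : T `<=` K' by move=> x hx; split; [exact: TK|exact: subset_span_list].
have [n [b hb]] := IH K' hK' hT TK' (fun x h => h.2).
have [KK'|] := pselect (K `<=` K').
  by exists n, b; rewrite (_ : K = K') //; apply/seteqP; split=> // x [].
move=> /existsNP [y /not_implyP [yK yK']].
have [a ha] := Ks y yK.
have hsl := span_list_subspace s hT.
have a0 : a != 0.
  by apply/eqP => a0; apply: yK'; split=> //; move: ha; rewrite a0 scale0r subr0.
exists (1 + n)%N; eexists.
apply: (@basis_mod_cat K K' T 1 n (fun=> y) b) => //; first by move=> x [].
apply/basis_modP => //; split=> // [x xK|c].
  (* K is K' plus the line of y: the coordinate of x along y is the quotient of the coefficients of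
     v in x and y. *)
  have [d hd] := Ks x xK; exists (d / a)%:M.
  rewrite /comb big_ord1 mxE eqxx mulr1n; split.
    by apply: subspaceB => //; exact: subspaceZ.
  have -> : x - (d / a) *: y = (x - d *: v) - (d / a) *: (y - a *: v).
    by rewrite scalerBr scalerA divfK // opprB addrA subrK.
  by apply: subspaceB => //; exact: subspaceZ.
rewrite /comb big_ord1 => h; apply/rowP => i; rewrite ord1 mxE.
have [//|c0] := eqVneq (c 0 0) 0; case: yK'.
by rewrite -[y](scalerK c0); exact: subspaceZ.
Qed.

Lemma finite_dim_span_list S : subspace S -> finite_dim S ->
  exists s, S `<=` span_list [set 0] s.
Proof.
move=> hS [n [b /basis_modP []]]//; first exact: subspace_set0.
move=> bS b1 _; exists [seq b i | i <- enum 'I_n] => x /b1 [c /= /eqP].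
rewrite subr_eq0 => /eqP ->; rewrite /comb -big_enum /=.
elim: (enum _) => [|i r IH]; first by rewrite /= big_nil.
by rewrite big_cons; exists (c 0 i); rewrite addrC addrK.
Qed.

(** Guarantees that [trace_mod] does not fall back on its default value for subquotients of a
    finite-dimensional S. *)
Lemma exists_trace S K T f : subspace S -> finite_dim S -> subspace K -> subspace T ->
  T `<=` K -> K `<=` S -> K `<=` f @^-1` K -> exists t, has_trace K T f t.
Proof.
move=> hS fS hK hT TK KS fK; have [s Ss] := finite_dim_span_list hS fS.
have KsT : K `<=` span_list T s.
  move=> x /KS /Ss; elim: s {Ss} x => [x /= ->|v s IH x [a /IH]]; last by exists a.
  exact: subspace_0.
have [n [b hb]] := exists_basis_mod hK hT TK KsT.
move: (hb) => /basis_modP []// bK b1 _.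
have h j : exists c, T (f (b j) - comb b c) by exact/b1/fK.
have {h} [p hp] := choice h.
exists (\tr (\matrix_i p i)); apply/has_traceP; exists n, b, (\matrix_i p i).
by split=> // j; rewrite rowK.
Qed.

End TraceTheory.

Section TraceImage.
Variables (F : fieldType) (V W : lmodType F).

(** A basis of S modulo the kernel of h maps to a basis of h(S), with the same matrix for the
    induced map. *)
Lemma has_trace_image (S : set V) (h : V -> W) (f : V -> V) (f' : W -> W) t :
  subspace S -> linear h -> (forall x, S x -> h (f x) = f' (h x)) ->
  (forall x, S x -> S (f x)) ->
  has_trace S (S `&` [set x | h x = 0]) f t -> has_trace (h @` S) [set 0] f' t.
Proof.
move=> hS hL hf fS /has_traceP [n [b [M [hb hM ->]]]]; apply/has_traceP.
have hk : subspace (S `&` [set x | h x = 0]).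
  by apply: subspaceI => //; exact: (preim_subspace hL (subspace_set0 W)).
have hi := image_subspace hL hS; have h0 := subspace_set0 W.
move: (hb) => /basis_modP []// bS b1 b2.
have hcomb c : h (comb b c) = comb (h \o b) c.
  by rewrite /comb (lin_sum hL); apply: eq_bigr => i _; rewrite (linZ hL).
exists n, (h \o b), M; split=> //; last first.
  by move=> j /=; rewrite -hf // -hcomb -(linB hL); case: (hM j).
apply/basis_modP => //; split.
- by move=> i; exists (b i).
- move=> _ [x xS <-]; have [c [_ hc]] := b1 x xS; exists c.
  by rewrite -hcomb -(linB hL).
- move=> c; rewrite -hcomb => hc; apply: b2; split=> //; exact: comb_sub.
Qed.

End TraceImage.

(** * Traces computed with dual linear forms *)

Section DualBasis.
Variables (F : fieldType) (V : lmodType F) (T : choiceType).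
Variables (r : seq T) (e : T -> V) (phi : T -> V -> F).
Hypothesis phiL : forall j, linear (phi j : V -> F^o).
Hypothesis phiE : forall i j, i \in r -> j \in r -> phi i (e j) = (i == j)%:R.
Hypothesis r_uniq : uniq r.
Let S := span [set e j | j in [set` r]].

Lemma dual_comb x : S x -> x = \sum_(j <- r) phi j x *: e j.
Proof.
move=> hx; apply: (hx [set x | x = \sum_(j <- r) phi j x *: e j]).
split; first split.
- by rewrite /= big1 // => j _; rewrite (lin0 (phiL j)) scale0r.
- move=> a y z /= hy hz; rewrite [y in LHS]hy [z in LHS]hz scaler_sumr -big_split.
  by apply: eq_bigr => j _ /=; rewrite (phiL j) scalerDl scalerA.
- move=> _ [j jr <-]; rewrite /= (bigD1_seq j) //= phiE // eqxx scale1r.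
  rewrite big_seq_cond big1 ?addr0 // => i /andP [ir ij].
  by rewrite phiE // (negbTE ij) scale0r.
Qed.

Lemma dual_eq0 x : S x -> (forall j, j \in r -> phi j x = 0) -> x = 0.
Proof.
by move=> /dual_comb xE h; rewrite xE big_seq big1 // => j /h ->; rewrite scale0r.
Qed.

Lemma dual_sub j : j \in r -> S (e j).
Proof. by move=> jr; apply: sub_span; exists j. Qed.

Let b (i : 'I_(size r)) := e (tnth (in_tuple r) i).

Let combE (g : T -> F) : comb b (\row_i g (tnth (in_tuple r) i)) = \sum_(j <- r) g j *: e j.
Proof.
by rewrite /comb [RHS]big_tnth; apply: eq_bigr => i _; rewrite mxE.
Qed.

Lemma dual_basis : basis_mod S [set 0] b.
Proof.
have hS : subspace S := span_subspace _.
apply/basis_modP; [exact: hS|exact: subspace_set0|split].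
- by move=> i; apply: dual_sub; exact: mem_tnth.
- move=> x hx; exists (\row_i phi (tnth (in_tuple r) i) x).
  by rewrite (combE (phi^~ x)) /= -dual_comb // subrr.
- move=> c /= hc; apply/rowP => i; rewrite mxE.
  have := congr1 (phi (tnth (in_tuple r) i)) hc.
  have off j : j != i -> phi (tnth (in_tuple r) i) (c 0 j *: b j) = 0.
    move=> ji; rewrite (linZ (phiL _)) /b phiE ?mem_tnth //.
    have [x0 _] : exists x0 : T, True by exists (tnth (in_tuple r) i).
    rewrite !(tnth_nth x0) /= nth_uniq //.
    by rewrite -val_eqE eq_sym in ji; rewrite (negbTE ji) scaler0.
  rewrite (lin0 (phiL _)) /comb (lin_sum (phiL _)) (bigD1 i) //=.
  rewrite [X in _ + X]big1 // addr0 (linZ (phiL _)) /b phiE ?mem_tnth // eqxx.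
  by move=> <-; rewrite -[LHS]mulr1.
Qed.

Lemma dual_finite_dim : finite_dim S.
Proof. by exists (size r), b; exact: dual_basis. Qed.

Lemma dual_trace (f : V -> V) : (forall j, j \in r -> S (f (e j))) ->
  has_trace S [set 0] f (\sum_(j <- r) phi j (f (e j))).
Proof.
move=> fS; apply/has_traceP.
exists (size r), b, (\matrix_(i, j) phi (tnth (in_tuple r) j) (f (b i))); split.
- exact: dual_basis.
- move=> i /=; rewrite [X in comb b X](_ : _ =
    \row_j phi (tnth (in_tuple r) j) (f (b i))); last first.
    by apply/rowP => j; rewrite !mxE.
  by rewrite (combE (phi^~ (f (b i)))) -dual_comb ?subrr //; apply: fS; exact: mem_tnth.
- by rewrite big_tnth; apply: eq_bigr => i _; rewrite mxE.
Qed.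

End DualBasis.

(** * Formal series over a semigroup *)

Section OptionSums.
Variable D : addSemigroupType.
Implicit Types (d e : D) (x y z : option D) (s t : seq D).

Lemma oaddA : associative (@oadd D).
Proof. by case=> [a|] [b|] [c|] //=; rewrite Algebra.addrA. Qed.
Lemma oaddC : commutative (@oadd D).
Proof. by case=> [a|] [b|] //=; rewrite Algebra.addrC. Qed.
Lemma oadd0 : left_id None (@oadd D).
Proof. by case. Qed.
HB.instance Definition _ := Monoid.isComLaw.Build (option D) None (@oadd D) oaddA oaddC oadd0.

Lemma osum_cons d s : osum (d :: s) = oadd (Some d) (osum s).
Proof. by rewrite /osum big_cons. Qed.
Lemma osum_cat s t : osum (s ++ t) = oadd (osum s) (osum t).
Proof. by rewrite /osum big_cat. Qed.
Lemma osum_perm s t : perm_eq s t -> osum s = osum t.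
Proof. by move=> st; rewrite /osum; exact: perm_big. Qed.
Lemma osum1 d : osum [:: d] = Some d.
Proof. by rewrite /osum big_seq1. Qed.
Lemma osum_eqN s : osum s = None :> option D -> s = [::].
Proof. by case: s => // d s; rewrite osum_cons; case: (osum s). Qed.

(** The exponent of the n-th power of E^d; n = 0 gives the adjoined unit. *)
Definition odeg (d : D) (n : nat) : option D := osum (nseq n d).

Lemma odegD d m n : odeg d (m + n) = oadd (odeg d m) (odeg d n).
Proof. by rewrite /odeg nseqD osum_cat. Qed.

Lemma odegS d r : odeg d r.+1 = Some (mulS d r).
Proof.
elim: r => [|r IH]; first exact: osum1.
by rewrite /odeg -/(nseq r.+2 d) /= osum_cons -/(odeg d r.+1) IH.
Qed.

Hypothesis Dfin : finite_decompositions D.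

Lemma exists_height x : exists m, (exists2 s, osum s = x & size s = m) /\
  forall s, osum s = x -> (size s <= m)%N.
Proof.
case: x => [d|]; last first.
  exists 0%N; split; first by exists [::] => //; rewrite /osum big_nil.
  by move=> s /osum_eqN ->.
have /finite_seqP [r hr] := Dfin d.
pose P m := `[< exists2 s, osum s = Some d & size s = m >].
have exP : exists m, P m by exists 1%N; apply/asboolP; exists [:: d] => //; exact: osum1.
have ub m : P m -> (m <= \max_(s <- r) size s)%N.
  move=> /asboolP [s hs <-]; apply: leq_bigmax_seq => //.
  by have : [set` r] s by rewrite -hr.
case: (ex_maxnP exP ub) => m /asboolP hm hmax; exists m; split=> // s hs.
by apply: hmax; apply/asboolP; exists s.
Qed.

Definition height x := projT1 (cid (exists_height x)).

Lemma height_max s : (size s <= height (osum s))%N.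
Proof. by rewrite /height; case: cid => m /= [_]; apply. Qed.

Lemma height_attained x : exists2 s, osum s = x & size s = height x.
Proof. by rewrite /height; case: cid => m /= []. Qed.

Lemma height_None : height None = 0%N.
Proof. by have [s /osum_eqN -> <-] := height_attained None. Qed.

(** Longest decompositions of x and y concatenate to a decomposition of their sum. *)
Lemma height_add x y : (height x + height y <= height (oadd x y))%N.
Proof.
have [s <- <-] := height_attained x; have [t <- <-] := height_attained y.
by rewrite -osum_cat -size_cat; exact: height_max.
Qed.

Lemma height_gt0 d : (0 < height (Some d))%N.
Proof. by have := height_max [:: d]; rewrite osum1. Qed.

Lemma height_ltl d e : (height (Some d) < height (Some (d + e)%R))%N.
Proof.
have := height_add (Some d) (Some e); have := height_gt0 e => /= h1 h2.
by apply: leq_trans h2; rewrite -addn1 leq_add2l.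
Qed.

(** If md = nd with m < n, adding (n - m)d leaves the height of md unchanged, although (n - m)d has
    positive height. Hence series in E^d keep the coefficients of one-variable series. *)
Lemma odeg_inj d : injective (odeg d).
Proof.
suff h m n : (m < n)%N -> odeg d m <> odeg d n.
  by move=> m n e; case: (ltngtP m n) => // /h; rewrite e.
move=> mn; rewrite -(subnKC (ltnW mn)) odegD => e.
have := height_add (odeg d m) (odeg d (n - m)); rewrite -e.
have := height_max (nseq (n - m) d); rewrite size_nseq -/(odeg d (n - m)); lia.
Qed.

(** Divisibility once a unit is adjoined: a coefficient of a product at x depends only on the
    coefficients of the factors at divisors of x ([fmul_ext]). *)
Definition odvd y x := exists z, oadd y z = x.

Lemma odvd_height y x : odvd y x -> (height y <= height x)%N.
Proof. by move=> [z <-]; apply: leq_trans (height_add y z); exact: leq_addr. Qed.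

Lemma odvd_trans z y x : odvd z y -> odvd y x -> odvd z x.
Proof. by move=> [a <-] [b <-]; exists (oadd a b); rewrite oaddA. Qed.

Lemma finite_osum x : finite_set [set s : seq D | osum s = x].
Proof.
case: x => [d|]; first exact: Dfin.
by apply: (@sub_finite_set _ _ [set [::]]) => // s /osum_eqN ->.
Qed.

(** A divisor of x starts some decomposition of x, so it occurs in one of finitely many lists. *)
Lemma finite_parts x : finite_set [set d : D | odvd (Some d) x].
Proof.
have /finite_seqP [r hr] := finite_osum x.
apply: (@sub_finite_set _ _ [set` flatten r]); last exact: finite_seq.
move=> d [z hz] /=; have [s sz _] := height_attained z.
apply/flattenP; exists (d :: s); last exact: mem_head.
by have : [set` r] (d :: s) by rewrite -hr /= osum_cons sz.
Qed.

(** Makes the sum in [fmul] a genuine finite sum; a sum with infinite support would be 0 by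
    convention. *)
Lemma finite_oadd x : finite_set [set p : option D * option D | oadd p.1 p.2 = x].
Proof.
have h := finite_parts x.
pose A := None |` [set Some d | d in [set d : D | odvd (Some d) x]].
have hA : finite_set A by rewrite finite_setU; split=> //; exact: finite_image.
apply: sub_finite_set (finite_setX hA hA) => -[a b] /= e; split.
  by case: a e => [d|] e; [right; exists d => //; exists b|left].
by case: b e => [d|] e; [right; exists d => //; exists a; rewrite oaddC|left].
Qed.

End OptionSums.

Section FiniteSets.

Lemma finite_seqs (T : choiceType) (A : set T) n : finite_set A ->
  finite_set [set s : seq T | (size s <= n)%N /\ forall a, a \in s -> A a].
Proof.
move=> fA; elim: n => [|n IH].
  by apply: (@sub_finite_set _ _ [set [::]]) => // s [/=]; case: s.
pose f (p : T * seq T) := p.1 :: p.2.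
apply: (@sub_finite_set _ _ ([set [::]] `|` f @` (A `*` _))); last first.
  by rewrite finite_setU; split=> //; apply: finite_image; apply: finite_setX fA IH.
case=> [|a s] [/= hs h]; first by left.
right; exists (a, s) => //; split=> /=; first by apply: h; rewrite inE eqxx.
by split=> // b bs; apply: h; rewrite inE bs orbT.
Qed.

Lemma fsbig_partition (F : zmodType) (T U : choiceType) (Q : set T) (P : set U)
  (h : T -> U) (f : T -> F) : finite_set Q -> finite_set P ->
  (forall q, Q q -> P (h q)) ->
  \sum_(q \in Q) f q = \sum_(p \in P) \sum_(q \in Q `&` h @^-1` [set p]) f q.
Proof.
move=> fQ fP hQP.
transitivity (\sum_(p \in P) \sum_(q \in Q) if q \in h @^-1` [set p] then f q else 0).
  rewrite exchange_fsbig //; apply: eq_fsbigr => q; rewrite inE => qQ.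
  rewrite (fsbigD1 (h q)) //=; last exact: hQP.
  rewrite ifT ?inE // fsbig1 ?addr0 // => p [_ /= pq].
  by rewrite ifF //; apply/negbTE/negP; rewrite inE /= => /esym.
by apply: eq_fsbigr => p _; rewrite fsbig_mkcondr.
Qed.

End FiniteSets.

Section Gen.
Variables (F : fieldType) (D : addSemigroupType).
Hypothesis Dfin : finite_decompositions D.
Implicit Types (x y z : option D).

Definition fibers_finite (T : choiceType) (A : set T) (delta : T -> option D) :=
  forall x, finite_set (A `&` delta @^-1` [set x]).

(** The generating series of a weighted set with degrees. Identities between series then follow from
    bijections of index sets instead of manipulations of coefficients. *)
Definition gen (T : choiceType) (A : set T) (delta : T -> option D) (w : T -> F)
  : fseries F D := fun x => \sum_(t \in A `&` delta @^-1` [set x]) w t.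

Lemma gen_bij (T T' : choiceType) (A : set T) (A' : set T') d d' w w' (h : T -> T') :
  set_bij A A' h -> (forall t, A t -> d' (h t) = d t) ->
  (forall t, A t -> w' (h t) = w t) -> gen A d w = gen A' d' w'.
Proof.
move=> hh hd hw; apply/funext => x; rewrite /gen.
rewrite (reindex_fsbig h (A `&` d @^-1` [set x])); last first.
  case: hh => h1 h2 h3; split.
  - by move=> t [At /= <-]; split; [exact: h1|rewrite /= hd].
  - by move=> t t' /[!inE] -[At _] [At' _]; apply: h2; rewrite inE.
  - move=> t' [/= /h3 [t At <-] e]; exists t => //; split=> //=.
    by rewrite -hd.
by apply: eq_fsbigr => t; rewrite inE => -[At _]; rewrite hw.
Qed.

Lemma gen_sub (T : choiceType) (A B : set T) d w : A `<=` B ->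
  (forall t, B t -> ~ A t -> w t = 0) -> gen A d w = gen B d w.
Proof.
move=> AB h; apply/funext => x; apply: fsbig_widen.
  by move=> t [At e]; split=> //; exact: AB.
by move=> t [[Bt e] nA]; apply: h => // At; apply: nA.
Qed.

(** The pairs of total degree x are partitioned according to the degrees of their two components. *)
Lemma gen_mul (T U : choiceType) (A : set T) (B : set U) d e w v :
  fibers_finite A d -> fibers_finite B e ->
  fmul (gen A d w) (gen B e v) =
  gen (A `*` B) (fun p => oadd (d p.1) (e p.2)) (fun p => w p.1 * v p.2).
Proof.
move=> fA fB; apply/funext => x; rewrite /fmul.
set P := [set p | _]; have fP : finite_set P := finite_oadd Dfin x.
pose h (q : T * U) := (d q.1, e q.2).
set Q : set (T * U) := (A `*` B) `&` (fun p => oadd (d p.1) (e p.2)) @^-1` [set x].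
have QE (p : option D * option D) : P p ->
    Q `&` h @^-1` [set p] = (A `&` d @^-1` [set p.1]) `*` (B `&` e @^-1` [set p.2]).
  move=> Pp; apply/seteqP; split=> -[a b] /=.
    by move=> [[[/= Aa Bb] _] <-].
  by case: p Pp => p1 p2 /= Pp [[Aa da] [Bb eb]]; subst p1 p2; do 2?split.
have QP q : Q q -> P (h q) by case=> _.
have fQ : finite_set Q.
  apply: (@sub_finite_set _ _ (\bigcup_(p in P) (Q `&` h @^-1` [set p]))).
    by move=> q Qq; exists (h q) => //; exact: QP.
  apply: bigcup_finite => // p Pp; rewrite QE //.
  by apply: finite_setX; [exact: fA|exact: fB].
rewrite [RHS](fsbig_partition _ fQ fP QP); apply: eq_fsbigr => p; rewrite inE => Pp.
rewrite QE // -(@pair_fsbig F 0 _ T U _ _ (fun a b => w a * v b)); [|exact: fA|exact: fB].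
rewrite /gen mulr_fsuml; apply: eq_fsbigr => a _.
by rewrite mulr_fsumr.
Qed.

Lemma gen_mul_fibers (T U : choiceType) (A : set T) (B : set U) d e :
  fibers_finite A d -> fibers_finite B e ->
  fibers_finite (A `*` B) (fun p => oadd (d p.1) (e p.2)).
Proof.
move=> fA fB x; have fP := finite_oadd Dfin x.
apply: (@sub_finite_set _ _ (\bigcup_(p in [set p | oadd p.1 p.2 = x])
   ((A `&` d @^-1` [set p.1]) `*` (B `&` e @^-1` [set p.2])))).
  by move=> [a b] [[/= Aa Bb] <-]; exists (d a, e b).
by apply: bigcup_finite => // p _; apply: finite_setX; [exact: fA|exact: fB].
Qed.

(** Every series is a generating series, indexed by the exponents themselves; this turns the ring
    laws into bijections. *)
Lemma gen_id (s : fseries F D) : s = gen [set: option D] id s.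
Proof.
apply/funext => x; rewrite /gen (_ : _ `&` _ = [set x]) ?fsbig_set1 //.
by apply/seteqP; split=> // y [].
Qed.

Lemma fibers_id : fibers_finite [set: option D] id.
Proof.
move=> x; rewrite (_ : _ `&` _ = [set x]) //.
by apply/seteqP; split=> // y [].
Qed.

Let fid := fibers_id.

Lemma fmulC (s t : fseries F D) : fmul s t = fmul t s.
Proof.
rewrite [s]gen_id [t]gen_id !gen_mul //.
apply: (@gen_bij _ _ _ _ _ _ _ _ (fun p => (p.2, p.1))).
- split=> //; first by move=> [a b] [c d] _ _ [-> ->].
  by move=> [a b] _; exists (b, a).
- by move=> [a b] _; exact: oaddC.
- by move=> [a b] _; exact: mulrC.
Qed.

Lemma fmulA (s t u : fseries F D) : fmul s (fmul t u) = fmul (fmul s t) u.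
Proof.
have f2 := gen_mul_fibers fid fid.
rewrite [s]gen_id [t]gen_id [u]gen_id (gen_mul _ _ fid fid) (gen_mul _ _ fid f2).
rewrite (gen_mul _ _ fid fid) (gen_mul _ _ f2 fid).
apply: (@gen_bij _ _ _ _ _ _ _ _ (fun p => ((p.1, p.2.1), p.2.2))).
- split=> //; first by move=> [a [b c]] [d [e f]] _ _ [-> -> ->].
  by move=> [[a b] c] _; exists (a, (b, c)).
- by move=> [a [b c]] _ /=; rewrite oaddA.
- by move=> [a [b c]] _ /=; rewrite mulrA.
Qed.

Lemma gen_unit : gen [set tt] (fun=> None) (fun=> 1) = fone :> fseries F D.
Proof.
apply/funext => x; rewrite /gen /fone /fmono; case: eqP => [->|xN].
  rewrite (_ : _ `&` _ = [set tt]) ?fsbig_set1 //.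
  by apply/seteqP; split=> // y [].
by rewrite fsbig1 // => t [_ /= e]; case: xN.
Qed.

Lemma fmul1 (s : fseries F D) : fmul fone s = s.
Proof.
rewrite [s]gen_id -gen_unit gen_mul //; last first.
  by move=> x; apply: (@sub_finite_set _ _ [set tt]) => // t [].
apply/esym/(@gen_bij _ _ _ _ _ _ _ _ (fun x => (tt, x))) => [|t _|t _] /=.
- split=> //; first by move=> a b _ _ [].
  by move=> [[] a] _; exists a.
- by [].
- by rewrite mul1r.
Qed.

Lemma fmul_ext (s s' t t' : fseries F D) x :
  (forall y, odvd y x -> s y = s' y) -> (forall y, odvd y x -> t y = t' y) ->
  fmul s t x = fmul s' t' x.
Proof.
move=> h h'; apply: eq_fsbigr => -[a b]; rewrite inE /= => e.
by rewrite h ?h' //; [exists a; rewrite oaddC|exists b].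
Qed.

Lemma fmulDl (s t u : fseries F D) x :
  fmul (fun y => s y + t y) u x = fmul s u x + fmul t u x.
Proof.
rewrite /fmul -fsbig_split; last exact: finite_oadd.
by apply: eq_fsbigr => p _; rewrite mulrDl.
Qed.

Lemma fmul_suml (I : Type) (r : seq I) (c : I -> F) (s : I -> fseries F D) u x :
  fmul (fun y => \sum_(i <- r) c i * s i y) u x = \sum_(i <- r) c i * fmul (s i) u x.
Proof.
elim: r => [|i r IH].
  rewrite big_nil /fmul fsbig1 // => p _; by rewrite big_nil mul0r.
rewrite big_cons -IH /fmul mulr_fsumr -fsbig_split; last exact: finite_oadd.
by apply: eq_fsbigr => p _; rewrite big_cons mulrDl mulrA.
Qed.

End Gen.

(** * Power series in one variable and their exponentials *)

Section OneVariable.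
Variable F : numFieldType.
Implicit Types (s t u : nat -> F) (n : nat).

Definition conv s t : nat -> F := fun n => \sum_(i < n.+1) s i * t (n - i)%N.
Definition deriv_seq s : nat -> F := fun n => n.+1%:R * s n.+1.
Definition one_seq : nat -> F := fun n => (n == 0)%:R.
Definition cpow s n := iter n (conv s) one_seq.
(** The sum stops at m = n because s is meant to have no constant term, so that s^m has order at
    least m ([cpow_small]). *)
Definition cexp s : nat -> F := fun n => \sum_(m < n.+1) (m`!%:R)^-1 * cpow s m n.

Let tr N s : {poly F} := \poly_(i < N) s i.

(** Polynomials of size N see all coefficients of index n < N, and commutativity, associativity and
    the Leibniz rule are inherited from them. *)
Lemma conv_poly N s t n : (n < N)%N -> conv s t n = (tr N s * tr N t)`_n.
Proof.
move=> nN; rewrite coefM; apply: eq_bigr => i _.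
have iN : (i < N)%N by apply: leq_ltn_trans nN; rewrite -ltnS.
by rewrite !coef_poly iN (leq_ltn_trans (leq_subr _ _) nN).
Qed.

Lemma convC s t : conv s t = conv t s.
Proof. by apply/funext => n; rewrite !(@conv_poly n.+1) // mulrC. Qed.

Lemma convA s t u : conv s (conv t u) = conv (conv s t) u.
Proof.
apply/funext => n.
transitivity ((tr n.+1 s * (tr n.+1 t * tr n.+1 u))`_n).
  rewrite coefM; apply: eq_bigr => i _.
  by rewrite coef_poly ltn_ord (@conv_poly n.+1) // ltnS leq_subr.
rewrite mulrA coefM; apply: eq_bigr => i _.
by rewrite [in RHS](@conv_poly n.+1) // coef_poly ltnS leq_subr.
Qed.

Lemma deriv_conv s t n :
  deriv_seq (conv s t) n = conv (deriv_seq s) t n + conv s (deriv_seq t) n.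
Proof.
rewrite /deriv_seq (@conv_poly n.+2) // mulr_natl -coef_deriv derivM coefD !coefM.
congr (_ + _); apply: eq_bigr => i _; have hi := ltn_ord i;
  rewrite coef_deriv !coef_poly.
  rewrite ifT; last lia.
  by rewrite ifT ?mulr_natl //; lia.
rewrite ifT; last lia.
by rewrite ifT ?mulr_natl //; lia.
Qed.

Lemma conv0 s t : conv s t 0 = s 0%N * t 0%N.
Proof. by rewrite /conv big_ord_recl big_ord0 addr0 subn0. Qed.

Lemma convDl s t u n : conv (fun i => s i + t i) u n = conv s u n + conv t u n.
Proof. by rewrite /conv -big_split; apply: eq_bigr => i _ /=; rewrite mulrDl. Qed.

Lemma cpow_small s m n : s 0%N = 0 -> (n < m)%N -> cpow s m n = 0.
Proof.
move=> s0; elim: m n => // m IH n nm; rewrite /cpow /= -/(cpow s m) /conv.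
rewrite big_ord_recl s0 mul0r add0r big1 // => i _.
by rewrite IH ?mulr0 //= /bump; have := ltn_ord i; lia.
Qed.

Lemma deriv_cpow s m n :
  deriv_seq (cpow s m.+1) n = m.+1%:R * conv (deriv_seq s) (cpow s m) n.
Proof.
elim: m n => [|m IH] n.
  rewrite mul1r /cpow /= deriv_conv -[RHS]addr0; congr (_ + _).
  by rewrite /conv big1 // => i _; rewrite /deriv_seq /one_seq /= !mulr0.
rewrite [LHS]deriv_conv -/(cpow s m.+1) (_ : deriv_seq (cpow s m.+1) =
  fun n => m.+1%:R * conv (deriv_seq s) (cpow s m) n); last first.
  by apply/funext => k; rewrite -IH.
rewrite (_ : conv s _ n = m.+1%:R * conv (deriv_seq s) (cpow s m.+1) n); last first.
  rewrite {2}/cpow /= convA [conv _ s]convC -convA /conv mulr_sumr.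
  by apply: eq_bigr => i _; rewrite mulrCA.
by rewrite -[m.+2%:R]natr1 mulrDl mul1r addrC.
Qed.

Lemma deriv_cexp s n : s 0%N = 0 -> deriv_seq (cexp s) n = conv (deriv_seq s) (cexp s) n.
Proof.
(* A common bound N for all indices k < N, needed to exchange the two sums. *)
move=> s0; have E k N : (k < N)%N -> cexp s k = \sum_(m < N) (m`!%:R)^-1 * cpow s m k.
  move=> kN; rewrite /cexp (big_ord_widen N (fun m => (m`!%:R)^-1 * cpow s m k)) //.
  rewrite big_mkcond; apply: eq_bigr => i _; case: ltnP => // ki.
  by rewrite cpow_small ?mulr0.
transitivity (\sum_(m < n.+1) (m`!%:R)^-1 * conv (deriv_seq s) (cpow s m) n).
  rewrite /deriv_seq /cexp big_ord_recl mulrDr /cpow /= mulr0 mulr0 add0r mulr_sumr.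
  apply: eq_bigr => m _; rewrite -/(cpow s m.+1) mulrCA -/(deriv_seq _ n) deriv_cpow.
  rewrite factS natrM invfM mulrA; congr (_ * _).
  by rewrite -mulrA mulrCA mulVf ?mulr1 // pnatr_eq0.
under eq_bigr do rewrite mulr_sumr.
rewrite exchange_big /=; apply: eq_bigr => i _.
rewrite (E _ n.+1) ?ltnS ?leq_subr // mulr_sumr; apply: eq_bigr => m _.
by rewrite mulrCA.
Qed.

(* If s' = - p and h' = p h, then exp(s) h has derivative zero. *)
Lemma cexp_inv s h p : s 0%N = 0 -> h 0%N = 1 ->
  (forall n, deriv_seq s n = - p n) -> (forall n, deriv_seq h n = conv p h n) ->
  conv (cexp s) h = one_seq.
Proof.
move=> s0 h0 ds dh; apply/funext => -[|n].
  rewrite conv0 h0 mulr1 /cexp big_ord_recl big_ord0 addr0 fact0 invr1 mul1r.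
  by rewrite /cpow.
have : deriv_seq (conv (cexp s) h) n = 0.
  rewrite deriv_conv (_ : deriv_seq (cexp s) = conv (deriv_seq s) (cexp s)); last first.
    by apply/funext => k; exact: deriv_cexp.
  rewrite (_ : deriv_seq h = conv p h); last exact/funext.
  rewrite convA [conv _ p]convC -convDl {1}/conv big1 // => i _.
  by rewrite -convDl {1}/conv big1 ?mul0r // => j _; rewrite ds addNr mul0r.
by move=> /eqP; rewrite mulf_eq0 pnatr_eq0 /= => /eqP.
Qed.

End OneVariable.

(** * Ordered monomials *)

Section OneVariableEmbedding.
Variables (F : numFieldType) (D : addSemigroupType).
Hypothesis Dfin : finite_decompositions D.
Variable d : D.
Implicit Types (s t : nat -> F).

(** Substitution of E^d for the variable; coefficients can be read back because [odeg d] is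
    injective. *)
Definition subst_mono s : fseries F D := gen [set: nat] (odeg d) s.

Lemma odeg_fiber n : [set: nat] `&` odeg d @^-1` [set odeg d n] = [set n].
Proof.
by apply/seteqP; split=> [m [_ /= /(odeg_inj Dfin)]|m ->].
Qed.

Lemma subst_mono_odeg s n : subst_mono s (odeg d n) = s n.
Proof. by rewrite /subst_mono /gen odeg_fiber fsbig_set1. Qed.

Lemma subst_mono_out s x : (forall n, x <> odeg d n) -> subst_mono s x = 0.
Proof. by move=> h; rewrite /subst_mono /gen fsbig1 // => n [_ /= e]; case: (h n). Qed.

Lemma odeg_fibers : fibers_finite [set: nat] (odeg d).
Proof.
move=> x; have [[n <-]|h] := pselect (exists n, odeg d n = x).
  by rewrite odeg_fiber.
by apply: (@sub_finite_set _ _ set0) => // n [_ /= e]; apply: h; exists n.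
Qed.

Lemma subst_mono_mul s t : fmul (subst_mono s) (subst_mono t) = subst_mono (conv s t).
Proof.
have hf := odeg_fibers.
rewrite /subst_mono gen_mul //; apply/funext => x.
have [[n <-]|h] := pselect (exists n, odeg d n = x); last first.
  rewrite [RHS]subst_mono_out; last by move=> n e; apply: h; exists n.
  rewrite /gen fsbig1 // => -[i j] [_ /= e]; case: h; exists (i + j)%N.
  by rewrite odegD.
rewrite [RHS]subst_mono_odeg /conv /gen (fsbig_ord _ n.+1 (fun i => s i * t (n - i)%N)).
rewrite (reindex_fsbig (fun i => (i, n - i)%N) `I_n.+1) //; split.
- move=> i /= hi; split=> //=; rewrite -odegD; congr odeg; lia.
- by move=> i j _ _ [].
- move=> [i j] [_ /=]; rewrite -odegD => /(odeg_inj Dfin) e; exists i => /=; first lia.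
  congr (_, _); lia.
Qed.

Lemma subst_mono_one : subst_mono (one_seq F) = fone.
Proof.
apply/funext => x; rewrite /fone /fmono.
have [[n <-]|h] := pselect (exists n, odeg d n = x).
  rewrite subst_mono_odeg /one_seq; congr (nat_of_bool _)%:R.
  by case: n => [|n]; rewrite ?odegS // /odeg /osum big_nil.
rewrite subst_mono_out; last by move=> n e; apply: h; exists n.
case: eqP => // xN; case: h; exists 0%N; by rewrite /odeg /osum big_nil.
Qed.

Lemma subst_mono_pow s n : fpow (subst_mono s) n = subst_mono (cpow s n).
Proof.
elim: n => [|n IH]; first by rewrite /fpow /= -subst_mono_one.
by rewrite /fpow /= -/(fpow _ n) IH subst_mono_mul.
Qed.

(** At the exponent nd only the powers m <= n contribute, so the infinite sum in [fexp] reduces to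
    the truncated one in [cexp]. *)
Lemma fexp_subst_mono s : s 0%N = 0 -> fexp (subst_mono s) = subst_mono (cexp s).
Proof.
move=> s0; apply/funext => x; rewrite /fexp /fsum /fscale.
have [[n <-]|h] := pselect (exists n, odeg d n = x); last first.
  have h' n : x <> odeg d n by move=> e; apply: h; exists n.
  rewrite subst_mono_out // fsbig1 // => n _.
  by rewrite subst_mono_pow subst_mono_out ?mulr0.
rewrite subst_mono_odeg /cexp (fsbig_ord _ n.+1 (fun m => (m`!%:R)^-1 * cpow s m n)).
rewrite -(@fsbig_widen _ _ 0 +%R `I_n.+1 setT) //.
  by apply: eq_fsbigr => m _; rewrite subst_mono_pow subst_mono_odeg.
move=> m [_ /= /negP]; rewrite -leqNgt => nm.
by rewrite subst_mono_pow subst_mono_odeg cpow_small ?mulr0.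
Qed.

(** The index r stands for the exponent (r + 1)d, hence the shift and the zero constant term. *)
Lemma series_subst_mono (a : nat -> F) :
  fsum (fun r : nat => fscale (a r) (fmono (Some (mulS d r)))) =
  subst_mono (fun n => if n is r.+1 then a r else 0).
Proof.
apply/funext => x; rewrite /fsum /fscale /fmono.
have [[[|n] <-]|h] := pselect (exists n, odeg d n = x); last 1 first.
- rewrite subst_mono_out; last by move=> n e; apply: h; exists n.
  rewrite fsbig1 // => r _; case: eqP => [e|]; last by rewrite mulr0.
  by case: h; exists r.+1; rewrite odegS.
- rewrite subst_mono_odeg fsbig1 // => r _; rewrite -odegS.
  by case: eqP => [/(odeg_inj Dfin)//|]; rewrite mulr0.
rewrite subst_mono_odeg -(@fsbig_widen _ _ 0 +%R [set n] setT) //.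
  by rewrite fsbig_set1 odegS eqxx mulr1.
move=> r [_ /= rn]; rewrite -odegS.
by case: eqP => [/(odeg_inj Dfin)[]e|]; [case: rn|rewrite mulr0].
Qed.

End OneVariableEmbedding.

(** * Generating series of ordered words *)

Section Words.
Variables (F : numFieldType) (D : addSemigroupType).
Hypothesis Dfin : finite_decompositions D.
Variables (I : choiceType) (disp : Order.disp_t) (K : orderType disp) (key : I -> K).
Hypothesis key_inj : injective key.
Variables (ev : pred I) (deg : I -> D) (om : I -> F).
Hypothesis deg_fin : forall d, finite_set [set i | deg i = d].
Implicit Types (i j : I) (w : seq I).

(* Odd letters may not be repeated in an ordered monomial. *)
Definition lei i j := (key i < key j)%O || ((i == j) && ev i).
Lemma leiE i j : lei i j = (key i < key j)%O || ((i == j) && ev i).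
Proof. by []. Qed.

Definition wdeg w := osum (map deg w).
Definition wt w := \prod_(i <- w) om i.
Definition words (p : pred I) : set (seq I) := [set w | sorted lei w /\ all p w].

Lemma wdeg_nil : wdeg [::] = None.
Proof. by rewrite /wdeg /osum big_nil. Qed.

Lemma wdeg_cons i w : wdeg (i :: w) = oadd (Some (deg i)) (wdeg w).
Proof. exact: osum_cons. Qed.

Lemma wdeg_cat w w' : wdeg (w ++ w') = oadd (wdeg w) (wdeg w').
Proof. by rewrite /wdeg map_cat osum_cat. Qed.

Lemma size_wdeg w : (size w <= height Dfin (wdeg w))%N.
Proof. by have := height_max Dfin (map deg w); rewrite size_map. Qed.

Lemma odvd_letter i w : i \in w -> odvd (Some (deg i)) (wdeg w).
Proof.
move=> iw; exists (wdeg (rem i w)); rewrite -wdeg_cons.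
by apply: osum_perm; apply: perm_map; rewrite perm_sym; exact: perm_to_rem.
Qed.

Lemma lei_trans : transitive lei.
Proof.
move=> j i k /orP [ij|/andP [/eqP <- ei]] //; rewrite /lei => /orP [jk|/andP [/eqP <- ej]].
  by rewrite (lt_trans ij jk).
by rewrite ij.
Qed.

Lemma lei_anti : antisymmetric lei.
Proof.
move=> i j /andP [/orP [ij|/andP [/eqP //]]] /orP [ji|/andP [/eqP //]].
by have := lt_trans ij ji; rewrite ltxx.
Qed.

Lemma finite_letters x : finite_set [set i | odvd (Some (deg i)) x].
Proof.
apply: (@sub_finite_set _ _ (\bigcup_(d in [set d | odvd (Some d) x]) [set i | deg i = d])).
  by move=> i hi; exists (deg i).
by apply: bigcup_finite => //; exact: finite_parts.
Qed.

Lemma finite_words x : finite_set [set w | wdeg w = x].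
Proof.
apply: sub_finite_set (finite_seqs (height Dfin x) (finite_letters x)) => w /= <-.
by split; [exact: size_wdeg|move=> i; exact: odvd_letter].
Qed.

Lemma words_fibers (A : set (seq I)) : fibers_finite A wdeg.
Proof. by move=> x; apply: sub_finite_set (finite_words x) => w [_]. Qed.

Definition lek i j := (key i <= key j)%O.

Lemma lek_total : total lek. Proof. by move=> i j; exact: le_total. Qed.
Lemma lek_trans : transitive lek. Proof. by move=> i j k; exact: le_trans. Qed.

(** Separates the order from the bound on multiplicities: the former is restored by [sort], the
    latter is invariant under permutation. *)
Lemma sorted_leiP w : reflect (sorted lek w /\ forall i, ~~ ev i -> (count_mem i w <= 1)%N)
  (sorted lei w).
Proof.
apply: (iffP idP) => [sw|[]].
  split=> [|i ei].
    apply: sub_sorted sw => i j /orP [/ltW //|/andP [/eqP -> _]]; exact: lexx.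
  move: sw; rewrite (sorted_pairwise lei_trans); elim: w => //= j w IH /andP [jw /IH].
  case: eqP => [ji _|_ //]; rewrite leqNgt; apply/negP => h.
  have : i \in w by rewrite -has_pred1 has_count.
  by move=> /(allP jw); rewrite ji /lei ltxx eqxx (negbTE ei).
rewrite (sorted_pairwise lek_trans) (sorted_pairwise lei_trans).
elim: w => //= j w IH /andP [jw sw] h; rewrite IH //; last first.
  by move=> i /h; apply: leq_trans; exact: leq_addl.
rewrite andbT; apply/allP => k kw; have := allP jw _ kw.
rewrite /lek le_eqVlt => /orP [/eqP /key_inj e|hl]; last by rewrite /lei hl.
subst k; rewrite /lei eqxx; case: (boolP (ev j)) => [_|/h]; first by rewrite orbT.
by rewrite eqxx add1n ltnS leqn0 -leqn0 leqNgt -has_count has_pred1 kw.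
Qed.

(** An ordered word is determined by its subwords in [p] and in [q]; conversely two such subwords
    are merged by sorting their concatenation. *)
Lemma gen_words_split (p q : pred I) : (forall i, p i -> ~~ q i) ->
  gen (words (predU p q)) wdeg wt =
  fmul (gen (words p) wdeg wt) (gen (words q) wdeg wt).
Proof.
move=> pq; rewrite (gen_mul Dfin); try exact: words_fibers.
have perm w : all (predU p q) w -> perm_eq w (seq.filter p w ++ seq.filter q w).
  move=> aw; rewrite perm_sym (_ : seq.filter q w = seq.filter (predC p) w).
    exact: permEl (perm_filterC p w).
  apply: eq_in_filter => i iw /=.
  have := allP aw _ iw => /=; case: (boolP (p i)) => [/pq/negbTE -> //|_ /= ->] //.
apply: (@gen_bij _ _ _ _ _ _ _ _ _ _ (fun w => (seq.filter p w, seq.filter q w))).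
- split.
  + move=> w [sw aw]; split=> /=; (split; last exact: filter_all).
      exact: sorted_filter lei_trans _ _ sw.
    exact: sorted_filter lei_trans _ _ sw.
  + move=> w w' /[!inE] -[sw aw] [sw' aw'] [e1 e2].
    apply: (sorted_eq lei_trans lei_anti sw sw').
    by apply: (perm_trans (perm _ aw)); rewrite e1 e2 perm_sym; exact: perm.
  + move=> [w1 w2] [[/= s1 a1] [/= s2 a2]].
    have f12 : seq.filter p (w1 ++ w2) = w1.
      rewrite filter_cat (all_filterP a1) (eq_in_filter (a2 := pred0)).
        by rewrite filter_pred0 cats0.
      by move=> i /(allP a2) qi /=; apply/negbTE/negP => /pq; rewrite qi.
    have f21 : seq.filter q (w1 ++ w2) = w2.
      rewrite filter_cat (all_filterP a2) (eq_in_filter (a2 := pred0)).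
        by rewrite filter_pred0.
      by move=> i /(allP a1) /pq /negbTE.
    pose w := sort lek (w1 ++ w2).
    have ww : perm_eq w (w1 ++ w2) by rewrite perm_sort.
    have sw : sorted lei w.
      apply/sorted_leiP; split=> [|i ei]; first exact: sort_sorted lek_total _.
      rewrite (permP ww) count_cat.
      have /sorted_leiP [_ /(_ i ei) h1] := s1; have /sorted_leiP [_ /(_ i ei) h2] := s2.
      have [i1|i1] := boolP (i \in w1); last first.
        by rewrite (count_memPn i1).
      rewrite (count_memPn (_ : i \notin w2)) ?addn0 //.
      by apply/negP => /(allP a2) qi; have := pq _ (allP a1 _ i1); rewrite qi.
    have fE r w0 : sorted lei w0 -> seq.filter r (w1 ++ w2) = w0 -> seq.filter r w = w0.
      move=> s0 e; apply: (sorted_eq lei_trans lei_anti) => //.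
        exact: sorted_filter lei_trans _ _ sw.
      by rewrite -e; exact: perm_filter.
    exists w; last by rewrite (fE p w1) // (fE q w2).
    split=> //; rewrite (perm_all _ ww) all_cat; apply/andP; split.
      by apply: sub_all a1 => i /= ->.
    by apply: sub_all a2 => i /= ->; rewrite orbT.
- move=> w [sw aw] /=; rewrite -wdeg_cat; apply: osum_perm; apply: perm_map.
  by rewrite perm_sym; exact: perm.
- move=> w [sw aw] /=; rewrite /wt -big_cat; apply: perm_big.
  by rewrite perm_sym; exact: perm.
Qed.

Lemma gen_words0 : gen (words pred0) wdeg wt = fone.
Proof.
rewrite -gen_unit; apply/esym/(@gen_bij _ _ _ _ _ _ _ _ _ _ (fun=> [::])) => [||] //.
- split; first by move=> t _; split.
    by move=> [] [].
  by move=> [|i w] [_] //; exists tt.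
- by move=> _ _; rewrite /wdeg /osum big_nil.
- by move=> _ _; rewrite /wt big_nil.
Qed.

Lemma eq_words (p q : pred I) : p =1 q -> words p = words q.
Proof.
by move=> pq; apply/seteqP; split=> w [sw aw]; split=> //; move: aw; rewrite (eq_all pq).
Qed.

(** The coefficients of 1 / (1 - om t) for an even letter and of 1 + om t for an odd one. *)
Definition letter_seq i : nat -> F := fun n => if ev i || (n <= 1)%N then om i ^+ n else 0.
(* The logarithmic derivative of letter_seq. *)
Definition letter_log i : nat -> F := fun n =>
  if ev i then om i ^+ n.+1 else - (- om i) ^+ n.+1.

Lemma gen_words1 i : gen (words (pred1 i)) wdeg wt = subst_mono (deg i) (letter_seq i).
Proof.
rewrite /subst_mono -(@gen_sub _ _ _ [set n | ev i || (n <= 1)%N]) //; last first.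
  by move=> n _ /negP /negbTE /= h; rewrite /letter_seq h.
apply/esym/(@gen_bij _ _ _ _ _ _ _ _ _ _ (fun n => nseq n i)).
- split.
  + move=> n /= hn; split; last by apply/allP => j; rewrite mem_nseq => /andP [_ /eqP ->] /=.
    apply/sorted_leiP; split.
      by rewrite (sorted_pairwise lek_trans); elim: n {hn} => //= n ->;
         rewrite andbT; apply/allP => j; rewrite mem_nseq => /andP [_ /eqP ->]; exact: lexx.
    move=> j ej; rewrite count_nseq /=; case: eqP => [ij|]; last by rewrite mul0n.
    by rewrite mul1n; move: hn; rewrite ij (negbTE ej).
  + by move=> n m _ _ /(congr1 size); rewrite !size_nseq.
  + move=> w [sw aw]; have ew := all_pred1P _ _ aw; exists (size w) => //=.
    case: (boolP (ev i)) => // ei; have /sorted_leiP [_ /(_ i ei)] := sw.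
    by rewrite ew count_nseq /= eqxx mul1n size_nseq.
- by move=> n _; rewrite /wdeg map_nseq.
- by move=> n /= h; rewrite /letter_seq h /wt big_nseq iter_mulr_1.
Qed.

Lemma deriv_letter i n : deriv_seq (letter_seq i) n = conv (letter_log i) (letter_seq i) n.
Proof.
rewrite /deriv_seq /letter_seq /letter_log /conv; case: (ev i) => /=.
  rewrite (eq_bigr (fun=> om i ^+ n.+1)) => [|j _]; last first.
    by rewrite -exprD; congr (_ ^+ _); have := ltn_ord j; lia.
  by rewrite sumr_const card_ord mulr_natl.
case: n => [|n]; first by rewrite big_ord_recl big_ord0 subnn /= !expr1 expr0 addr0 opprK mulr1 mul1r.
rewrite ltnNge /= mulr0 !big_ord_recr /= big1 => [|j _].
  by rewrite subSnn subnn expr0 expr1 mulr1 add0r !exprS /=; ring.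
by rewrite ifF ?mulr0 //; have := ltn_ord j; lia.
Qed.

Definition letters_seq l := foldr (fun i s => conv (letter_seq i) s) (one_seq F) l.

Lemma gen_words_letters d l : uniq l -> all (fun i => deg i == d) l ->
  gen (words (mem l)) wdeg wt = subst_mono d (letters_seq l).
Proof.
elim: l => [|i l IH] /=.
  move=> _ _; rewrite subst_mono_one // -gen_words0; congr gen; exact: eq_words.
move=> /andP [il ul] /andP [/eqP di dl]; rewrite -subst_mono_mul // -IH //.
rewrite -di -gen_words1 -gen_words_split; last by move=> j /= /eqP ->.
by congr gen; apply: eq_words => j; rewrite /= inE.
Qed.

Lemma deriv_letters l n : deriv_seq (letters_seq l) n =
  conv (fun n => \sum_(i <- l) letter_log i n) (letters_seq l) n.
Proof.
elim: l n => [|i l IH] n /=.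
  by rewrite /deriv_seq /one_seq /= mulr0 /conv big1 // => k _; rewrite big_nil mul0r.
rewrite deriv_conv (_ : deriv_seq (letter_seq i) = conv (letter_log i) (letter_seq i));
  last by apply/funext => k; exact: deriv_letter.
pose S n := \sum_(i <- l) letter_log i n.
rewrite (_ : deriv_seq (letters_seq l) = conv S (letters_seq l)); last exact/funext.
rewrite -convA (convA (letter_seq i)) (convC (letter_seq i) S) -convA -convDl.
congr (conv _ _ n); apply/funext => k.
by rewrite big_cons.
Qed.

Lemma letters_seq0 l : letters_seq l 0 = 1.
Proof.
elim: l => //= i l IH; rewrite conv0 IH mulr1 /letter_seq.
by rewrite orbT expr0.
Qed.

(** The last condition says that s' is minus the logarithmic derivative of the series of words in
    letters of degree d, so [cexp_inv] applies. *)
Lemma fexp_words d l (s : nat -> F) : uniq l -> (forall i, (i \in l) = (deg i == d)) ->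
  s 0%N = 0 -> (forall n, n.+1%:R * s n.+1 = - \sum_(i <- l) letter_log i n) ->
  fmul (fexp (subst_mono d s)) (gen (words (fun i => deg i == d)) wdeg wt) = fone.
Proof.
move=> ul dl s0 hs; rewrite (eq_words (q := mem l)); last by move=> i; rewrite /= dl.
rewrite (gen_words_letters (d := d)) //; last by apply/allP => i; rewrite dl.
rewrite fexp_subst_mono // subst_mono_mul // (@cexp_inv _ s _ _ s0 _ hs).
- exact: subst_mono_one.
- exact: letters_seq0.
- exact: deriv_letters.
Qed.

Lemma big_fmul_words (E : D -> fseries F D) (r : seq D) : uniq r ->
  (forall d, fmul (E d) (gen (words (fun i => deg i == d)) wdeg wt) = fone) ->
  fmul (\big[@fmul F D/fone]_(d <- r) E d) (gen (words (fun i => deg i \in r)) wdeg wt) = fone.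
Proof.
move=> + hE; elim: r => [_|d r IH /= /andP [dr ur]].
  by rewrite big_nil fmul1 // -gen_words0; congr gen; exact: eq_words.
rewrite big_cons (eq_words (q := predU (fun i => deg i == d) (fun i => deg i \in r)));
  last by move=> i; rewrite /= inE.
rewrite gen_words_split; last by move=> i /= /eqP ->.
set S := gen _ _ _; set U := gen _ _ _; set P := \big[_/_]_(_ <- _) _.
rewrite -(fmulA Dfin) [fmul P _](fmulA Dfin) [fmul P S](fmulC Dfin) -(fmulA Dfin S).
by rewrite IH // [fmul S _](fmulC Dfin) fmul1.
Qed.

(** These words index a basis of the augmentation ideal. *)
Definition pwords : set (seq I) := [set w | sorted lei w /\ w != [::]].
Definition sdeg (s : seq (seq I)) : option D := \big[@oadd D/None]_(w <- s) wdeg w.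
Definition swt (s : seq (seq I)) : F := \prod_(w <- s) wt w.
(* Indexes a basis of the degree k term of the reduced bar complex. *)
Definition bars k : set (seq (seq I)) := [set s | size s = k /\ forall w, w \in s -> pwords w].

Lemma sdeg_nil : sdeg [::] = None.
Proof. exact: big_nil. Qed.

Lemma sdeg_cons w s : sdeg (w :: s) = oadd (wdeg w) (sdeg s).
Proof. by rewrite /sdeg big_cons. Qed.

Lemma odvd_word w s : w \in s -> odvd (wdeg w) (sdeg s).
Proof. by move=> ws; rewrite /sdeg (big_rem w) //=; eexists. Qed.

(** Each nonempty word contributes at least 1 to the height. Hence, in a fixed degree, the bar
    complex stops at the height of that degree. *)
Lemma size_sdeg s : (forall w, w \in s -> w != [::]) -> (size s <= height Dfin (sdeg s))%N.
Proof.
elim: s => //= w s IH h; rewrite sdeg_cons.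
apply: leq_trans (height_add Dfin _ _); rewrite -add1n leq_add //.
  have := h w (mem_head _ _); case: w {h} => // i w _.
  by apply: leq_trans (size_wdeg (i :: w)).
by apply: IH => v vs; apply: h; rewrite inE vs orbT.
Qed.

Lemma finite_bars k x : finite_set (bars k `&` sdeg @^-1` [set x]).
Proof.
have fin : finite_set [set w | odvd (wdeg w) x].
  have h : finite_set (None |` [set Some d | d in [set d | odvd (Some d) x]]).
    by rewrite finite_setU; split=> //; apply: finite_image; exact: finite_parts.
  apply: sub_finite_set (bigcup_finite h (fun y _ => finite_words y)) => w wx.
  exists (wdeg w) => //; move: wx => /=.
  by case: (wdeg w) => [d|]; [right; exists d|left].
apply: sub_finite_set (finite_seqs k fin) => s [[<- _] /= <-].
by split=> // w; exact: odvd_word.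
Qed.

Lemma gen_bars0 : gen (bars 0) sdeg swt = fone.
Proof.
rewrite -gen_unit; apply/esym/(@gen_bij _ _ _ _ _ _ _ _ _ _ (fun=> [::])) => [||] //.
- split; first by move=> t _; split.
    by move=> [] [].
  by move=> [|w s] [] // _ _; exists tt.
- by move=> _ _; rewrite /sdeg big_nil.
- by move=> _ _; rewrite /swt big_nil.
Qed.

Lemma gen_barsS k : gen (bars k.+1) sdeg swt = fmul (gen pwords wdeg wt) (gen (bars k) sdeg swt).
Proof.
rewrite gen_mul //; [|exact: words_fibers|exact: finite_bars].
apply/esym/(@gen_bij _ _ _ _ _ _ _ _ _ _ (fun p => p.1 :: p.2)).
- split.
  + move=> [w s] [/= hw [sk hs]]; split=> /=; first by rewrite sk.
    by move=> v; rewrite inE => /orP [/eqP -> //|/hs].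
  + by move=> [w s] [w' s'] _ _ [-> ->].
  + move=> [|w s] [//= [sk] hs]; exists (w, s) => //; split=> /=.
      by apply: hs; exact: mem_head.
    by split=> // v vs; apply: hs; rewrite inE vs orbT.
- by move=> [w s] _; rewrite sdeg_cons.
- by move=> [w s] _; rewrite /swt big_cons.
Qed.

Lemma gen_bars_small k x : (height Dfin x < k)%N -> gen (bars k) sdeg swt x = 0.
Proof.
move=> hk; rewrite /gen fsbig1 // => s [[sk hs] /= e].
have := @size_sdeg s (fun w ws => (hs w ws).2); rewrite e sk; lia.
Qed.

Let u := gen (words predT) wdeg wt.

Lemma gen_words_pwords x : u x = fone x + gen pwords wdeg wt x.
Proof.
rewrite /u {1}/gen (fsbigID [set [::]]); last exact: words_fibers.
congr (_ + _); last first.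
  apply: eq_fsbigl; apply/seteqP; split=> w [].
    by move=> [[sw _] e] /eqP w0; split.
  by move=> [sw /eqP w0] e; split=> //; split=> //; split=> //; exact/allP.
rewrite /fone /fmono; case: eqP => [->|xN].
  rewrite (_ : _ `&` _ = [set [::]]) ?fsbig_set1; first by rewrite /wt big_nil.
  apply/seteqP; split=> [w []//|w ->]; split=> //; split; first by split.
  by rewrite /= /wdeg /osum big_nil.
rewrite fsbig1 // => w [[_ /= e] /= w0]; case: xN.
by rewrite -e w0 /wdeg /osum big_nil.
Qed.

(** With p the series of nonempty words, u = 1 + p and the series of [bars k] is p^k, so the
    alternating sum times u telescopes. Admitting every N above the height lets one truncation serve
    all divisors of x. *)
Lemma words_inverse (omH : fseries F D) :
  (forall x N, (height Dfin x <= N)%N ->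
     omH x = \sum_(k < N.+1) (-1) ^+ k * gen (bars k) sdeg swt x) ->
  fmul omH u = fone.
Proof.
move=> hH; apply/funext => x; set N := height Dfin x.
pose c k := gen (bars k) sdeg swt.
rewrite (@fmul_ext _ _ _ (fun y => \sum_(k < N.+1) (-1) ^+ k * c k y) _ u x) //; last first.
  by move=> y /(odvd_height Dfin) yx; exact: hH.
rewrite (fmul_suml Dfin).
have step k : fmul (c k) u x = c k x + c k.+1 x.
  rewrite fmulC // (_ : u = fun x => fone x + gen pwords wdeg wt x); last first.
    by apply/funext => y; exact: gen_words_pwords.
  by rewrite fmulDl // fmul1 // /c gen_barsS.
have tele M : \sum_(k < M) (-1) ^+ k * fmul (c k) u x = c 0%N x - (-1) ^+ M * c M x.
  elim: M => [|M IH]; first by rewrite big_ord0 expr0 mul1r subrr.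
  by rewrite big_ord_recr /= IH step exprS; ring.
by rewrite tele {2}/c gen_bars_small // mulr0 subr0 /c gen_bars0.
Qed.

(** Once r contains every degree dividing x, words with letters of degree in r account for all
    coefficients of u at divisors of x. The partial product over r is the inverse of their series,
    hence agrees with the inverse of u at x. *)
Lemma fprod_words (E : D -> fseries F D) (omH : fseries F D) :
  (forall d, fmul (E d) (gen (words (fun i => deg i == d)) wdeg wt) = fone) ->
  fmul omH u = fone -> is_fprod E omH.
Proof.
move=> hE hu x; have /finite_seqP [r0 hr0] := finite_parts Dfin x.
exists r0 => r ur sub.
pose P := \big[@fmul F D/fone]_(d <- r) E d.
pose U := gen (words (fun i => deg i \in r)) wdeg wt.
have PU : fmul P U = fone by exact: big_fmul_words.
have uU y : odvd y x -> u y = U y.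
  move=> yx; apply: eq_fsbigl; apply/seteqP; split=> w [[sw aw] e].
    split=> //; split=> //; apply/allP => i /odvd_letter.
    rewrite e => iy; apply: sub.
    by have : [set` r0] (deg i) by rewrite -hr0; exact: odvd_trans iy yx.
  by split=> //; split=> //; exact/allP.
transitivity (fmul (fmul P u) omH x).
  by rewrite -fmulA // [fmul u _]fmulC // hu fmulC // fmul1.
rewrite (@fmul_ext _ _ _ fone _ omH x) ?fmul1 // => y yx.
rewrite -PU; apply: fmul_ext => // z zy.
by rewrite uU //; exact: odvd_trans zy yx.
Qed.

End Words.

(** * The Poincare-Birkhoff-Witt theorem *)

Section Coordinates.
Variables (F : fieldType) (L : lmodType F) (I : choiceType).
Variables (x : I -> L) (xi : I -> L -> F).
Hypothesis xi_lin : forall i, linear (xi i : L -> F^o).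
Hypothesis xi_fin : forall v, finite_set [set i | xi i v != 0].
Hypothesis xi_sum : forall v, v = \sum_(i \in [set: I]) xi i v *: x i.
Hypothesis xi_x : forall i j, xi i (x j) = (i == j)%:R.

Definition ext (W : lmodType F) (h : I -> W) (v : L) : W :=
  \sum_(i \in [set: I]) xi i v *: h i.

Definition supp (v : L) : seq I := enum_fset (fset_set [set i | xi i v != 0]).

Lemma mem_supp v i : (i \in supp v) = (xi i v != 0).
Proof.
transitivity (i \in fset_set [set i | xi i v != 0]); first by [].
by rewrite in_fset_set //; apply/idP/idP; rewrite inE.
Qed.

Lemma extE (W : lmodType F) (h : I -> W) v (r : seq I) :
  uniq r -> {subset supp v <= r} -> ext h v = \sum_(i <- r) xi i v *: h i.
Proof.
move=> ur sub; rewrite /ext (fsbigE r) //; last first.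
  move=> i _ ir; have : i \notin supp v by apply: contra ir; exact: sub.
  by rewrite mem_supp negbK => /eqP ->; rewrite scale0r.
by apply: eq_bigl => i; rewrite in_setT.
Qed.

Lemma supp_uniq v : uniq (supp v). Proof. exact: fset_uniq. Qed.

Lemma ext_supp (W : lmodType F) (h : I -> W) v :
  ext h v = \sum_(i <- supp v) xi i v *: h i.
Proof. by apply: extE => //; exact: supp_uniq. Qed.

Lemma ext_linear (W : lmodType F) (h : I -> W) : linear (ext h).
Proof.
move=> a v w; pose r := undup (supp v ++ supp w ++ supp (a *: v + w)).
rewrite !(@extE _ _ _ r) ?undup_uniq //; try by
  move=> i hi; rewrite mem_undup !mem_cat hi ?orbT.
rewrite scaler_sumr -big_split; apply: eq_bigr => i _ /=.
by rewrite xi_lin scalerDl scalerA.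
Qed.

Lemma ext_linear_fun (W : lmodType F) (h h' : I -> W) a v :
  ext (fun i => a *: h i + h' i) v = a *: ext h v + ext h' v.
Proof.
rewrite !ext_supp scaler_sumr -big_split; apply: eq_bigr => i _ /=.
by rewrite scalerDr !scalerA mulrC.
Qed.

Lemma ext_x (W : lmodType F) (h : I -> W) i : ext h (x i) = h i.
Proof.
rewrite (@extE _ _ _ [:: i]) //; last first.
  by move=> j; rewrite mem_supp xi_x inE; have [//|_] := eqVneq j i; rewrite eqxx.
by rewrite big_seq1 xi_x eqxx scale1r.
Qed.

Lemma ext_id v : ext x v = v. Proof. exact/esym/xi_sum. Qed.

Lemma lin_ext (W W' : lmodType F) (f : W -> W') (h : I -> W) v : linear f ->
  f (ext h v) = ext (f \o h) v.
Proof.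
move=> fL; rewrite !ext_supp (lin_sum fL); apply: eq_bigr => i _.
exact: linZ.
Qed.

Lemma lin_eq_ext (W : lmodType F) (f : L -> W) v : linear f -> f v = ext (f \o x) v.
Proof. by move=> fL; rewrite -[v in LHS]ext_id (lin_ext _ _ fL). Qed.

Lemma ext_mem (W : lmodType F) (S : set W) (h : I -> W) v : subspace S ->
  (forall i, xi i v != 0 -> S (h i)) -> S (ext h v).
Proof.
move=> hS hh; rewrite ext_supp; apply: subspace_sum => // i + _.
by rewrite mem_supp => /hh; exact: subspaceZ.
Qed.

Lemma eq_ext (W : lmodType F) (h h' : I -> W) v :
  (forall i, xi i v != 0 -> h i = h' i) -> ext h v = ext h' v.
Proof.
move=> e; rewrite !ext_supp big_seq [RHS]big_seq; apply: eq_bigr => i.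
by rewrite mem_supp => /e ->.
Qed.

Lemma ext_exchange (W : lmodType F) (h : I -> I -> W) u v :
  ext (fun i => ext (h i) v) u = ext (fun j => ext (h^~ j) u) v.
Proof.
rewrite !ext_supp; under eq_bigr do rewrite ext_supp scaler_sumr.
rewrite exchange_big; apply: eq_bigr => j _ /=; rewrite ext_supp scaler_sumr.
by apply: eq_bigr => i _; rewrite !scalerA mulrC.
Qed.

End Coordinates.

Section TensorFacts.
Variables (F : fieldType) (V : lmodType F).

Lemma tword_nil : tword [::] = 1 :> tensoralg V. Proof. exact: big_nil. Qed.
Lemma tword_cons (v : V) s : tword (v :: s) = tgen v * tword s. Proof. exact: big_cons. Qed.
Lemma tword_cat (s t : seq V) : tword (s ++ t) = tword s * tword t.
Proof. exact: big_cat. Qed.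

Lemma tensor_span (t : tensoralg V) : span (range (@tword F V)) t.
Proof.
have hw (w : {fmonom V}) : qpi (tensor_ideal V) (mkmalgU w 1 : freealg V) = tword w.
  case: w => w /=; elim: w => [|v w IH].
    rewrite tword_nil -[RHS](rmorph1 (qpi (tensor_ideal V))); congr qpi.
    by congr mkmalgU; apply/val_inj; rewrite /= fm1.
  rewrite tword_cons -IH /tgen -rmorphM mulUU; congr (qpi (tensor_ideal V) (mkmalgU _ _)).
  by apply/val_inj; rewrite /= fmM fmU.
have hS : subspace (span (range (@tword F V))) by exact: span_subspace.
suff h r : span (range (@tword F V)) (qpi (tensor_ideal V) r).
  by rewrite -[t](qpi_reprK (J := tensor_ideal V)); exact: h.
rewrite [r]freealgE linear_sum; apply: (@subspace_sum F (tensoralg V) _ _ _ _ _ hS) => w _ _.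
rewrite linearZ; apply: (@subspaceZ F (tensoralg V) _ _ _ hS).
by rewrite /= hw; apply: sub_span; exists w.
Qed.

Lemma tensor_ind (W : lmodType F) (h h' : tensoralg V -> W) :
  linear h -> linear h' -> (forall s, h (tword s) = h' (tword s)) -> h =1 h'.
Proof.
move=> hL hL' e t; suff : [set t | h t = h' t] t by [].
apply: (tensor_span t); split; last first.
  by move=> _ [s _ <-]; exact: e.
split=> [|a y z /= hy hz]; first by rewrite /= (lin0 hL) (lin0 hL').
by rewrite hL hL' hy hz.
Qed.

End TensorFacts.

(** A relation of U(L) between two words, split into three words; used with s and r the prefix and
    the suffix. *)
Lemma sandwich_commutator (F : fieldType) (B : algType F) (s X Y Z r : B) (c : F) :
  s * (X - (Y - c *: Z)) * r = c *: (s * Z * r) + (s * X * r - s * Y * r).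
Proof.
by rewrite opprB mulrDr mulrDl mulrBr mulrBl -scalerAr -scalerAl addrCA.
Qed.

Section QuotientFacts.
Variables (F : fieldType) (B : algType F) (J : proper_two_sided B).

Definition qlift (W : lmodType F) (h : B -> W) (q : quotalg J) : W := h (repr q).

Lemma qlift_pi (W : lmodType F) (h : B -> W) t : linear h ->
  (forall t, pts_set J t -> h t = 0) -> qlift h (qpi J t) = h t.
Proof.
by move=> hL hJ; apply/eqP; rewrite -subr_eq0 -(linB hL); apply/eqP/hJ/repr_qpi.
Qed.

Lemma qlift_linear (W : lmodType F) (h : B -> W) : linear h ->
  (forall t, pts_set J t -> h t = 0) -> linear (qlift h).
Proof.
move=> hL hJ a y z; rewrite -[y](qpi_reprK (J := J)) -[z](qpi_reprK (J := J)).
by rewrite -linearP !qlift_pi // hL.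
Qed.

End QuotientFacts.

Section AdaptedBasis.
Variables (F : numFieldType) (Gam : addSemigroupType) (A : zmodType).
Variables (theta : A -> A -> F).
Variables (L : lmodType F) (Lg : Gam * A -> set L) (br : L -> L -> L).
Variables (I : choiceType) (disp : Order.disp_t) (K : orderType disp) (key : I -> K).
Variables (deg : I -> (Gam * A)%type) (x : I -> L) (xi : I -> L -> F).

(* xi i v is the coordinate of v along x i; by ab_key_br, the bracket of two
   letters only involves later letters. *)
Record adapted_basis : Prop := {
  ab_coloring : coloring theta;
  ab_lie : color_lie theta Lg br;
  ab_key_inj : injective key;
  ab_deg : forall i, Lg (deg i) (x i);
  ab_lin : forall i, linear (xi i : L -> F^o);
  ab_fin : forall v, finite_set [set i | xi i v != 0];
  ab_sum : forall v, v = \sum_(i \in [set: I]) xi i v *: x i;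
  ab_dual : forall i j, xi i (x j) = (i == j)%:R;
  ab_hom : forall d v i, Lg d v -> xi i v != 0 -> deg i = d;
  ab_key_br : forall i j k, deg k = deg i + deg j -> (key i < key k)%O }.

End AdaptedBasis.

Section PBW.
Variables (F : numFieldType) (Gam : addSemigroupType) (A : zmodType).
Variables (theta : A -> A -> F).
Variables (L : lmodType F) (Lg : Gam * A -> set L) (br : L -> L -> L).
Variables (I : choiceType) (disp : Order.disp_t) (K : orderType disp) (key : I -> K).
Variables (deg : I -> (Gam * A)%type) (x : I -> L) (xi : I -> L -> F).
Hypothesis H : adapted_basis theta Lg br key deg x xi.
Let theta_coloring := ab_coloring H.
Let L_color_lie := ab_lie H.
Let key_inj := ab_key_inj H.
Let x_deg := ab_deg H.
Let xi_lin := ab_lin H.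
Let xi_fin := ab_fin H.
Let xi_sum := ab_sum H.
Let xi_x := ab_dual H.
Let xi_deg := ab_hom H.
Let key_br := ab_key_br H.

Notation ext := (ext xi).
Notation th i j := (theta (deg i).2 (deg j).2).
Notation ev := (fun i => th i i == 1).
Notation lei := (lei key ev).
Notation wdeg := (wdeg deg).
Notation "[ u ; v ]" := (br u v) (at level 0, format "[ u ;  v ]").

Lemma brl y : linear (br^~ y). Proof. exact: color_lie_linearl L_color_lie y. Qed.
Lemma brr y : linear (br y). Proof. exact: color_lie_linearr L_color_lie y. Qed.
Lemma br_deg i j : Lg (deg i + deg j) [x i; x j].
Proof. exact: color_lie_degree L_color_lie _ _ _ _ (x_deg i) (x_deg j). Qed.
Lemma br_letter i j k : xi k [x i; x j] != 0 -> deg k = deg i + deg j.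
Proof. exact/xi_deg/br_deg. Qed.
Lemma br_keyl i j k : xi k [x i; x j] != 0 -> (key i < key k)%O.
Proof. by move=> /br_letter /key_br. Qed.
Lemma br_keyr i j k : xi k [x i; x j] != 0 -> (key j < key k)%O.
Proof. by move=> /br_letter; rewrite Algebra.addrC => /key_br. Qed.

Lemma thN i : ~~ ev i -> th i i = -1.
Proof.
move=> /negbTE h; have /eqP := coloring_skew theta_coloring (deg i).2 (deg i).2.
by rewrite -expr2 sqrf_eq1 h /= => /eqP.
Qed.

Lemma two_neq0 : (2 : F) != 0. Proof. by rewrite pnatr_eq0. Qed.

(* The value at x_i z_N of the linear map which sends each ordered monomial z_M
   of U(L) to f M, computed by moving x_i to its place in N. Brackets only produce
   later letters, so it is a structural recursion; f M for unordered M is junk. *)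
Fixpoint act (W : lmodType F) (f : seq I -> W) (i : I) (N : seq I) {struct N} : W :=
  match N with
  | [::] => f [:: i]
  | j :: N' =>
      if lei i j then f [:: i, j & N']
      else if i == j then 2^-1 *: ext (fun k => act f k N') [x i; x i]
      else th i j *: act (fun w => f (j :: w)) i N' + ext (fun k => act f k N') [x i; x j]
  end.

Lemma act_linear_fun (W : lmodType F) (f g : seq I -> W) a i N :
  act (fun w => a *: f w + g w) i N = a *: act f i N + act g i N.
Proof.
elim: N i f g => //= j N IH i f g; case: ifP => // _.
have e : (fun k => act (fun w => a *: f w + g w) k N) =
    (fun k => a *: act f k N + act g k N) by apply/funext => k; exact: IH.
rewrite e !ext_linear_fun //; case: ifP => _.
  by rewrite scalerDr !scalerA mulrC.
by rewrite IH !scalerDr !scalerA [a * _]mulrC addrACA.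
Qed.

Lemma act_0 (W : lmodType F) i N : act (fun=> 0 : W) i N = 0.
Proof.
have := act_linear_fun (fun=> 0 : W) (fun=> 0) (-1) i N.
by rewrite scaler0 addr0 scaleN1r addNr.
Qed.

Lemma act_scale (W : lmodType F) (f : seq I -> W) a i N :
  act (fun w => a *: f w) i N = a *: act f i N.
Proof.
rewrite -[RHS]addr0 -(act_0 W i N) -act_linear_fun; congr (act _ i N).
by apply/funext => w; rewrite addr0.
Qed.

Lemma act_map (W W' : lmodType F) (h : W -> W') (f : seq I -> W) i N : linear h ->
  h (act f i N) = act (h \o f) i N.
Proof.
move=> hL; elim: N i f => //= j N IH i f; case: ifP => // _.
have e u : h (ext (fun k => act f k N) u) = ext (fun k => act (h \o f) k N) u.
  by rewrite (lin_ext _ _ _ hL) //; congr (ext _ _); apply/funext => k; exact: IH.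
case: ifP => _; first by rewrite (linZ hL) e.
by rewrite (linD hL) (linZ hL) e IH.
Qed.

(* Which monomials occur in x_i z_N. *)
Lemma act_mem (W : lmodType F) (S : set W) (Q : pred I) (f : seq I -> W) i N :
  subspace S -> (forall j k, Q j -> (key j < key k)%O -> Q k) ->
  Q i -> all Q N -> sorted lei N ->
  (forall w, sorted lei w -> all Q w -> wdeg w = wdeg (i :: N) ->
     (size w <= size N)%N || perm_eq w (i :: N) -> S (f w)) ->
  S (act f i N).
Proof.
move=> hS; elim: N i f Q => [|j N IH] i f Q Qup Qi /= QN sN hf.
  by apply: hf; rewrite ?perm_refl ?orbT //= Qi.
move: QN => /andP [Qj QN].
have sN' : sorted lei N by exact: path_sorted sN.
case: ifP => [ij|ij]; first by apply: hf; rewrite //= ?ij ?Qi ?Qj // perm_refl orbT.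
have hbr : S (ext (fun k => act f k N) [x i; x j]).
  apply: ext_mem => // k hk; apply: (IH _ _ Q) => //.
    exact: Qup Qi (br_keyl hk).
  move=> w sw Qw dw hw; apply: hf => //.
    by rewrite dw !wdeg_cons oaddA /= (br_letter hk).
  apply/orP; left; case/orP: hw => [/leqW //|/perm_size -> //].
case: ifP => [/eqP e|ne]; first by apply: subspaceZ => //; rewrite -e in hbr.
apply: subspaceD => //; apply: subspaceZ => //.
have lt := @lei_trans I disp K key ev.
(* The strengthened predicate keeps all letters allowed after j, so that prefixing j again gives
   ordered words. *)
apply: (IH _ _ (fun k => Q k && lei j k)).
- move=> k l /andP [Qk jk] kl; rewrite (Qup _ _ Qk kl); apply: lt jk _.
  by rewrite leiE kl.
- rewrite Qi leiE /=; move/negbT: ij; rewrite negb_or => /andP [+ _].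
  by rewrite -leNgt le_eqVlt => /orP [/eqP/key_inj e|-> //]; rewrite e eqxx in ne.
- apply/allP => k kN; rewrite (allP QN) //=.
  by have /allP := order_path_min lt sN; apply.
- by [].
- move=> w sw; rewrite all_predI => /andP [Qw jw] dw hw; apply: hf => /=.
  + by rewrite path_sortedE // jw.
  + by rewrite Qj.
  + rewrite !wdeg_cons dw wdeg_cons !oaddA; congr oadd; exact: oaddC.
  + case/orP: hw => [h|h]; first by rewrite ltnS h.
    apply/orP; right; apply: (@perm_trans _ (j :: i :: N)); first by rewrite perm_cons.
    exact: permEl (perm_catCA [:: j] [:: i] N).
Qed.

(** This is [act_mem] for the difference of [f] and [g] and the zero subspace. *)
Lemma act_ext (W : lmodType F) (Q : pred I) (f g : seq I -> W) i N :
  (forall j k, Q j -> (key j < key k)%O -> Q k) ->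
  Q i -> all Q N -> sorted lei N ->
  (forall w, sorted lei w -> all Q w -> wdeg w = wdeg (i :: N) ->
     (size w <= size N)%N || perm_eq w (i :: N) -> f w = g w) ->
  act f i N = act g i N.
Proof.
move=> Qup Qi QN sN fg; apply/eqP; rewrite -subr_eq0 addrC -scaleN1r.
rewrite -act_linear_fun; apply/eqP.
apply: (act_mem (subspace_set0 W) Qup) => // w h1 h2 h3 h4.
by rewrite /= (fg w) // scaleN1r addNr.
Qed.

Lemma act_cons (W : lmodType F) (f : seq I -> W) i N : sorted lei (i :: N) ->
  act f i N = f (i :: N).
Proof. by case: N => //= j N /andP [-> _]. Qed.

(* The right action of L on functions of ordered monomials which is dual to left
   multiplication. *)
Definition av (W : lmodType F) (f : seq I -> W) (v : L) (N : seq I) : W :=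
  ext (fun k => act f k N) v.

Lemma avE (W : lmodType F) (f : seq I -> W) v N : av f v N = ext (fun k => act f k N) v.
Proof. by []. Qed.

Lemma av_x (W : lmodType F) (f : seq I -> W) i N : av f (x i) N = act f i N.
Proof. exact: ext_x. Qed.

Lemma av_linear (W : lmodType F) (f : seq I -> W) N : linear (fun v => av f v N).
Proof. exact: ext_linear. Qed.

Lemma av_linear_fun (W : lmodType F) (f g : seq I -> W) a v N :
  av (fun w => a *: f w + g w) v N = a *: av f v N + av g v N.
Proof.
rewrite /av -ext_linear_fun //; congr (ext _ _); apply/funext => k.
exact: act_linear_fun.
Qed.

Lemma act_ext_fun (W : lmodType F) (g : I -> seq I -> W) u j N :
  act (fun w => ext (g^~ w) u) j N = ext (fun i => act (g i) j N) u.
Proof.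
rewrite ext_supp //.
transitivity (act (fun w => \sum_(i <- supp xi u) xi i u *: g i w) j N).
  by congr (act _ j N); apply/funext => w; rewrite ext_supp.
elim: (supp xi u) => [|i r IH].
  rewrite big_nil -[RHS](act_0 W j N).
  by congr (act _ j N); apply/funext => w; rewrite big_nil.
rewrite big_cons -IH -act_linear_fun; congr (act _ j N).
by apply/funext => w; rewrite big_cons.
Qed.

Lemma act_ext_val (W : lmodType F) (f : seq I -> W) u j N :
  act (av f u) j N = ext (fun i => act (act f i) j N) u.
Proof. exact: act_ext_fun. Qed.

Lemma av_av (W : lmodType F) (f : seq I -> W) u v N :
  av (av f u) v N = ext (fun j => ext (fun i => act (act f i) j N) u) v.
Proof.
by rewrite {1}/av; congr (ext _ _); apply/funext => j; exact: act_ext_val.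
Qed.

Lemma br_ext u v : [u; v] = ext (fun j => ext (fun i => [x i; x j]) u) v.
Proof.
rewrite (lin_eq_ext xi_fin xi_sum v (brr u)); congr (ext _ _); apply/funext => j /=.
by rewrite (lin_eq_ext xi_fin xi_sum u (brl (x j))).
Qed.

(** The outer index acts first on N: [act (act f i) j N] stands for the value at x_i x_j z_N. The
    statement is thus the defining relation of U(L) tested on z_N, the consistency condition behind
    the Poincare-Birkhoff-Witt theorem. *)
Definition relation_at (N : seq I) := forall (W : lmodType F) (f : seq I -> W) i j,
  act (act f i) j N = th i j *: act (act f j) i N + av f [x i; x j] N.

(** Bilinearity extends the relation from letters, because theta is constant on pairs of
    components. *)
Lemma relation_hom N d e u v : relation_at N -> Lg d u -> Lg e v ->
  forall (W : lmodType F) (f : seq I -> W),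
  av (av f u) v N = theta d.2 e.2 *: av (av f v) u N + av f [u; v] N.
Proof.
move=> hN du ev W f; rewrite !av_av [in X in _ = _ + X]br_ext.
rewrite (lin_ext _ _ _ (av_linear f N)) // [ext _ u in X in _ *: X]ext_exchange //.
rewrite -ext_linear_fun //; apply: eq_ext => // j jv /=.
rewrite (lin_ext _ _ _ (av_linear f N)) // -ext_linear_fun //; apply: eq_ext => // i iu /=.
by rewrite hN (xi_deg du iu) (xi_deg ev jv).
Qed.

Lemma th_skew i j : th i j * th j i = 1. Proof. exact: coloring_skew theta_coloring _ _. Qed.

Lemma br_skew i j : [x i; x j] = - (th i j *: [x j; x i]).
Proof. exact: color_lie_skew L_color_lie _ _ _ _ (x_deg i) (x_deg j). Qed.

(** Exchanges the roles of i and j through theta(a,b) theta(b,a) = 1, so only the case where j does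
    not come after i has to be checked. *)
Lemma relation_sym (W : lmodType F) (f : seq I -> W) i j N :
  act (act f i) j N = th i j *: act (act f j) i N + av f [x i; x j] N ->
  act (act f j) i N = th j i *: act (act f i) j N + av f [x j; x i] N.
Proof.
move=> ->; rewrite scalerDr scalerA [th j i * _]mulrC th_skew scale1r -addrA.
rewrite [[x i; _]]br_skew (linN (av_linear f N)) (linZ (av_linear f N)) scalerN scalerA.
by rewrite [th j i * _]mulrC th_skew scale1r addNr addr0.
Qed.

Lemma ltW_lei i j : (key i < key j)%O -> lei i j.
Proof. by rewrite leiE => ->. Qed.

Lemma br_even i : ev i -> [x i; x i] = 0.
Proof.
move=> /eqP e; have := br_skew i i; rewrite e scale1r => /eqP.
rewrite -subr_eq0 opprK -mulr2n -scaler_nat scaler_eq0 (negbTE two_neq0) /=.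
by move=> /eqP.
Qed.

(** Here x_j z_N is the ordered monomial with letters j :: N, and the relation is the clause of
    [act] which moves x_i past j, or squares an odd letter. *)
Lemma relation_head (W : lmodType F) (f : seq I -> W) i j N :
  sorted lei (j :: N) -> (key j < key i)%O || (i == j) ->
  act (act f i) j N = th i j *: act (act f j) i N + av f [x i; x j] N.
Proof.
case: (eqVneq i j) => [<- sN _|ij sN].
  case: (boolP (ev i)) => [ei|oi].
    rewrite br_even // (lin0 (av_linear f N)) addr0; move/eqP: ei => ->.
    by rewrite scale1r.
  rewrite thN // scaleN1r addrC; apply/eqP; rewrite -subr_eq opprK -mulr2n -scaler_nat.
  rewrite act_cons //= leiE ltxx eqxx (negbTE oi) /= scalerA mulfV ?two_neq0 //.
  by rewrite scale1r.
rewrite orbF => ji; rewrite [LHS]act_cons //=.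
have -> : lei i j = false by rewrite leiE lt_gtF // (negbTE ij).
rewrite (negbTE ij); congr (_ *: _ + _).
have lt := @lei_trans I disp K key ev.
(* All words that occur consist of letters allowed after j, where acting by x_j only puts j in
   front. *)
apply/esym/(@act_ext _ (lei j)).
- by move=> k l jk kl; apply: lt jk _; exact: ltW_lei.
- exact: ltW_lei.
- exact: order_path_min lt sN.
- exact: path_sorted sN.
- by move=> w sw jw _ _; rewrite act_cons //= path_sortedE // jw.
Qed.

Lemma th_addl i j k : theta (deg i + deg j).2 (deg k).2 = th i k * th j k.
Proof. exact: coloring_addl theta_coloring _ _ _. Qed.
Lemma th_addr i j k : theta (deg i).2 (deg j + deg k).2 = th i j * th i k.
Proof. exact: coloring_addr theta_coloring _ _ _. Qed.

(** The form with x_k on the right of x_i and x_j, as needed when both are moved past a first letter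
    k. *)
Lemma jacobi i j k :
  [x i; [x j; x k]] = [[x i; x j]; x k] - th j k *: [[x i; x k]; x j].
Proof.
rewrite (color_lie_jacobi L_color_lie _ (x_deg i) (x_deg j)); congr (_ + _).
rewrite (color_lie_skew L_color_lie (x_deg j) (br_deg i k)) th_addr.
by rewrite scalerN scalerA mulrA th_skew mul1r.
Qed.

Lemma br_odd i k : ~~ ev k -> [x i; [x k; x k]] = 2 *: [[x i; x k]; x k].
Proof.
by move=> ok; rewrite jacobi thN // scaleN1r opprK scaler_nat mulr2n.
Qed.

(** With y = [[x_k; x_k]; x_k], the Jacobi identity gives [x_k; [x_k; x_k]] = 2y and skew symmetry
    gives y = - [x_k; [x_k; x_k]]. Hence 3y = 0. *)
Lemma br_odd3 k : ~~ ev k -> [[x k; x k]; x k] = 0.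
Proof.
move=> ok; have h := br_odd k ok.
have := color_lie_skew L_color_lie (br_deg k k) (x_deg k).
rewrite th_addl th_skew scale1r h => /eqP; rewrite -subr_eq0 opprK.
rewrite -[X in X + _]scale1r -scalerDl scaler_eq0 => /orP [|/eqP //].
by rewrite addrC natr1 pnatr_eq0.
Qed.

Lemma act_gt (W : lmodType F) (f : seq I -> W) i k P : (key k < key i)%O ->
  act f i (k :: P) = th i k *: act (fun w => f (k :: w)) i P + av f [x i; x k] P.
Proof.
move=> ki /=; have ik : i == k = false.
  by apply/negbTE/eqP => e; move: ki; rewrite e ltxx.
by rewrite leiE (lt_gtF ki) ik.
Qed.

Lemma act_odd (W : lmodType F) (f : seq I -> W) k P : ~~ ev k ->
  act f k (k :: P) = 2^-1 *: av f [x k; x k] P.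
Proof. by move=> /negbTE ok /=; rewrite leiE ltxx eqxx ok. Qed.

Lemma av_gt (W : lmodType F) (f : seq I -> W) u d k P : Lg d u ->
  (forall m, xi m u != 0 -> (key k < key m)%O) ->
  av f u (k :: P) =
  theta d.2 (deg k).2 *: av (fun w => f (k :: w)) u P + av f [u; x k] P.
Proof.
move=> du hu.
have lk : linear (fun v => av f [v; x k] P).
  by move=> a v w; rewrite brl (av_linear f P).
rewrite (lin_eq_ext xi_fin xi_sum u lk).
rewrite /av -ext_linear_fun //; apply: eq_ext => // m hm.
by rewrite act_gt ?hu // (xi_deg du hm).
Qed.

(** As k is odd, every letter of P comes strictly after k. The words that occur then have only
    letters after k, and putting k in front of them is the action of x_k. *)
Lemma av_odd_cons (W : lmodType F) (f : seq I -> W) u k P : ~~ ev k ->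
  sorted lei (k :: P) -> (forall m, xi m u != 0 -> (key k < key m)%O) ->
  av (fun w => f (k :: w)) u P = av (act f k) u P.
Proof.
move=> ok sP hu; apply: eq_ext => // m /hu km.
have lt := @lei_trans I disp K key ev.
apply/esym/(@act_ext _ (fun j => (key k < key j)%O)) => //.
- by move=> j l kj /(lt_trans kj).
- apply/allP => j jP; have /allP /(_ _ jP) := order_path_min lt sP.
  by rewrite leiE (negbTE ok) andbF orbF.
- exact: path_sorted sP.
- move=> w sw kw _ _; rewrite act_cons //= path_sortedE // sw andbT.
  by apply: sub_all kw => j; exact: ltW_lei.
Qed.

Lemma av_x_fun (W : lmodType F) (f : seq I -> W) i : av f (x i) = act f i.
Proof. by apply/funext => w; exact: av_x. Qed.

(** The overlap check: x_i x_j z_P with a further first letter k can be reduced in two ways, and the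
    discrepancy is an instance of the Jacobi identity. *)
Lemma relation_step k P : sorted lei (k :: P) -> relation_at P -> relation_at (k :: P).
Proof.
move=> sN hP W f i j.
wlog ji : i j / (key j <= key i)%O.
  move=> h; have [|/ltW] := leP (key j) (key i); first exact: h.
  by move=> ij; apply: relation_sym; exact: h.
have ji' : (key j < key i)%O || (i == j).
  by move: ji; rewrite le_eqVlt => /orP [/eqP/key_inj ->|->]; rewrite ?eqxx ?orbT.
have [jk|] := boolP (lei j k).
  by apply: relation_head => //=; rewrite jk.
rewrite leiE negb_or -leNgt le_eqVlt => /andP [/orP [/eqP/key_inj e|kj] ojk].
  (* Here j = k is odd and meets itself: x_j x_j becomes half a bracket, and [br_odd] supplies the
     matching factor 2. *)
  subst k; have oj : ~~ ev j by move: ojk; rewrite eqxx.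
  have tjj := thN oj.
  case/orP: ji' => [{}ji|/eqP e].
    have hm m : xi m [x i; x j] != 0 -> (key j < key m)%O by exact: br_keyr.
    rewrite act_odd // act_gt //.
    have -> : (fun w => act f j (j :: w)) = (fun w => 2^-1 *: av f [x j; x j] w).
      by apply/funext => w; rewrite act_odd.
    rewrite act_scale -(av_x (av f _)) (av_gt _ _ (br_deg i j) hm) (av_odd_cons _ oj sN hm).
    rewrite -[act f i]av_x_fun (relation_hom hP (x_deg i) (br_deg j j)).
    rewrite th_addl tjj br_odd // (linZ (av_linear f P)).
    rewrite !scalerDr !scalerA mulVf ?two_neq0 // scale1r th_addr mulrN1 scaleNr.
    rewrite [2^-1 * _]mulrC -!addrA. congr (_ + _).
    by rewrite addrA addrN add0r.
  (* Here i = j = k, and the only extra term contains the vanishing triple bracket of [br_odd3]. *)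
  subst i; have hm m : xi m [x j; x j] != 0 -> (key j < key m)%O by exact: br_keyr.
  rewrite tjj scaleN1r addrC; apply/eqP; rewrite -subr_eq opprK act_odd //.
  rewrite -scalerDr -mulr2n -scaler_nat scalerA mulVf ?two_neq0 // scale1r.
  rewrite (av_gt _ _ (br_deg j j) hm) (av_odd_cons _ oj sN hm) br_odd3 //.
  by rewrite (lin0 (av_linear f P)) addr0 th_addl th_skew scale1r.
(* Now k precedes both letters. The relation on P is used for x_i and x_j, for x_i and [x_j; x_k],
   and for [x_i; x_k] and x_j. *)
have ki := lt_le_trans kj ji.
have hm m : xi m [x i; x j] != 0 -> (key k < key m)%O.
  by move=> /br_keyr; exact: lt_trans.
pose fk w := f (k :: w).
have fE i' : (key k < key i')%O ->
    (fun w => act f i' (k :: w)) = (fun w => th i' k *: act fk i' w + av f [x i'; x k] w).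
  by move=> h; apply/funext => w; rewrite act_gt.
rewrite !act_gt // !fE // !act_linear_fun (hP _ fk i j) (av_gt _ _ (br_deg i j) hm) -/fk.
set a1 := act (act fk j) i P.
rewrite -[act f i]av_x_fun -[act f j]av_x_fun -!(av_x (av f _)).
rewrite (relation_hom hP (x_deg i) (br_deg j k)) (relation_hom hP (br_deg i k) (x_deg j)).
rewrite jacobi (linB (av_linear f P)) (linZ (av_linear f P)) th_addl th_addr.
set X := av fk _ P; set Y := av (av f (x j)) _ P; set Z := av (av f _) (x i) P.
set U := av f _ P; set V := av f _ P.
rewrite !scalerDr !scalerA th_addl [th i j * th k j]mulrC [th j k * (_ * _)]mulrA th_skew mul1r.
rewrite [th j k * th i k]mulrC [(th i k * _) * _]mulrC [th i j * (_ * _)]mulrA.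
move: (_ *: a1) (_ *: X) (_ *: Y) (_ *: U) (_ *: Z) => a b c u z.
by rewrite +%R.[AC ((2*2)*(1*2)) (((1*5*3)*(2*6))*(4*7))] subrr addr0.
Qed.

Lemma relationP N : sorted lei N -> relation_at N.
Proof.
elim: N => [|k P IH] sN; last exact/relation_step/IH/(path_sorted sN).
move=> W f i j.
wlog ji : i j / (key j <= key i)%O.
  move=> h; have [|/ltW] := leP (key j) (key i); first exact: h.
  by move=> ij; apply: relation_sym; exact: h.
apply: relation_head => //.
by move: ji; rewrite le_eqVlt => /orP [/eqP/key_inj ->|->]; rewrite ?eqxx ?orbT.
Qed.

(** The value of the linear map given by [f] at the product of the vectors in s; the first vector
    modifies [f] first because functions carry a right action. *)
Definition hword (W : lmodType F) (f : seq I -> W) (s : seq L) : W :=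
  foldl (@av W) f s [::].

Lemma hwordE (W : lmodType F) (f : seq I -> W) s : hword f s = foldl (@av W) f s [::].
Proof. by []. Qed.

Lemma foldl_av_linear (W : lmodType F) (f g : seq I -> W) a s :
  foldl (@av W) (fun w => a *: f w + g w) s =
  fun w => a *: foldl (@av W) f s w + foldl (@av W) g s w.
Proof.
elim: s f g => //= v s IH f g; rewrite -IH; congr foldl.
by apply/funext => w; exact: av_linear_fun.
Qed.

(** Starting from the empty word, only ordered words are ever reached, so the junk values of [f] at
    unordered words have no influence. *)
Lemma foldl_av0 (W : lmodType F) (f : seq I -> W) s :
  (forall w, sorted lei w -> f w = 0) -> hword f s = 0.
Proof.
rewrite /hword; have : sorted lei [::] by []; move: [::].
elim: s f => [|v s IH] f w sw hf /=; first exact: hf.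
apply: IH => // w' sw'; rewrite /av -(lin0 (ext_linear xi_lin xi_fin (fun=> 0 : W))).
rewrite (lin0 (ext_linear xi_lin xi_fin _)).
rewrite ext_supp // big1 // => k _; rewrite (@act_ext W predT f (fun=> 0) k w') ?all_predT //.
  by rewrite act_0 scaler0.
by move=> w0 s0 _ _ _; exact: hf.
Qed.

Lemma hword_cat (W : lmodType F) (f : seq I -> W) s t :
  hword f (s ++ t) = hword (foldl (@av W) f s) t.
Proof. by rewrite /hword foldl_cat. Qed.

Lemma hword_linear_fun (W : lmodType F) (f g : seq I -> W) a s :
  hword (fun w => a *: f w + g w) s = a *: hword f s + hword g s.
Proof. by rewrite /hword foldl_av_linear. Qed.

Lemma hword_multilinear (W : lmodType F) (f : seq I -> W) : multilinear (hword f).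
Proof.
move=> s t a u v; rewrite !hword_cat /= /hword /= -/(hword _ t).
rewrite -[foldl _ _ t [::]]/(hword (av _ _) t) -[X in _ = _ *: X + _]/(hword (av _ _) t).
rewrite -[X in _ = _ + X]/(hword (av _ _) t) -hword_linear_fun.
by congr (hword _ t); apply/funext => w; exact: (av_linear _ w).
Qed.

Notation U := (uea theta Lg br).
Notation ug := (ugen theta Lg br).
Notation UJ := (uea_ideal theta Lg br).

(** A generator of the ideal is placed between two words. The prefix changes [f] into another
    function, on which [relationP] gives zero at all ordered words, and the suffix preserves this by
    [foldl_av0]. *)
Lemma hword_uea (W : lmodType F) (f : seq I -> W) t : pts_set UJ t ->
  tensor_ext (hword f) t = 0.
Proof.
have hL := tensor_ext_linear (hword_multilinear f).
(* Allowing arbitrary factors on both sides makes the vanishing condition define a two-sided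
   ideal. *)
move=> ht; suff h : forall a b, tensor_ext (hword f) (a * t * b) = 0.
  by rewrite -[t]mul1r -[1 * t]mulr1.
apply: (ht [set t | forall a b, tensor_ext (hword f) (a * t * b) = 0]).
split; first split; first split.
- by move=> a b; rewrite mulr0 mul0r (lin0 hL).
- move=> c y z /= hy hz a b; rewrite mulrDr mulrDl -scalerAr -scalerAl hL hy hz.
  by rewrite scaler0 addr0.
- move=> c y /= hy; split=> a b; first by rewrite mulrA.
  by rewrite mulrA -mulrA.
move=> _ [d [e [u [v [du ev ->]]]]] a b.
move: a; apply: tensor_ind => //.
- by move=> c y z; rewrite !mulrDl -!scalerAl hL.
- by move=> c y z; rewrite scaler0 addr0.
move=> s; move: b; apply: tensor_ind => //.
- by move=> c y z; rewrite mulrDr -scalerAr hL.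
- by move=> c y z; rewrite scaler0 addr0.
move=> r.
have E : tword s * (tgen [u; v] - (tgen u * tgen v - theta d.2 e.2 *: (tgen v * tgen u))) *
    tword r = theta d.2 e.2 *: tword (s ++ v :: u :: r) +
    (tword (s ++ [u; v] :: r) - tword (s ++ u :: v :: r)).
  by rewrite sandwich_commutator !tword_cat !tword_cons !mulrA.
rewrite E hL (linB hL) !tensor_ext_word; try exact: hword_multilinear.
set g := foldl (@av W) f s.
pose G w := theta d.2 e.2 *: av (av g v) u w + (-1 *: av (av g u) v w + av g [u; v] w).
have := @foldl_av0 W G r; rewrite /G !hword_linear_fun => e0.
rewrite !hword_cat -/g addrC; have {e0} := e0 _; rewrite scaleN1r => <-.
  by rewrite addrC [X in _ + X]addrC.
move=> w sw; rewrite (relation_hom (relationP sw) du ev) scaleN1r opprD addrA.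
by rewrite addrA subrr add0r addNr.
Qed.

(** The linear map on U(L) with prescribed values on ordered monomials; it does not depend on the
    representative by [hword_uea]. *)
Definition phi (W : lmodType F) (f : seq I -> W) : U -> W :=
  @qlift F _ UJ W (tensor_ext (hword f)).

Lemma phi_linear (W : lmodType F) (f : seq I -> W) : linear (phi f).
Proof.
apply: qlift_linear; first exact/tensor_ext_linear/hword_multilinear.
exact: hword_uea.
Qed.

Lemma uprodE s : \prod_(v <- s) ug v = qpi UJ (tword s).
Proof. by rewrite /tword rmorph_prod. Qed.

Lemma phi_prod (W : lmodType F) (f : seq I -> W) s :
  phi f (\prod_(v <- s) ug v) = hword f s.
Proof.
rewrite uprodE /phi qlift_pi; last exact: hword_uea.
  by rewrite tensor_ext_word //; exact: hword_multilinear.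
exact/tensor_ext_linear/hword_multilinear.
Qed.

Definition zmon (N : seq I) : U := \prod_(i <- N) ug (x i).

Lemma zmonE N : zmon N = \prod_(v <- map x N) ug v.
Proof. by rewrite /zmon big_map. Qed.

Lemma zmon_nil : zmon [::] = 1.
Proof. exact: big_nil. Qed.

Lemma zmon_cons i N : zmon (i :: N) = ug (x i) * zmon N.
Proof. exact: big_cons. Qed.

(** In an ordered word each letter is merely put in front ([act_cons]). This is the linear
    independence half of the Poincare-Birkhoff-Witt theorem. *)
Lemma phi_zmon (W : lmodType F) (f : seq I -> W) N : sorted lei N -> phi f (zmon N) = f N.
Proof.
move=> sN; rewrite zmonE phi_prod /hword.
suff h w : sorted lei (N ++ w) -> foldl (@av W) f (map x N) w = f (N ++ w).
  by rewrite h cats0.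
elim: N f {sN} => //= i N IH f sw.
by rewrite IH ?(path_sorted sw) // av_x act_cons.
Qed.

Lemma ugen_linear : linear ug.
Proof.
by move=> a u v; rewrite /ugen (tgen_is_linear a u v); exact: (qpi_is_linear UJ).
Qed.

Lemma ugen_br d e u v : Lg d u -> Lg e v ->
  ug u * ug v = theta d.2 e.2 *: (ug v * ug u) + ug [u; v].
Proof.
move=> du ev.
have h : qpi UJ (tgen [u; v]) =
    qpi UJ (tgen u * tgen v - theta d.2 e.2 *: (tgen v * tgen u)).
  by apply/qpi_eq; apply: sub_ideal_gen; exists d, e, u, v.
by rewrite -[ug [u; v]]/(qpi UJ (tgen [u; v])) h linearB linearZ /= !rmorphM /= addrC subrK.
Qed.

(** Inside U(L) every clause of [act] is a defining relation, so the recursion computes the actual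
    product. This is the spanning half of the theorem. *)
Lemma ugen_zmon i N : ug (x i) * zmon N = act zmon i N.
Proof.
elim: N i => [|j N IH] i; first by rewrite /= /zmon big_nil mulr1 big_seq1.
have IHv u : ug u * zmon N = ext (fun k => act zmon k N) u.
  have lk : linear (fun u => ug u * zmon N).
    by move=> a v w; rewrite ugen_linear mulrDl scalerAl.
  rewrite (lin_eq_ext xi_fin xi_sum u lk); congr (ext _ _); apply/funext => k.
  exact: IH.
rewrite /=; case: ifP => [_|ij]; first by rewrite /zmon !big_cons.
have zE : zmon (j :: N) = ug (x j) * zmon N by rewrite /zmon big_cons.
rewrite zE mulrA (ugen_br (x_deg i) (x_deg j)) mulrDl -scalerAl -mulrA IHv.
case: ifP => [/eqP e|_]; last first.
  congr (_ *: _ + _); rewrite IH act_map.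
    by congr (act _ _ _); apply/funext => w /=; rewrite /zmon big_cons.
  by move=> a v w; rewrite mulrDr scalerAr.
subst j; have oi : ~~ ev i by apply/negbT; move: ij; rewrite leiE ltxx eqxx.
(* For an odd letter the relation of x_i with itself says that twice the square is the bracket. *)
rewrite mulrA; have : ug (x i) * ug (x i) = 2^-1 *: ug [x i; x i].
  have := ugen_br (x_deg i) (x_deg i); rewrite thN // scaleN1r addrC => /eqP.
  rewrite -subr_eq opprK -mulr2n -scaler_nat => /eqP <-.
  by rewrite scalerA mulVf ?two_neq0 // scale1r.
move=> ->; rewrite thN // -scalerAl IHv scalerA mulN1r -[X in _ + X]scale1r -scalerDl.
by congr (_ *: _); field.
Qed.

Lemma ugen_zmon_av v N : ug v * zmon N = av zmon v N.
Proof.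
have lk : linear (fun u => ug u * zmon N).
  by move=> a u w; rewrite ugen_linear mulrDl scalerAl.
rewrite (lin_eq_ext xi_fin xi_sum v lk); congr (ext _ _); apply/funext => k.
exact: ugen_zmon.
Qed.

End PBW.

(** * Automorphisms of the enveloping algebra *)

Section UeaLift.
Variables (F : fieldType) (Gam : addSemigroupType) (A : zmodType).
Variables (theta : A -> A -> F).
Variables (L : lmodType F) (Lg : Gam * A -> set L) (br : L -> L -> L).
Variables (B : algType F) (f : L -> B).
Hypothesis f_lin : linear f.
Hypothesis f_br : forall d e u v, Lg d u -> Lg e v ->
  f (br u v) = f u * f v - theta d.2 e.2 *: (f v * f u).
Notation U := (uea theta Lg br).
Notation UJ := (uea_ideal theta Lg br).

Let tL := tensor_lift_linear f_lin.

Lemma tensor_lift_ideal t : pts_set UJ t -> tensor_lift f t = 0.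
Proof.
have [t1 tM] := tensor_lift_morph f_lin.
move=> /(_ [set t | tensor_lift f t = 0]); apply; split; first split; first split.
- exact: (lin0 tL).
- by move=> a y z /= hy hz; rewrite tL hy hz scaler0 addr0.
- by move=> a y /= hy; rewrite !tM hy mulr0 mul0r.
move=> _ [d [e [u [v [du ev ->]]]]] /=.
rewrite !(linB tL) (linZ tL) !tM !tensor_lift_gen //.
by rewrite (f_br du ev) subrr.
Qed.

Lemma uea_lift_pi t : @uea_lift _ _ _ theta _ Lg br _ f (qpi UJ t) = tensor_lift f t.
Proof. exact: (qlift_pi (J := UJ) _ tL tensor_lift_ideal). Qed.

Lemma uea_lift_linear : linear (@uea_lift _ _ _ theta _ Lg br _ f).
Proof. exact: (qlift_linear (J := UJ) tL tensor_lift_ideal). Qed.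

Lemma uea_lift_gen v : uea_lift f (ugen theta Lg br v) = f v.
Proof. by rewrite uea_lift_pi tensor_lift_gen. Qed.

Lemma uea_lift1 : uea_lift f (1 : U) = 1.
Proof.
by rewrite -(rmorph1 (qpi UJ)) uea_lift_pi; case: (tensor_lift_morph f_lin).
Qed.

Lemma uea_liftM (u v : U) : uea_lift f (u * v) = uea_lift f u * uea_lift f v.
Proof.
have [_ tM] := tensor_lift_morph f_lin.
rewrite -[u](qpi_reprK (J := UJ)) -[v](qpi_reprK (J := UJ)) -rmorphM.
by rewrite !uea_lift_pi tM.
Qed.

Lemma uea_lift_prod (J : Type) (r : seq J) (h : J -> U) :
  uea_lift f (\prod_(j <- r) h j) = \prod_(j <- r) uea_lift f (h j).
Proof. exact: (big_morph _ uea_liftM uea_lift1). Qed.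

End UeaLift.

Section Counit.
Variables (F : fieldType) (Gam : addSemigroupType) (A : zmodType).
Variables (theta : A -> A -> F).
Variables (L : lmodType F) (Lg : Gam * A -> set L) (br : L -> L -> L).
Notation U := (uea theta Lg br).
Notation eps := (@counit F Gam A theta L Lg br).

Let z : L -> F^o := fun=> 0.
Let zL : linear z. Proof. by move=> a u v; rewrite /z scaler0 addr0. Qed.
Let zb : forall d e u v, Lg d u -> Lg e v ->
  z (br u v) = z u * z v - theta d.2 e.2 *: (z v * z u).
Proof. by move=> d e u v _ _; rewrite /z mulr0 scaler0 subr0. Qed.

Lemma counit_linear : linear (eps : U -> F^o).
Proof. exact: (uea_lift_linear zL zb). Qed.

Lemma counit1 : eps 1 = 1.
Proof. exact: (uea_lift1 zL zb). Qed.

Lemma counitM u v : eps (u * v) = eps u * eps v.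
Proof. exact: (uea_liftM zL zb). Qed.

Lemma counit_gen v : eps (ugen theta Lg br v) = 0.
Proof. exact: (uea_lift_gen zL zb). Qed.

End Counit.

(** * Diagonal coefficients of an automorphism on ordered monomials *)

Section Eigenvalues.
Variables (F : numFieldType) (Gam : addSemigroupType) (A : zmodType).
Variables (theta : A -> A -> F).
Variables (L : lmodType F) (Lg : Gam * A -> set L) (br : L -> L -> L).
Variables (I : choiceType) (disp : Order.disp_t) (K : orderType disp) (key : I -> K).
Variables (deg : I -> (Gam * A)%type) (x : I -> L) (xi : I -> L -> F).
Hypothesis H : adapted_basis theta Lg br key deg x xi.
Variable idx : I -> nat.

Notation ext := (ext xi).
Notation ev := (fun i => theta (deg i).2 (deg i).2 == 1).
Notation lei := (lei key ev).
Notation wdeg := (wdeg deg).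
Notation av := (av theta br key deg x xi).
Notation act := (act theta br key deg x xi).
Notation hword := (hword theta br key deg x xi).
Notation U := (uea theta Lg br).
Notation ug := (ugen theta Lg br).
Notation phi := (phi key deg x xi).
Notation zmon := (zmon theta Lg br x).

(** Since g only adds letters of larger [idx], this sum makes g triangular on monomials of a given
    length. *)
Definition rank (w : seq I) := \sum_(i <- w) idx i.

Lemma rank_rcons r i : rank (rcons r i) = (rank r + idx i)%N.
Proof. by rewrite /rank -cats1 big_cat big_seq1. Qed.

Lemma rank_perm w j N : perm_eq w (j :: N) -> rank w = (idx j + rank N)%N.
Proof. by move=> h; rewrite /rank (perm_big _ h) big_cons. Qed.

(** Its image under [phi] is the coordinate along the ordered monomial z_M. *)
Definition delta (M : seq I) (w : seq I) : F^o := (w == M)%:R.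

(* Leading terms: the rank of a product of letters, each modified by letters of
   higher rank, is at least the sum of their ranks, up to shorter monomials. *)
Lemma foldl_av_vanish (y : I -> L) M r w :
  (forall i j, xi j (y i) != 0 -> (idx i <= idx j)%N) -> sorted lei w ->
  ((size w + size r < size M) || (size w + size r == size M) && (rank M < rank w + rank r))%N ->
  foldl (@av F^o) (delta M) (map y r) w = 0.
Proof.
move=> hy; elim/last_ind: r w => [|r i IH] w sw.
  rewrite /= /rank big_nil !addn0 /delta => h; case: eqP => // wM; move: h.
  by rewrite wM !ltnn andbF.
rewrite size_rcons map_rcons foldl_rcons rank_rcons /= => h.
rewrite avE ext_supp; last exact: ab_fin H.
rewrite big1_seq // => j /andP [_]; rewrite (mem_supp (ab_fin H)) => /hy ij.
rewrite (@act_ext _ _ _ _ _ _ _ _ _ _ _ _ _ _ H F^o predT _ (fun=> 0) j w) ?all_predT //.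
  by rewrite (act_0 H) scaler0.
move=> w' sw' _ _ hw; apply: IH => //.
case/orP: hw => [hw|hw]; first by apply/orP; case/orP: h => [h|/andP [h _]]; left; lia.
rewrite (perm_size hw) (rank_perm hw) /=.
by case/orP: h => [h|/andP [/eqP h1 h2]]; apply/orP; [left; lia|right; lia].
Qed.

Variable g : L -> L.
Hypothesis g_triang : forall i j, xi j (g (x i)) != 0 -> j = i \/ (idx i < idx j)%N.
Definition eigen i := xi i (g (x i)).

(** Compares the coefficient of z_M in the products of the g(x_i) and of the x_i, applied to z_w.
    When length and rank add up exactly to those of M, only the diagonal term of each g(x_i)
    survives. *)
Lemma foldl_av_leading M r w : sorted lei w ->
  (size w + size r = size M)%N -> (rank w + rank r = rank M)%N ->
  foldl (@av F^o) (delta M) (map (g \o x) r) w =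
  (\prod_(i <- r) eigen i) * foldl (@av F^o) (delta M) (map x r) w.
Proof.
have hx i j : xi j (x i) != 0 -> (idx i <= idx j)%N.
  by rewrite (ab_dual H); have [->|_] := eqVneq j i; rewrite ?eqxx.
have hg i j : xi j ((g \o x) i) != 0 -> (idx i <= idx j)%N.
  by move=> /g_triang [->|/ltnW].
elim/last_ind: r w => [|r i IH] w sw; first by rewrite big_nil mul1r.
rewrite size_rcons !map_rcons !foldl_rcons rank_rcons -cats1 big_cat big_seq1 /= => hs hr.
rewrite (av_x H) avE (@ext_supp F L I xi (ab_fin H)).
set G := foldl _ _ _; set E := foldl _ _ _.
(* The other letters of g(x_i) have larger [idx]: what they produce is too short or of too large a
   rank to reach M. *)
have off j : j != i -> xi j (g (x i)) *: act G j w = 0.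
  move=> ji; have [->|/g_triang []] := eqVneq (xi j (g (x i))) 0; first by rewrite scale0r.
    by move/eqP; rewrite (negbTE ji).
  move=> ij; rewrite (@act_ext _ _ _ _ _ _ _ _ _ _ _ _ _ _ H F^o predT _ (fun=> 0) j w) ?all_predT //.
    by rewrite (act_0 H) scaler0.
  move=> w' sw' _ _ hw; apply: foldl_av_vanish => //.
  case/orP: hw => [hw|hw]; first by apply/orP; left; lia.
  rewrite (perm_size hw) (rank_perm hw) /=.
  by apply/orP; right; lia.
have diag : act G i w = (\prod_(i <- r) eigen i) * act E i w.
  rewrite -[RHS]/(_ *: (act E i w : F^o)) -(act_scale H).
  apply: (@act_ext _ _ _ _ _ _ _ _ _ _ _ _ _ _ H F^o predT) => //; first exact: all_predT.
  move=> w' sw' _ _ /orP [hw|hw].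
    rewrite /G /E !foldl_av_vanish ?scaler0 //; apply/orP; left; lia.
  by apply: IH => //; rewrite ?(perm_size hw) ?(rank_perm hw) /=; lia.
(* If the eigenvalue is 0, the letter i is absent from the support and cannot be split off the
   sum. *)
have [h0|h0] := eqVneq (xi i (g (x i))) 0.
  rewrite big1_seq => [|j _]; first by rewrite /eigen h0 mulr0 mul0r.
  by have [->|/off //] := eqVneq j i; rewrite h0 scale0r.
rewrite (bigD1_seq i) ?supp_uniq ?(mem_supp (ab_fin H)) //= big1 ?addr0 //.
by rewrite diag /eigen -[LHS]/(_ * _) mulrA; congr (_ * _); rewrite mulrC.
Qed.

Hypothesis g_lin : linear g.
Hypothesis g_br : forall u v, g (br u v) = br (g u) (g v).
Hypothesis g_deg : forall d u, Lg d u -> Lg d (g u).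

Notation gU := (uea_lift (fun v => ug (g v))).

Lemma gU_lin_gen : linear (fun v => ug (g v)).
Proof. by move=> a u v; rewrite g_lin ugen_linear. Qed.

Lemma gU_br_gen d e u v : Lg d u -> Lg e v ->
  ug (g (br u v)) = ug (g u) * ug (g v) - theta d.2 e.2 *: (ug (g v) * ug (g u)).
Proof.
move=> /g_deg du /g_deg ev; by rewrite g_br (@ugen_br _ _ _ theta _ Lg br _ _ _ _ du ev) [RHS]addrC addKr.
Qed.

Lemma gU_prod s : gU (\prod_(v <- s) ug v) = \prod_(v <- s) ug (g v).
Proof.
rewrite (uea_lift_prod gU_lin_gen gU_br_gen); apply: eq_bigr => v _.
exact: (uea_lift_gen gU_lin_gen gU_br_gen).
Qed.

Lemma phi_gU M : sorted lei M -> phi (delta M) (gU (zmon M)) = \prod_(i <- M) eigen i.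
Proof.
move=> sM; have := phi_zmon H (delta M) sM.
rewrite !zmonE gU_prod -(big_map g xpredT ug) !(phi_prod H) -map_comp !hwordE.
by rewrite foldl_av_leading //= => [->|]; rewrite ?/delta ?eqxx ?mulr1 // /rank big_nil.
Qed.

End Eigenvalues.

(** * Ordered monomials as a graded basis of the enveloping algebra *)

Section Monomials.
Variables (F : numFieldType) (Gam : addSemigroupType) (A : zmodType).
Variables (theta : A -> A -> F).
Variables (L : lmodType F) (Lg : Gam * A -> set L) (br : L -> L -> L).
Variables (I : choiceType) (disp : Order.disp_t) (K : orderType disp) (key : I -> K).
Variables (deg : I -> (Gam * A)%type) (x : I -> L) (xi : I -> L -> F).
Hypothesis H : adapted_basis theta Lg br key deg x xi.

Notation D := (Gam * A)%type.
Notation ev := (fun i => theta (deg i).2 (deg i).2 == 1).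
Notation lei := (lei key ev).
Notation wdeg := (wdeg deg).
Notation U := (uea theta Lg br).
Notation ug := (ugen theta Lg br).
Notation phi := (phi key deg x xi).
Notation zmon := (zmon theta Lg br x).
Notation eps := (@counit F Gam A theta L Lg br).
Notation udeg := (@uea_deg F Gam A theta L Lg br).

Definition zspan (P : set (seq I)) : set U := span [set zmon M | M in [set M | sorted lei M /\ P M]].

Lemma zspan_subspace P : subspace (zspan P).
Proof. exact: span_subspace. Qed.

Lemma zspan_mem (P : set (seq I)) M : sorted lei M -> P M -> zspan P (zmon M).
Proof. by move=> sM PM; apply: sub_span; exists M. Qed.

(** [act_mem] shows that degrees determine which monomials may occur; the same statement serves for
    the grading and, with no condition on words, for spanning. *)
Lemma zspan_mul (P Q : set (seq I)) v u :
  (forall i M N, xi i v != 0 -> P M -> wdeg N = wdeg (i :: M) -> Q N) ->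
  zspan P u -> zspan Q (ug v * u).
Proof.
move=> h hu; have hQ := zspan_subspace Q.
apply: (span_ind (P := fun u => zspan Q (ug v * u)) hu); first split.
- by rewrite /= mulr0; exact: subspace_0.
- move=> a y z /= hy hz; rewrite mulrDr -scalerAr.
  by apply: (subspaceD hQ) => //; apply: (subspaceZ _ hQ).
move=> _ [M [sM PM] <-] /=; rewrite (ugen_zmon_av H) /av.
apply: ext_mem => //; first exact: ab_fin H.
move=> i hi; apply: (act_mem H (Q := predT)) => //; first exact: all_predT.
by move=> w sw _ dw _; apply: zspan_mem => //; exact: h hi PM dw.
Qed.

Notation zdeg o := (zspan [set M | wdeg M = o]).

Lemma ugen_zdeg d v o u : Lg d v -> zdeg o u -> zdeg (oadd (Some d) o) (ug v * u).
Proof.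
move=> dv; apply: zspan_mul => i M N iv /= <- ->.
by rewrite wdeg_cons (ab_hom H dv iv).
Qed.

Lemma uprod_zdeg (s : seq (D * L)) : (forall p, p \in s -> Lg p.1 p.2) ->
  zdeg (osum [seq p.1 | p <- s]) (\prod_(p <- s) ug p.2).
Proof.
elim: s => [|[d v] s IH] h.
  by rewrite big_nil -(zmon_nil theta Lg br x); apply: zspan_mem => //=; rewrite /wdeg /osum big_nil.
rewrite big_cons /= osum_cons; apply: ugen_zdeg; first exact: (h _ (mem_head _ _)).
by apply: IH => p ps; apply: h; rewrite inE ps orbT.
Qed.

Lemma uea_degE d : udeg d = zdeg (Some d).
Proof.
apply/seteqP; split.
  apply: span_min; first exact: zspan_subspace.
  by move=> _ [k _ [s [_ hs <- ->]]]; exact: uprod_zdeg.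
apply: span_mono => _ [M [sM /= dM] <-]; exists (size M) => //.
exists [seq (deg i, x i) | i <- M]; split.
- by rewrite size_map.
- by move=> p /mapP [i _ ->]; exact: ab_deg H i.
- by rewrite -map_comp.
- by rewrite big_map.
Qed.

Lemma zspan_all u : zspan setT u.
Proof.
have hS := zspan_subspace setT.
suff h t : zspan setT (qpi (uea_ideal theta Lg br) t).
  by rewrite -[u](qpi_reprK (J := uea_ideal theta Lg br)).
suff : (qpi (uea_ideal theta Lg br) @^-1` zspan setT) t by [].
apply: (tensor_span t); split.
  by apply: preim_subspace => // a y z; exact: qpi_is_linear.
move=> _ [s _ <-]; rewrite /preimage /= -uprodE; elim: s => [|v s IH].
  by rewrite big_nil -(zmon_nil theta Lg br x); exact: zspan_mem.
by rewrite big_cons; apply: zspan_mul IH.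
Qed.

Lemma counit_zmon M : eps (zmon M) = (M == [::])%:R.
Proof.
case: M => [|i M]; first by rewrite zmon_nil counit1.
by rewrite zmon_cons counitM counit_gen mul0r.
Qed.

Lemma counit_eq0P u : eps u = 0 <-> zspan [set M | M != [::]] u.
Proof.
have hS := zspan_subspace [set M | M != [::]].
have eL := @counit_linear F Gam A theta L Lg br.
split=> [u0|]; last first.
  move=> hu; apply: (span_ind (P := fun u => eps u = 0) hu).
    split; first exact: (lin0 eL).
    by move=> a y z /= hy hz; rewrite (eL a y z) hy hz scaler0 addr0.
  by move=> _ [M [_ /= /negbTE M0] <-]; rewrite /= counit_zmon M0.
(* Removing the constant term gives a statement linear in u, which can be checked on monomials. *)
suff : zspan [set M | M != [::]] (u - eps u *: 1) by rewrite u0 scale0r subr0.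
apply: (span_ind (P := fun u => zspan [set M | M != [::]] (u - eps u *: 1)) (zspan_all u)) => {u u0}.
  split; first by rewrite /= (lin0 eL) scale0r subr0; exact: subspace_0.
  move=> a y z /= hy hz.
  have -> : a *: y + z - eps (a *: y + z) *: 1 =
      a *: (y - eps y *: 1) + (z - eps z *: 1).
    by rewrite (eL a y z) scalerBr scalerDl scalerA opprD addrACA.
  by apply: (subspaceD hS) => //; exact: (subspaceZ _ hS).
move=> _ [M [sM _] <-] /=; rewrite counit_zmon; have [->|M0] := eqVneq M [::].
  by rewrite zmon_nil scale1r subrr; exact: subspace_0.
by rewrite scale0r subr0; exact: zspan_mem.
Qed.

Lemma phi_delta M N : sorted lei N -> phi (delta F M) (zmon N) = (M == N)%:R.
Proof. by move=> sN; rewrite (phi_zmon H) // /delta eq_sym. Qed.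

Lemma uea_deg_mul d e u v : udeg d u -> udeg e v -> udeg (d + e) (u * v).
Proof.
move=> du ev; have hS : subspace (udeg (d + e)) := span_subspace _.
suff h : forall t, (\bigcup_k homog_words ug Lg d k) t -> udeg (d + e) (t * v).
  apply: (span_ind (P := fun u => udeg (d + e) (u * v)) du) => //; split; first by rewrite /= mul0r; exact: subspace_0.
  move=> a y z /= hy hz; rewrite mulrDl -scalerAl.
  by apply: (subspaceD hS) => //; exact: (subspaceZ _ hS).
move=> t ht; apply: (span_ind (P := fun v => udeg (d + e) (t * v)) ev).
  split; first by rewrite /= mulr0; exact: subspace_0.
  move=> a y z /= hy hz; rewrite mulrDr -scalerAr.
  by apply: (subspaceD hS) => //; exact: (subspaceZ _ hS).
case: ht => k _ [s [sk hs ds ->]] _ [l _ [r [rl hr dr ->]]] /=.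
apply: sub_span; exists (k + l)%N => //; exists (s ++ r); split.
- by rewrite size_cat sk rl.
- by move=> p; rewrite mem_cat => /orP [/hs|/hr].
- by rewrite map_cat osum_cat ds dr.
- by rewrite big_cat.
Qed.

End Monomials.

(** * The bar complex *)

Section BarDifferential.
Variables (F : fieldType) (B : algType F).
Implicit Types (s : seq B) (i j : nat).

Lemma bar_diff_linear : linear (@bar_diff F B).
Proof. exact/tensor_ext_linear/bar_word_multilinear. Qed.

Lemma bar_diff_word s : bar_diff (tword s) = bar_word s.
Proof. exact/tensor_ext_word/bar_word_multilinear. Qed.

Lemma bar_merge_cons (a : B) s i : bar_merge (a :: s) i.+1 = a :: bar_merge s i.
Proof. by []. Qed.

Lemma bar_merge_cons2 (a b : B) s : bar_merge [:: a, b & s] 0 = a * b :: s.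
Proof. by rewrite /bar_merge /= drop0. Qed.

Lemma size_bar_merge s i : (i.+1 < size s)%N -> size (bar_merge s i) = (size s).-1.
Proof.
by move=> h; rewrite /bar_merge size_cat /= size_drop size_takel; lia.
Qed.

(** The simplicial identity for the faces of the bar complex; the case i = j, where the merges meet,
    is associativity. *)
Lemma bar_merge_merge s i j : (i <= j)%N -> (j.+2 < size s)%N ->
  bar_merge (bar_merge s i) j = bar_merge (bar_merge s j.+1) i.
Proof.
elim: i j s => [|i IH] j [|a [|b s]] // ij js.
  rewrite bar_merge_cons bar_merge_cons2; case: j {ij} js => [|j] js.
    case: s js => [|c s] // _.
    by rewrite !bar_merge_cons2 mulrA.
  by rewrite !bar_merge_cons bar_merge_cons2.
by case: j ij js => // j ij js; exact: (congr1 (cons a) (IH j (b :: s) ij js)).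
Qed.

(** The pairs (i, j) with i <= j cancel against the pairs (j + 1, i), which are exactly those whose
    second index is smaller than the first. *)
Lemma alternating_sum (V : zmodType) m (a : nat -> nat -> V) :
  (forall i j, (i <= j)%N -> (j < m)%N -> a j.+1 i = - a i j) ->
  \sum_(i < m.+1) \sum_(j < m) a i j = 0.
Proof.
move=> h.
transitivity (\sum_(i < m.+1) (\sum_(j < m | (j < i)%N) a i j + \sum_(j < m | ~~ (j < i)%N) a i j)).
  by apply: eq_bigr => i _; rewrite (bigID (fun j : 'I_m => (j < i)%N)).
rewrite big_split /= big_ord_recl big1 // add0r [X in _ + X]big_ord_recr /=.
rewrite [X in _ + (_ + X)]big1 ?addr0; last by move=> j; rewrite ltn_ord.
rewrite [X in _ + X](exchange_big_dep xpredT) //= -big_split big1 // => i _ /=.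
rewrite [X in X + _](eq_bigr (fun j : 'I_m => - a j i)); last first.
  by move=> j ji; apply: h => //; exact: ltn_ord.
rewrite sumrN addrC; apply/eqP; rewrite subr_eq0; apply/eqP.
by apply: eq_bigl => j; rewrite -leqNgt ltnS.
Qed.

Lemma bar_diff_diff t : bar_diff (bar_diff t) = 0 :> tensoralg B.
Proof.
have dL := bar_diff_linear.
apply: (tensor_ind (h := fun t => bar_diff (bar_diff t)) (h' := fun=> 0)).
- by move=> a y z; rewrite !dL.
- by move=> a y z; rewrite scaler0 addr0.
move=> s; rewrite bar_diff_word /bar_word (lin_sum dL).
case sz: (size s) => [|[|n]]; [by rewrite big_geq|by rewrite big_geq|].
rewrite /= big_mkord.
transitivity (\sum_(i < n.+1) \sum_(j < n)
   (-1) ^+ (i + j) *: tword (bar_merge (bar_merge s i) j)).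
  apply: eq_bigr => i _; rewrite (linZ dL) bar_diff_word /bar_word size_bar_merge; last first.
    by rewrite sz ltnS ltn_ord.
  rewrite sz /= big_mkord scaler_sumr; apply: eq_bigr => j _.
  by rewrite scalerA exprD.
apply: (alternating_sum (a := fun i j => (-1) ^+ (i + j) *: tword (bar_merge (bar_merge s i) j))).
move=> i j ij jn; rewrite -bar_merge_merge //; last by rewrite sz; lia.
by rewrite addSn exprS mulN1r scaleNr addnC.
Qed.

Variable f : B -> B.
Hypothesis f_lin : linear f.
Hypothesis f_mul : forall u v, f (u * v) = f u * f v.

Let tf := tensor_lift (fun u => tgen (f u)).

Let tfL : linear (fun u => tgen (f u)).
Proof. by move=> a u v; rewrite f_lin linearP. Qed.

Lemma tensor_map_linear : linear tf.
Proof. exact: tensor_lift_linear. Qed.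

Lemma tensor_map_word s : tf (tword s) = tword (map f s).
Proof.
rewrite /tf /tensor_lift tensor_ext_word; last exact: prod_multilinear.
by rewrite /tword big_map.
Qed.

Lemma map_bar_merge s i : (i.+1 < size s)%N -> map f (bar_merge s i) = bar_merge (map f s) i.
Proof.
move=> h; rewrite /bar_merge map_cat /= f_mul map_take map_drop.
by rewrite !(nth_map 0) //; exact: ltnW.
Qed.

Lemma bar_diff_map t : bar_diff (tf t) = tf (bar_diff t).
Proof.
have dL := bar_diff_linear; have hL := tensor_map_linear.
apply: (tensor_ind (h := fun t => bar_diff (tf t)) (h' := fun t => tf (bar_diff t))).
- by move=> a y z; rewrite hL dL.
- by move=> a y z; rewrite dL hL.
move=> s; rewrite tensor_map_word !bar_diff_word /bar_word (lin_sum hL) size_map.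
apply: eq_big_nat => i /andP [_ hi]; rewrite (linZ hL) tensor_map_word map_bar_merge //.
by lia.
Qed.

End BarDifferential.

Fixpoint related (T M : Type) (Q : T -> M -> Prop) (ts : seq T) (ms : seq M) : Prop :=
  match ts, ms with
  | [::], [::] => True
  | t :: ts', m :: ms' => Q t m /\ related Q ts' ms'
  | _, _ => False
  end.

(** Expands each tensor factor in its own generators. The tag carried by a factor says which
    generators are allowed: a degree, or [tt] when the degree is ignored. *)
Lemma tword_span (F : fieldType) (V : lmodType F) (T : eqType) (M : Type) (z : M -> V)
  (Q : T -> M -> Prop) (us : seq (T * V)) :
  (forall p, p \in us -> span [set z m | m in Q p.1] p.2) ->
  span [set tword (map z ms) | ms in related Q (map fst us)] (tword (map snd us)).
Proof.
elim: us => [|[t u] us IH] h /=; first by apply: sub_span; exists [::].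
rewrite tword_cons.
set S := span _; have hS : subspace S by exact: span_subspace.
have hu : span [set z m | m in Q t] u by exact: (h _ (mem_head _ _)).
have hus := IH (fun p ps => h p (mem_behead (s := (t, u) :: us) ps)).
apply: (span_ind (P := fun u => S (tgen u * tword (map snd us))) hu).
  split; first by rewrite linear0 mul0r; exact: subspace_0.
  move=> a y y' hy hy'; rewrite linearP mulrDl -scalerAl.
  by apply: (subspaceD hS) => //; exact: (subspaceZ _ hS).
move=> _ [m Qm <-].
apply: (span_ind (P := fun y => S (tgen (z m) * y)) hus).
  split; first by rewrite mulr0; exact: subspace_0.
  move=> a y y' hy hy'; rewrite mulrDr -scalerAr.
  by apply: (subspaceD hS) => //; exact: (subspaceZ _ hS).
by move=> _ [ms hms <-]; apply: sub_span; exists (m :: ms) => //=; rewrite tword_cons.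
Qed.

(** * The Euler-Poincare principle for traces *)

Section EulerPoincare.
Variables (F : fieldType) (V : lmodType F) (C : nat -> set V) (d f : V -> V) (c : nat -> F).
Hypothesis C_sub : forall k, subspace (C k).
Hypothesis C_fin : forall k, finite_dim (C k).
Hypothesis d_lin : linear d.
Hypothesis f_lin : linear f.
Hypothesis dC : forall k, d @` C k.+1 `<=` C k.
Hypothesis dd : forall x, d (d x) = 0.
Hypothesis df : forall x, d (f x) = f (d x).
Hypothesis fC : forall k, C k `<=` f @^-1` C k.
Hypothesis C_tr : forall k, has_trace (C k) [set 0] f (c k).

Let Z k := C k `&` [set x | d x = 0].
Let Bd k := d @` C k.+1.

Lemma has_trace0 (T : set V) : subspace T -> has_trace T T f 0.
Proof.
move=> hT; exists 0%N, (fun=> 0), 0; split; [exact: basis_mod_nil|by case|].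
by rewrite mxtrace0.
Qed.

(** With b_k the trace on the boundaries in C_k, the trace on C_(k+1) is that on homology plus
    b_(k+1) + b_k, and the b terms telescope. The ends vanish: b_0 because d is zero on C_1, b_N
    because C_(N+1) is zero. *)
Lemma euler_poincare N : (forall x, C 1 x -> d x = 0) -> C N.+1 `<=` [set 0] ->
  \sum_(k < N) (-1) ^+ k * trace_mod (Z k.+1) (Bd k.+1) f = \sum_(k < N) (-1) ^+ k * c k.+1.
Proof.
move=> d1 CN; have h0 := subspace_set0 V.
have f0 : [set (0 : V)] `<=` f @^-1` [set 0] by move=> x ->; rewrite /preimage /= (lin0 f_lin).
have hZ k : subspace (Z k) by apply: subspaceI => //; exact: (preim_subspace d_lin h0).
have hB k : subspace (Bd k) by exact: image_subspace.
have BZ k : Bd k `<=` Z k.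
  by move=> y hy; split; [exact: dC hy|case: hy => x _ <-; exact: dd].
have ZC k : Z k `<=` C k by move=> x [].
have zB k : [set (0 : V)] `<=` Bd k by move=> x ->; exact: subspace_0.
have fZ k : Z k `<=` f @^-1` Z k.
  by move=> x [xC /= dx]; split; [exact: fC|rewrite /= df dx (lin0 f_lin)].
have fB k : Bd k `<=` f @^-1` Bd k.
  by move=> _ [x xC <-]; exists (f x); [exact: fC|rewrite df].
have eB k : exists t, has_trace (Bd k) [set 0] f t.
  apply: (exists_trace (C_sub k) (C_fin k)) => //; exact: dC.
have [b hb] := choice eB.
have b0 : b 0%N = 0.
  apply: (has_trace_uniq (hB 0%N) h0 f_lin f0 (hb 0%N)).
  have -> : Bd 0 = [set 0].
    by apply/seteqP; split=> [_ [x /d1 -> <-] //|]; exact: zB.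
  exact: has_trace0.
have bN : b N = 0.
  apply: (has_trace_uniq (hB N) h0 f_lin f0 (hb N)).
  have -> : Bd N = [set 0].
    apply/seteqP; split=> [_ [x /CN -> <-]|]; last exact: zB.
    by rewrite /= (lin0 d_lin).
  exact: has_trace0.
have ct k : c k.+1 = trace_mod (Z k.+1) (Bd k.+1) f + b k.+1 + b k.
  have [t1 ht1] := exists_trace (C_sub k.+1) (C_fin k.+1) (C_sub k.+1) (hZ k.+1) (@ZC k.+1)
    (fun _ h => h) (@fC k.+1).
  have [t2 ht2] := exists_trace (C_sub k.+1) (C_fin k.+1) (hZ k.+1) (hB k.+1) (@BZ k.+1)
    (@ZC k.+1) (@fZ k.+1).
  rewrite (trace_modE (hZ k.+1) (hB k.+1) f_lin (@fB k.+1) ht2).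
  have e1 : t1 = b k.
    apply: (has_trace_uniq (hB k) h0 f_lin f0 _ (hb k)).
    by apply: has_trace_image ht1 => //; exact: fC.
  have ht3 := has_traceD (hZ k.+1) (hB k.+1) h0 (@zB k.+1) (@BZ k.+1) (@fZ k.+1) ht2 (hb k.+1).
  have z0 : [set (0 : V)] `<=` Z k.+1 by move=> x ->; exact: subspace_0.
  have ht4 := has_traceD (C_sub k.+1) (hZ k.+1) h0 z0 (@ZC k.+1) (@fC k.+1) ht1 ht3.
  by rewrite (has_trace_uniq (C_sub k.+1) h0 f_lin f0 (C_tr k.+1) ht4) e1 addrC.
have tele M : \sum_(k < M) (-1) ^+ k * (b k.+1 + b k) = b 0%N - (-1) ^+ M * b M.
  elim: M => [|M IH]; first by rewrite big_ord0 expr0 mul1r subrr.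
  by rewrite big_ord_recr /= IH exprS; ring.
under [RHS]eq_bigr do rewrite ct -addrA mulrDr.
by rewrite big_split /= tele b0 bN mulr0 subr0 addr0.
Qed.

End EulerPoincare.

(** * Traces on the bar complex of an algebra with a basis of monomials *)

Section BarTraces.
Variables (F : numFieldType) (D : addSemigroupType).
Hypothesis Dfin : finite_decompositions D.
Variables (I : choiceType) (disp : Order.disp_t) (K : orderType disp) (key : I -> K).
Variables (ev : pred I) (deg : I -> D).
Hypothesis deg_fin : forall d, finite_set [set i | deg i = d].
Variables (B : algType F) (eps : B -> F) (udeg : D -> set B).
Variables (zmon : seq I -> B) (coord : seq I -> B -> F).

Notation lei := (lei key ev).
Notation wdeg := (wdeg deg).
Notation sdeg := (sdeg deg).
Notation bars := (bars key ev).
Notation pwords := (pwords key ev).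

Hypothesis coord_lin : forall M, linear (coord M : B -> F^o).
Hypothesis coord_zmon : forall M N, sorted lei N -> coord M (zmon N) = (M == N)%:R.
Hypothesis udegE : forall d, udeg d = span [set zmon M | M in [set M | sorted lei M /\ wdeg M = Some d]].
Hypothesis udeg_mul : forall d e u v, udeg d u -> udeg e v -> udeg (d + e) (u * v).
Hypothesis epsE : forall u, eps u = 0 <-> span [set zmon M | M in pwords] u.

(* bar_deg for an algebra B with a basis zmon of ordered monomials. *)
Definition gdeg k d : set (tensoralg B) := span (homog_words (@tgen F B) udeg d k).

Definition bmon (s : seq (seq I)) : tensoralg B := tword (map zmon s).

(** Products of coordinate forms, dual to the tensors of monomials; the value is 0 when the lengths
    differ. *)
Fixpoint pairing (s : seq (seq I)) (us : seq B) : F^o :=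
  match s, us with
  | [::], [::] => 1
  | M :: s', u :: us' => coord M u * pairing s' us'
  | _, _ => 0
  end.

Lemma pairing_multilinear s : multilinear (pairing s).
Proof.
move=> us t a u v; elim: us s => [|u' us IH] [|M s] /=; rewrite ?scaler0 ?addr0 //.
  by rewrite (coord_lin M) mulrDl scalerAl.
by rewrite IH mulrDr scalerAr.
Qed.

Definition bphi s : tensoralg B -> F^o := tensor_ext (pairing s).

Lemma bphi_linear s : linear (bphi s).
Proof. exact/tensor_ext_linear/pairing_multilinear. Qed.

Lemma bphi_word s us : bphi s (tword us) = pairing s us.
Proof. exact/tensor_ext_word/pairing_multilinear. Qed.

Lemma bphi_bmon s t : (forall M, M \in t -> sorted lei M) -> bphi s (bmon t) = (s == t)%:R.
Proof.
rewrite bphi_word; elim: s t => [|M s IH] [|N t] //= h.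
rewrite coord_zmon; last exact/h/mem_head.
rewrite IH => [|M' tM]; last by apply: h; rewrite inE tM orbT.
by rewrite eqseq_cons -natrM mulnb.
Qed.

Lemma pwords_degree M : pwords M -> exists e, wdeg M = Some e.
Proof.
case: M => [[]//|i M _]; rewrite wdeg_cons.
by case: (wdeg M) => [e|]; eexists.
Qed.

Lemma bar_degE k d : gdeg k d = span [set bmon s | s in bars k `&` sdeg @^-1` [set Some d]].
Proof.
apply/seteqP; split; last first.
  apply: span_mono => _ [s [[<- hs] /= ds] <-].
  (* The default d is never taken: every factor is a nonempty word and has a degree. *)
  pose dg M := odflt d (wdeg M).
  have dgE M : M \in s -> wdeg M = Some (dg M).
    by move=> /hs /pwords_degree [e he]; rewrite /dg he.
  exists [seq (dg M, zmon M) | M <- s]; split.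
  - by rewrite size_map.
  - move=> p /mapP [M Ms ->] /=; rewrite udegE; apply: sub_span; exists M => //.
    by split; [case: (hs _ Ms)|exact: dgE].
  - rewrite -map_comp -ds; elim: s {ds hs} dgE => [|M s IH] h.
      by rewrite sdeg_nil /osum big_nil.
    rewrite /= osum_cons IH; last by move=> N Ns; apply: h; rewrite inE Ns orbT.
    by rewrite sdeg_cons (h M (mem_head _ _)).
  - by rewrite big_map /bmon /tword big_map.
apply: span_min; first exact: span_subspace.
move=> _ [s [<- hs ds ->]].
have h : span [set tword (map zmon ms) | ms in related
    (fun e M => sorted lei M /\ wdeg M = Some e) (map fst s)] (tword (map snd s)).
  by apply: tword_span => p /hs; rewrite udegE.
rewrite (_ : \prod_(p <- s) tgen p.2 = tword (map snd s)); last by rewrite /tword big_map.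
apply: span_mono h => _ [ms hms <-]; exists ms => //=.
have e : sdeg ms = osum [seq p.1 | p <- s] /\ bars (size s) ms.
  elim: s ms hms {hs ds} => [|[e u] s IH] [|M ms] //=.
    by move=> _; rewrite sdeg_nil /osum big_nil.
  move=> [[sM dM] /IH [e1 [e2 e3]]]; rewrite sdeg_cons osum_cons dM e1; split=> //.
  split=> /=; first by rewrite e2.
  move=> N; rewrite inE => /orP [/eqP ->|/e3 //]; split=> //.
  by apply/eqP => M0; move: dM; rewrite M0 wdeg_nil.
by split; [case: e|rewrite -ds; case: e].
Qed.

Lemma barE k : bar eps k = span [set bmon s | s in bars k].
Proof.
apply/seteqP; split; last first.
  apply: span_image_sub; first exact: span_subspace.
  move=> s [sk hs]; apply: sub_span; exists (map zmon s).
  split; [by rewrite size_map| |reflexivity].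
  move=> u /mapP [M Ms ->]; apply/epsE; apply: sub_span; exists M => //; exact: hs.
apply: span_min; first exact: span_subspace.
move=> _ [us [<- hs ->]].
have h : span [set tword (map zmon ms) | ms in related (fun (_ : unit) => pwords)
    (map fst [seq (tt, u) | u <- us])] (tword (map snd [seq (tt, u) | u <- us])).
  by apply: tword_span => p /mapP [u uus ->]; apply/epsE/hs.
have e : [seq p.2 | p <- [seq (tt, u) | u <- us]] = us.
  by rewrite -map_comp; exact: map_id.
rewrite e in h; apply: span_mono h => _ [ms hms <-]; exists ms => //.
elim: us ms hms {hs e} => [|u us IH] [|M ms] //= [hM /IH [e1 e2]].
split=> /=; first by rewrite e1.
by move=> N; rewrite inE => /orP [/eqP ->|/e2].
Qed.

Lemma bar_deg_sub k d : gdeg k d `<=` bar eps k.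
Proof.
rewrite bar_degE barE; apply: span_image_sub; first exact: span_subspace.
by move=> s [hs _]; apply: sub_span; exists s.
Qed.

Lemma bars_list k y : exists2 r : seq (seq (seq I)), uniq r &
  forall s, s \in r <-> bars k s /\ sdeg s = y.
Proof.
have /finite_seqP [r hr] := finite_bars Dfin key ev deg_fin k y.
exists (undup r); first exact: undup_uniq.
move=> s; rewrite mem_undup; have e : [set` r] s <-> (bars k `&` sdeg @^-1` [set y]) s.
  by rewrite hr.
exact: e.
Qed.

Lemma bars_sorted k s M : bars k s -> M \in s -> sorted lei M.
Proof. by move=> [_ h] /h []. Qed.

Lemma bar_deg_listE k d (r : seq (seq (seq I))) : (forall s, s \in r <-> bars k s /\ sdeg s = Some d) ->
  gdeg k d = span [set bmon s | s in [set` r]].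
Proof.
move=> hr; rewrite bar_degE; congr span; apply/seteqP; split=> _ [s hs <-].
  by exists s => //; apply/hr.
by exists s => //; apply/hr.
Qed.

Lemma bphi_list k d (r : seq (seq (seq I))) : (forall s, s \in r <-> bars k s /\ sdeg s = Some d) ->
  forall s t, s \in r -> t \in r -> bphi s (bmon t) = (s == t)%:R.
Proof.
move=> hr s t _ /hr [ht _]; apply: bphi_bmon => M; exact: bars_sorted ht.
Qed.

Lemma bar_deg_subspace k d : subspace (gdeg k d).
Proof. exact: span_subspace. Qed.

Lemma bar_deg_fin k d : finite_dim (gdeg k d).
Proof.
have [r ur hr] := bars_list k (Some d); rewrite (bar_deg_listE hr).
exact: (dual_finite_dim bphi_linear (bphi_list hr) ur).
Qed.

(** Merging two neighbours adds their degrees, so the total degree is unchanged. *)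
Lemma bar_merge_deg (s : seq (D * B)) i : (i.+1 < size s)%N ->
  (forall p, p \in s -> udeg p.1 p.2) ->
  exists s' : seq (D * B), [/\ size s' = (size s).-1,
    forall p, p \in s' -> udeg p.1 p.2,
    osum (map fst s') = osum (map fst s) & map snd s' = bar_merge (map snd s) i].
Proof.
elim: i s => [|i IH] [|p [|q s]] // hi h.
  exists ((p.1 + q.1, p.2 * q.2) :: s); split=> //=.
  - move=> t; rewrite inE => /orP [/eqP ->|ts] /=; last by apply: h; rewrite !inE ts !orbT.
    by apply: udeg_mul; apply: h; rewrite !inE eqxx ?orbT.
  - by rewrite !osum_cons oaddA.
  - by rewrite bar_merge_cons2.
have [||s' [s1 s2 s3 s4]] := IH (q :: s); first by rewrite /= in hi *.
  by move=> t ts; apply: h; rewrite inE ts orbT.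
exists (p :: s'); split=> //=.
- by rewrite s1.
- by move=> t; rewrite inE => /orP [/eqP ->|/s2 //]; apply: h; rewrite inE eqxx.
- by rewrite osum_cons s3 /= !osum_cons.
- by rewrite s4.
Qed.

Lemma bar_diff_deg k d : @bar_diff F B @` gdeg k.+1 d `<=` gdeg k d.
Proof.
have dL := @bar_diff_linear F B; have hS := bar_deg_subspace k d.
suff h : forall t, homog_words (@tgen F B) udeg d k.+1 t -> gdeg k d (bar_diff t).
  by rewrite image_sub; exact: (span_lin dL hS h).
move=> _ [s [sk hs ds ->]].
rewrite (_ : \prod_(p <- s) tgen p.2 = tword (map snd s)); last by rewrite /tword big_map.
rewrite bar_diff_word /bar_word size_map sk /=.
rewrite big_seq_cond; apply: (subspace_sum hS) => i _; rewrite mem_index_iota andbT => /andP [_ ik].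
apply: (subspaceZ _ hS).
have [|s' [s1 s2 s3 s4]] := bar_merge_deg _ hs (i := i); first by rewrite sk.
apply: sub_span; exists s'; split=> //; [by rewrite s1 sk|by rewrite s3|].
by rewrite -s4 /tword big_map.
Qed.

(** Split a chain t with boundary in degree d as t1 + t2, where t2 involves only the other degrees.
    The boundary of t2 lies both in degree d and in the span of the other degrees, hence is zero,
    and t1 has the same boundary as t. *)
Lemma boundaries_deg k d :
  tor_boundaries eps k `&` gdeg k d = @bar_diff F B @` gdeg k.+1 d.
Proof.
have dL := @bar_diff_linear F B.
apply/seteqP; split; last first.
  by move=> y hy; split; [case: hy => t /bar_deg_sub ht <-; exists t|exact: bar_diff_deg hy].
move=> _ [[t ht <-] hd].
pose N k := span [set bmon s | s in bars k `&` [set s | sdeg s <> Some d]].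
have hN j : subspace (N j) by exact: span_subspace.
have hC := bar_deg_subspace k.+1 d.
have [t1 [t2 [ht1 ht2 te]]] : exists t1 t2, [/\ gdeg k.+1 d t1, N k.+1 t2 & t = t1 + t2].
  move: ht; rewrite barE => ht.
  apply: (span_ind (P := fun t => exists t1 t2, [/\ gdeg k.+1 d t1, N k.+1 t2 & t = t1 + t2]) ht).
    split; first by exists 0, 0; split; [exact: subspace_0|exact: subspace_0|rewrite addr0].
    move=> a _ _ [y1 [y2 [h1 h2 ->]]] [z1 [z2 [h3 h4 ->]]].
    exists (a *: y1 + z1), (a *: y2 + z2); split.
    - by apply: (subspaceD hC) => //; exact: (subspaceZ _ hC).
    - by apply: (subspaceD (hN _)) => //; exact: (subspaceZ _ (hN _)).
    - by rewrite scalerDr addrACA.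
  move=> _ [s hs <-]; have [sd|sd] := pselect (sdeg s = Some d).
    exists (bmon s), 0; split; [|exact: subspace_0|by rewrite addr0].
    by rewrite bar_degE; apply: sub_span; exists s.
  exists 0, (bmon s); split; [exact: subspace_0| |by rewrite add0r].
  by apply: sub_span; exists s.
have dN : N k (bar_diff t2).
  apply: (span_lin dL (hN k) _ ht2).
  move=> _ [s [hs /= sd] <-].
  have [e he] : exists e, sdeg s = Some e.
    case: s hs {sd} => [|M s] [//= _ hs]; rewrite sdeg_cons.
    have [e ->] := pwords_degree (hs M (mem_head _ _)).
    by case: (sdeg s) => [e'|]; eexists.
  have : gdeg k e (bar_diff (bmon s)).
    apply: bar_diff_deg; exists (bmon s) => //.
    by rewrite bar_degE; apply: sub_span; exists s.
  rewrite bar_degE; apply: span_mono => _ [s' [hs' /= e'] <-]; exists s' => //.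
  by split=> //=; rewrite e' -he.
have dt2 : gdeg k d (bar_diff t2).
  rewrite (_ : bar_diff t2 = bar_diff t - bar_diff t1); last first.
    by rewrite te (linD dL) addrC addKr.
  apply: (subspaceB (bar_deg_subspace k d)) => //.
  by apply: bar_diff_deg; exists t1.
exists t1 => //; rewrite te (linD dL).
suff -> : bar_diff t2 = 0 by rewrite addr0.
have [r ur hr] := bars_list k (Some d); rewrite (bar_deg_listE hr) in dt2.
apply: (dual_eq0 bphi_linear (bphi_list hr) ur dt2) => s /hr [hs ds].
apply: (span_lin (bphi_linear s) (subspace_set0 _) _ dN).
move=> _ [s' [hs' /= ds'] <-]; rewrite bphi_bmon; last by move=> M; exact: bars_sorted hs'.
by case: eqP => // e; case: ds'; rewrite -e.
Qed.

Lemma cycles_deg k d :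
  tor_cycles eps k `&` gdeg k d = gdeg k d `&` [set t | bar_diff t = 0].
Proof.
apply/seteqP; split=> t; first by move=> [[_ h] hd].
by move=> [hd h]; split; [split; [exact: bar_deg_sub hd|exact: h]|exact: hd].
Qed.

Section Automorphism.
Variables (f : B -> B) (om : I -> F).
Hypothesis f_lin : linear f.
Hypothesis f_mul : forall u v, f (u * v) = f u * f v.
Hypothesis f_deg : forall d u, udeg d u -> udeg d (f u).
Hypothesis f_coord : forall M, sorted lei M -> coord M (f (zmon M)) = wt om M.

Notation gB := (tensor_lift (fun u => tgen (f u))).

Lemma bar_act_linear : linear gB.
Proof. exact: tensor_map_linear f_lin. Qed.

Lemma bar_act_word us : gB (tword us) = tword (map f us).
Proof. exact: tensor_map_word f_lin us. Qed.

Lemma bar_diff_act t : bar_diff (gB t) = gB (bar_diff t).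
Proof. exact: bar_diff_map f_lin f_mul t. Qed.

Lemma bar_act_deg k d : gdeg k d `<=` gB @^-1` gdeg k d.
Proof.
apply: (span_lin bar_act_linear (bar_deg_subspace k d)).
move=> _ [s [sk hs ds ->]].
rewrite (_ : \prod_(p <- s) tgen p.2 = tword (map snd s)); last by rewrite /tword big_map.
rewrite bar_act_word; apply: sub_span; exists [seq (p.1, f p.2) | p <- s]; split.
- by rewrite size_map.
- by move=> _ /mapP [p /hs hp ->]; exact: f_deg.
- by rewrite -map_comp.
- by rewrite /tword !big_map.
Qed.

(** The diagonal coefficient at a tensor of monomials is the product of the diagonal coefficients of
    its factors. *)
Lemma bar_act_trace k d : has_trace (gdeg k d) [set 0] gB
  (gen (bars k) sdeg (swt om) (Some d)).
Proof.
have [r ur hr] := bars_list k (Some d).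
have E : gen (bars k) sdeg (swt om) (Some d) = \sum_(s <- r) bphi s (gB (bmon s)).
  rewrite /gen (fsbig_fwiden r) //.
  - rewrite big_seq [RHS]big_seq; apply: eq_bigr => s /hr [hs _].
    rewrite bar_act_word bphi_word /swt; elim: s {hs} (fun M => @bars_sorted _ _ M hs) => [|M s IH] h /=.
      by rewrite big_nil.
    rewrite big_cons IH; last by move=> N Ns; apply: h; rewrite inE Ns orbT.
    by rewrite f_coord //; exact: h (mem_head _ _).
  - by move=> s /= hs; apply/hr.
  - by move=> s [/= /hr hs]; case.
rewrite E (bar_deg_listE hr).
apply: (dual_trace bphi_linear (bphi_list hr) ur) => s sr.
rewrite -(bar_deg_listE hr); apply: bar_act_deg; rewrite (bar_deg_listE hr).
by apply: sub_span; exists s.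
Qed.

Lemma gdeg_small k d : (height Dfin (Some d) < k)%N -> gdeg k d `<=` [set 0].
Proof.
move=> hk; rewrite bar_degE; apply: span_min; first exact: subspace_set0.
move=> _ [s [[sk hs] /= ds] <-]; exfalso; move: hk; rewrite ltnNge => /negP; apply.
rewrite -sk -ds; apply: size_sdeg => M /hs; by case.
Qed.

(** A word with one factor has no neighbours to merge: the reduced complex has zero differential
    from its first term to F. *)
Lemma gdeg1 d t : gdeg 1 d t -> bar_diff t = 0.
Proof.
move=> ht; apply: (span_lin (@bar_diff_linear F B) (subspace_set0 _) _ ht).
move=> _ [[|p [|q s]] [//= _ _ _ ->]].
rewrite (_ : \prod_(p <- [:: p]) tgen p.2 = tword [:: p.2]); last first.
  by rewrite /tword !big_seq1.
by rewrite bar_diff_word /bar_word big_geq.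
Qed.

Lemma homology_euler d N : (height Dfin (Some d) <= N)%N ->
  \sum_(k < N) (-1) ^+ k *
    trace_mod (tor_cycles eps k.+1 `&` gdeg k.+1 d) (tor_boundaries eps k.+1 `&` gdeg k.+1 d) gB =
  \sum_(k < N) (-1) ^+ k * gen (bars k.+1) sdeg (swt om) (Some d).
Proof.
move=> hN; under eq_bigr do rewrite boundaries_deg cycles_deg.
apply: (@euler_poincare F (tensoralg B) (fun k => gdeg k d) (@bar_diff F B) gB
  (fun k => gen (bars k) sdeg (swt om) (Some d))).
- by move=> k; exact: bar_deg_subspace.
- by move=> k; exact: bar_deg_fin.
- exact: bar_diff_linear.
- exact: bar_act_linear.
- by move=> k; exact: bar_diff_deg.
- exact: bar_diff_diff.
- exact: bar_diff_act.
- by move=> k; exact: bar_act_deg.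
- by move=> k; exact: bar_act_trace.
- exact: gdeg1.
- exact: gdeg_small.
Qed.

(** Needed because [str_H] ranges over all positive k; it reduces that sum to a bounded one. *)
Lemma homology_small k d : (height Dfin (Some d) < k)%N ->
  trace_mod (tor_cycles eps k `&` gdeg k d) (tor_boundaries eps k `&` gdeg k d) gB = 0.
Proof.
move=> hk; have h0 := subspace_set0 (tensoralg B).
have g0 := gdeg_small hk; have hS := bar_deg_subspace k d.
rewrite cycles_deg boundaries_deg.
have -> : gdeg k d `&` [set t | bar_diff t = 0] = [set 0].
  apply/seteqP; split=> [t [/g0 //]|t ->]; split; first exact: subspace_0.
  by rewrite /= (lin0 (@bar_diff_linear F B)).
have -> : @bar_diff F B @` gdeg k.+1 d = [set 0].
  apply/seteqP; split=> [t ht|t ->]; first by apply: g0; exact: bar_diff_deg ht.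
  by exists 0; [exact: subspace_0 (bar_deg_subspace _ _)|rewrite (lin0 (@bar_diff_linear F B))].
apply: trace_modE => //; first exact: bar_act_linear.
  by move=> t ->; rewrite /preimage /= (lin0 bar_act_linear).
exact: has_trace0.
Qed.

End Automorphism.

End BarTraces.

(** * The denominator identity *)

Section Signs.
Variables (F : numFieldType) (Gam : addSemigroupType) (A : zmodType).
Variables (theta : A -> A -> F) (theta_coloring : coloring theta).
Variables (I : choiceType) (deg : I -> (Gam * A)%type) (lam : I -> F).
Notation D := (Gam * A)%type.

Definition opsi (y : option D) : F := if y is Some d then psi theta d.2 else 1.

(** The mixed factors theta(a,b) and theta(b,a) cancel, so the sign of a monomial is the product of
    the signs of its letters. *)
Lemma opsiD y z : opsi (oadd y z) = opsi y * opsi z.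
Proof.
case: y z => [d|] [e|] /=; rewrite ?mulr1 ?mul1r //.
rewrite /psi (coloring_addl theta_coloring) !(coloring_addr theta_coloring).
by rewrite mulrA -[theta d.2 d.2 * _ * _]mulrA (coloring_skew theta_coloring) mulr1.
Qed.

(** Weighting letters by signed eigenvalues turns supertraces into plain weighted counts of
    words. *)
Definition signed i := psi theta (deg i).2 * lam i.

Lemma wt_signed w : wt signed w = opsi (wdeg deg w) * wt lam w.
Proof.
elim: w => [|i w IH]; first by rewrite /wt /wdeg /osum !big_nil mulr1.
rewrite /wt !big_cons -!/(wt _ _) IH wdeg_cons opsiD /= mulrACA //.
Qed.

Lemma swt_signed s : swt signed s = opsi (sdeg deg s) * swt lam s.
Proof.
elim: s => [|w s IH]; first by rewrite /swt /sdeg !big_nil mulr1.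
by rewrite /swt !big_cons -!/(swt _ _) IH wt_signed sdeg_cons opsiD mulrACA.
Qed.

Lemma gen_signed (T : set (seq (seq I))) d :
  gen T (sdeg deg) (swt signed) (Some d) = psi theta d.2 * gen T (sdeg deg) (swt lam) (Some d).
Proof.
rewrite /gen mulr_fsumr; apply: eq_fsbigr => s; rewrite inE => -[_ /= ds].
by rewrite swt_signed ds.
Qed.

End Signs.

Section Denominator.
Variables (F : numFieldType) (Gam : addSemigroupType) (A : zmodType).
Variables (theta : A -> A -> F).
Variables (L : lmodType F) (Lg : Gam * A -> set L) (br : L -> L -> L).
Variables (I : choiceType) (disp : Order.disp_t) (K : orderType disp) (key : I -> K).
Variables (deg : I -> (Gam * A)%type) (x : I -> L) (xi : I -> L -> F).
Hypothesis H : adapted_basis theta Lg br key deg x xi.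
Notation D := (Gam * A)%type.
Hypothesis Dfin : finite_decompositions D.
Hypothesis deg_fin : forall d, finite_set [set i | deg i = d].
Variable idx : I -> nat.
Variable g : L -> L.
Hypothesis g_triang : forall i j, xi j (g (x i)) != 0 -> j = i \/ (idx i < idx j)%N.
Hypothesis g_lin : linear g.
Hypothesis g_br : forall u v, g (br u v) = br (g u) (g v).
Hypothesis g_deg : forall d u, Lg d u -> Lg d (g u).

Notation ev := (fun i => theta (deg i).2 (deg i).2 == 1).
Notation lei := (lei key ev).
Notation wdeg := (wdeg deg).
Notation sdeg := (sdeg deg).
Notation bars := (bars key ev).
Notation U := (uea theta Lg br).
Notation ug := (ugen theta Lg br).
Notation phi := (phi key deg x xi).
Notation zmon := (zmon theta Lg br x).
Notation eps := (@counit F Gam A theta L Lg br).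
Notation udeg := (@uea_deg F Gam A theta L Lg br).
Notation lam := (eigen x xi g).
Notation om := (signed theta deg lam).
Notation gU := (uea_lift (fun v => ug (g v))).

(** U(L) seen only as an algebra, the form in which the results on the bar complex are applied. *)
Definition Ualg : algType F := U.

Let gUL : linear (gU : U -> U) :=
  uea_lift_linear (gU_lin_gen theta Lg br g_lin) (gU_br_gen theta g_br g_deg).
Let gUM : forall u v : U, gU (u * v) = gU u * gU v :=
  uea_liftM (gU_lin_gen theta Lg br g_lin) (gU_br_gen theta g_br g_deg).

Lemma gU_deg d u : udeg d u -> udeg d (gU u : U).
Proof.
move: u; apply: (span_lin gUL (span_subspace _)).
move=> _ [k _ [s [sk hs ds ->]]].
rewrite -(big_map snd xpredT ug) (@gU_prod F Gam A theta L Lg br g g_lin g_br g_deg).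
apply: sub_span; exists k => //; exists [seq (p.1, g p.2) | p <- s]; split.
- by rewrite size_map.
- by move=> _ /mapP [p /hs hp ->]; exact: g_deg.
- by rewrite -map_comp.
- by rewrite !big_map.
Qed.

Lemma str_homologyE k d : str_homology theta Lg br g k d = psi theta d.2 *
  trace_mod (tor_cycles (eps : Ualg -> F) k `&` gdeg (udeg : D -> set Ualg) k d)
    (tor_boundaries (eps : Ualg -> F) k `&` gdeg (udeg : D -> set Ualg) k d)
    (tensor_lift (fun u : Ualg => tgen (gU u : Ualg))).
Proof. reflexivity. Qed.

Let coord (M : seq I) : Ualg -> F := phi (delta F M).
Let coord_lin M : linear (coord M : Ualg -> F^o).
Proof. exact: (phi_linear H (delta F M)). Qed.
Let coord_zmon M N : sorted lei N -> coord M (zmon N) = (M == N)%:R.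
Proof. exact: (phi_delta H). Qed.
Let udegE (d : D) : (udeg d : set Ualg) =
  span [set (zmon M : Ualg) | M in [set M | sorted lei M /\ wdeg M = Some d]].
Proof. exact: (uea_degE H). Qed.
Let udeg_mul (d e : D) (u v : Ualg) : udeg d u -> udeg e v -> udeg (d + e) (u * v).
Proof. exact: uea_deg_mul. Qed.
Let epsE (u : Ualg) : eps u = 0 <-> span [set (zmon M : Ualg) | M in pwords key ev] u.
Proof. exact: (counit_eq0P H). Qed.
Let f_coord M : sorted lei M -> coord M (gU (zmon M)) = wt lam M.
Proof. exact: (phi_gU H g_triang g_lin g_br g_deg). Qed.

Lemma str_homology_sum d N : (height Dfin (Some d) <= N)%N ->
  \sum_(k < N) (-1) ^+ k * str_homology theta Lg br g k.+1 d =
  \sum_(k < N) (-1) ^+ k * gen (bars k.+1) sdeg (swt om) (Some d).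
Proof.
move=> hN.
under eq_bigr do rewrite str_homologyE mulrCA.
under [RHS]eq_bigr do rewrite (gen_signed (ab_coloring H)) mulrCA.
rewrite -!mulr_sumr; congr (_ * _).
exact: (@homology_euler F D Dfin I disp K key ev deg deg_fin Ualg eps udeg zmon coord
  coord_lin coord_zmon udegE udeg_mul epsE _ lam gUL gUM gU_deg f_coord d N hN).
Qed.

Lemma str_homology_small k d : (height Dfin (Some d) < k)%N ->
  str_homology theta Lg br g k d = 0.
Proof.
move=> hk; rewrite str_homologyE.
by rewrite (@homology_small F D Dfin I disp K key ev deg deg_fin Ualg eps udeg zmon coord
  coord_lin coord_zmon udegE udeg_mul epsE _ gUL k d hk) mulr0.
Qed.

Lemma str_H_sum d N : (height Dfin (Some d) <= N)%N ->
  str_H theta Lg br g d =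
  \sum_(k < N) (-1) ^+ k * gen (bars k.+1) sdeg (swt om) (Some d).
Proof.
move=> hN; rewrite -str_homology_sum // /str_H.
(* In homological degree k + 1 the sign (-1)^(k+2) equals (-1)^k. *)
rewrite (reindex_fsbig S [set: nat]); last first.
  split=> //; first by move=> i j _ _ [].
  by move=> [|k] //= _; exists k.
rewrite (fsbig_ord _ N (fun k => (-1) ^+ k * str_homology theta Lg br g k.+1 d)).
rewrite -(@fsbig_widen _ _ 0 +%R `I_N setT) //.
  by apply: eq_fsbigr => k _; rewrite !exprS !mulN1r opprK.
move=> k [_ /= /negP]; rewrite -leqNgt => Nk.
by rewrite str_homology_small ?mulr0 // ltnS (leq_trans hN).
Qed.

Definition homology_series : fseries F D :=
  fsub fone (fsum (fun d : D => fscale (str_H theta Lg br g d) (fmono (Some d)))).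

Lemma homology_series_inv :
  fmul homology_series (gen (words key ev predT) wdeg (wt om)) = fone.
Proof.
apply: (words_inverse (Dfin := Dfin) deg_fin) => y N hN.
rewrite /homology_series /fsub /fsum /fscale big_ord_recl expr0 mul1r gen_bars0.
congr (_ + _); case: y hN => [d|] hN; last first.
  rewrite fsbig1 ?oppr0 => [|d _]; last by rewrite /fmono /= mulr0.
  by rewrite big1 // => k _; rewrite (@gen_bars_small _ _ Dfin) ?mulr0 // height_None.
rewrite -(@fsbig_widen _ _ 0 +%R [set d] setT) //; last first.
  move=> e [_ /= ed]; rewrite /fmono; case: eqP => [[de]|]; last by rewrite mulr0.
  by case: ed.
rewrite fsbig_set1 /fmono eqxx mulr1 (str_H_sum hN) -sumrN.
by apply: eq_bigr => k _; rewrite /= exprS mulN1r mulNr.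
Qed.

(** For an odd letter the weight is - lam, and the two minus signs in the power cancel. Both
    parities thus give psi times a power of the eigenvalue, the contribution of the letter to the
    supertrace of the (n+1)-st power of g. *)
Lemma letter_log_signed i n :
  letter_log ev om i n = psi theta (deg i).2 * lam i ^+ n.+1.
Proof.
rewrite /letter_log /signed /psi; case: ifP => [/eqP ->|/negbT h]; first by rewrite !mul1r.
by rewrite (thN H h) mulN1r opprK mulN1r.
Qed.

(** The supertraces enter only as signed power sums of eigenvalues, so they are kept abstract;
    dividing them by r + 1 integrates the logarithmic derivative. *)
Lemma denominator (str : D -> nat -> F) :
  (forall d l r, uniq l -> (forall i, (i \in l) = (deg i == d)) ->
     str d r = psi theta d.2 * \sum_(i <- l) lam i ^+ r.+1) ->
  is_fprod (fun d : D => fexp (fscale (-1) (fsum (fun r : nat =>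
      fscale (r.+1%:R^-1 * str d r) (fmono (Some (mulS d r)))))))
    homology_series.
Proof.
move=> hstr; apply: (fprod_words Dfin (ab_key_inj H) deg_fin _ homology_series_inv) => d.
have [l ul dl] : exists2 l : seq I, uniq l & forall i, (i \in l) = (deg i == d).
  have /finite_seqP [l hl] := deg_fin d; exists (undup l); first exact: undup_uniq.
  move=> i; rewrite mem_undup; apply/idP/eqP => [il|di].
    by have : [set i | deg i = d] i by rewrite hl.
  by have : [set` l] i by rewrite -hl.
rewrite (series_subst_mono Dfin).
pose s n := if n is r.+1 then - (r.+1%:R^-1 * str d r) else 0.
rewrite (_ : fscale (-1) _ = subst_mono d s); last first.
  apply/funext => y; rewrite /fscale /subst_mono /gen mulr_fsumr.
  by apply: eq_fsbigr => -[|r] _; rewrite /= ?mulr0 // mulN1r.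
apply: (fexp_words Dfin (ab_key_inj H) deg_fin ul dl) => // n.
rewrite /= mulrN mulrA mulfV ?pnatr_eq0 // mul1r (hstr d l n ul dl) mulr_sumr.
congr (- _); rewrite big_seq [RHS]big_seq; apply: eq_bigr => i.
by rewrite dl letter_log_signed => /eqP ->.
Qed.

End Denominator.

(** * Existence of adapted bases *)

Section TriangularBasis.
Variables (F : numClosedFieldType) (V : lmodType F).

(** Over an algebraically closed field the matrix of f is conjugate to a lower triangular one. As
    rows hold images, f(b_i) involves only the b_j with j <= i. *)
Lemma triangular_basis (S : set V) (f : V -> V) : subspace S -> finite_dim S ->
  linear f -> S `<=` f @^-1` S ->
  exists n (b : 'I_n -> V), basis_mod S [set 0] b /\
    exists T : 'M[F]_n, (forall i, f (b i) = comb b (row i T)) /\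
      forall i j : 'I_n, (i < j)%N -> T i j = 0.
Proof.
move=> hS [n [b hb]] fL fS; have h0 := subspace_set0 V.
move: (hb) => /basis_modP []// bS b1 b2.
have h j : exists c, f (b j) = comb b c.
  by have [c /eqP] := b1 _ (fS _ (bS j)); rewrite subr_eq0 => /eqP; exists c.
have {h} [p hp] := choice h; pose M := \matrix_i p i.
have [|P Pu] := @cotrigonalization F n [:: M].
  by move=> ? ? /[!inE] /eqP -> /eqP ->.
rewrite /= andbT /similar_to => /is_trig_mxP tri.
have Pun := unitarymx_unit Pu; set T := conjmx P M in tri.
have PM : P *m M = T *m P by rewrite /T conjumx // mulmxKV.
have cE c : comb (fun i => comb b (row i P)) c = comb b (c *m P).
  by rewrite comb_mul.
have fE c : f (comb b c) = comb b (c *m M).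
  rewrite comb_mul /comb (lin_sum fL); apply: eq_bigr => i _.
  by rewrite (linZ fL) hp rowK.
exists n, (fun i => comb b (row i P)); split.
  apply/basis_modP => //; split.
  - by move=> i; exact: comb_sub.
  - by move=> v /b1 [c hc]; exists (c *m invmx P); rewrite cE mulmxKV.
  - move=> c; rewrite cE => /b2 cP.
    by rewrite -[c](mulmxK Pun) cP mul0mx.
exists T; split=> // i.
by rewrite fE cE -!row_mul PM.
Qed.

End TriangularBasis.

Section BasisCoordinates.
Variables (F : fieldType) (V : lmodType F) (I : choiceType) (x : I -> V).
Implicit Types (c : I -> F) (r : seq I).

Definition lincomb c : V := \sum_(i \in [set: I]) c i *: x i.

Lemma lincombE c r : uniq r -> (forall i, i \notin r -> c i = 0) ->
  lincomb c = \sum_(i <- r) c i *: x i.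
Proof.
move=> ur cr; rewrite /lincomb (fsbigE r) //; last by move=> i _ /cr ->; rewrite scale0r.
by apply: eq_bigl => i; rewrite in_setT.
Qed.

Definition spanned v := exists c r, [/\ uniq r, forall i, i \notin r -> c i = 0 & v = lincomb c].

Lemma lincombD a c c' r r' : uniq r -> (forall i, i \notin r -> c i = 0) ->
  uniq r' -> (forall i, i \notin r' -> c' i = 0) ->
  lincomb (fun i => a * c i + c' i) = a *: lincomb c + lincomb c'.
Proof.
move=> ur cr ur' cr'; have ut := undup_uniq (r ++ r').
have ct i : i \notin undup (r ++ r') -> c i = 0 /\ c' i = 0.
  by rewrite mem_undup mem_cat negb_or => /andP [/cr -> /cr' ->].
rewrite !(lincombE ut); try by move=> i /ct [h1 h2]; rewrite ?h1 ?h2 ?mulr0 ?addr0.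
rewrite scaler_sumr -big_split; apply: eq_bigr => i _ /=.
by rewrite scalerDl scalerA.
Qed.

Lemma spanned_subspace : subspace spanned.
Proof.
split.
  exists (fun=> 0), [::]; split=> //.
  by rewrite (@lincombE _ [::]) // big_nil.
move=> a _ _ [c [r [ur cr ->]]] [c' [r' [ur' cr' ->]]].
exists (fun i => a * c i + c' i), (undup (r ++ r')); split; first exact: undup_uniq.
  by move=> i; rewrite mem_undup mem_cat negb_or => /andP [/cr -> /cr' ->]; rewrite mulr0 addr0.
by rewrite (lincombD _ ur cr ur' cr').
Qed.

Hypothesis x_span : forall v, spanned v.
Hypothesis x_free : forall r c, uniq r -> \sum_(i <- r) c i *: x i = 0 ->
  forall i, i \in r -> c i = 0.

(** Choose an expansion of every vector; freeness makes expansions unique, and uniqueness makes the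
    chosen coefficients linear. *)
Lemma exists_coordinates : exists xi : I -> V -> F,
  [/\ forall i, linear (xi i : V -> F^o),
      forall v, finite_set [set i | xi i v != 0],
      forall v, v = \sum_(i \in [set: I]) xi i v *: x i &
      forall i j, xi i (x j) = (i == j)%:R].
Proof.
have [c hc] := choice x_span.
have [r hr] := choice hc => {hc}.
have inj c1 r1 c2 r2 : uniq r1 -> (forall i, i \notin r1 -> c1 i = 0) ->
    uniq r2 -> (forall i, i \notin r2 -> c2 i = 0) -> lincomb c1 = lincomb c2 -> c1 =1 c2.
  move=> u1 h1 u2 h2 e i; apply/eqP; rewrite -subr_eq0; apply/eqP.
  have ut := undup_uniq (r2 ++ r1).
  have ct j : j \notin undup (r2 ++ r1) -> -1 * c2 j + c1 j = 0.
    by rewrite mem_undup mem_cat negb_or => /andP [/h2 -> /h1 ->]; rewrite mulr0 addr0.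
  have := lincombD (-1) u2 h2 u1 h1; rewrite e scaleN1r addNr (lincombE ut ct).
  move=> /(x_free ut) h; have [/h|/ct] := boolP (i \in undup (r2 ++ r1));
    by rewrite mulN1r addrC.
exists (fun i v => c v i); split.
- move=> i a v w; have [uv cv ev] := hr v; have [uw cw ew] := hr w.
  have [u h e] := hr (a *: v + w).
  have ut := undup_uniq (r v ++ r w).
  rewrite [c (a *: v + w) i](inj _ _ (fun i => a * c v i + c w i) _ u h ut) //.
    by move=> j; rewrite mem_undup mem_cat negb_or => /andP [/cv -> /cw ->]; rewrite mulr0 addr0.
  by rewrite (lincombD _ uv cv uw cw) -ev -ew -e.
- move=> v; have [_ h _] := hr v; apply: (@sub_finite_set _ _ [set` r v]); last exact: finite_seq.
  by move=> i /=; apply: contraNT => /h ->.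
- by move=> v; have [_ _] := hr v.
- move=> i j; have [u h e] := hr (x j).
  rewrite (inj _ _ (fun i => (i == j)%:R) [:: j] u h) //.
    by move=> k; rewrite inE => /negbTE ->.
  rewrite -e (@lincombE _ [:: j]) ?big_seq1 ?eqxx ?scale1r //.
  by move=> k; rewrite inE => /negbTE ->.
Qed.

End BasisCoordinates.

Section HomogeneousBasis.
Variables (F : fieldType) (V : lmodType F) (D : choiceType) (Vg : D -> set V).
Hypothesis V_grading : grading Vg.
Variables (n : D -> nat) (b : forall d, 'I_(n d) -> V).
Hypothesis b_basis : forall d, basis_mod (Vg d) [set 0] (@b d).

Notation I := {d : D & 'I_(n d)}.
Definition hbasis (i : I) : V := @b (tag i) (tagged i).

Let Vs d := grading_subspace V_grading d.
Let bP d := (basis_modP (@b d) (Vs d) (subspace_set0 V)).1 (b_basis d).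

Lemma hbasis_homog i : Vg (tag i) (hbasis i).
Proof. by case: (bP (tag i)) => h _ _; exact: h. Qed.

Lemma hbasis_comp d v : Vg d v ->
  exists c : 'rV_(n d), v = \sum_j c 0 j *: hbasis (existT _ d j).
Proof.
have [_ h _] := bP d; move=> /h [c /eqP]; rewrite subr_eq0 => /eqP.
by exists c.
Qed.

Lemma hbasis_span v : spanned hbasis v.
Proof.
have hS := spanned_subspace hbasis.
have [s [hs ->]] := grading_span V_grading v.
apply: (subspace_sum hS) => p /hs hp _; have [c ->] := hbasis_comp hp.
apply: (subspace_sum hS) => j _ _; apply: (subspaceZ _ hS).
pose i : I := existT _ p.1 j.
exists (fun k => (k == i)%:R), [:: i]; split=> //.
  by move=> k; rewrite inE => /negbTE ->.
rewrite (@lincombE _ _ _ _ _ [:: i]) ?big_seq1 ?eqxx ?scale1r //.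
by move=> k; rewrite inE => /negbTE ->.
Qed.

(** Grouping the terms by degree, directness of the grading kills each group, and each group is a
    combination of the basis of one component. *)
Lemma hbasis_free (r : seq I) (c : I -> F) : uniq r -> \sum_(i <- r) c i *: hbasis i = 0 ->
  forall i, i \in r -> c i = 0.
Proof.
move=> ur h0 i ir.
pose ds := undup [seq tag k | k <- r].
pose y d := \sum_(k <- r | tag k == d) c k *: hbasis k.
have y0 : forall d, d \in ds -> y d = 0.
  apply: (grading_direct V_grading); first exact: undup_uniq.
    move=> d; apply: (subspace_sum (Vs d)) => k _ /eqP <-.
    by apply: (subspaceZ _ (Vs _)); exact: hbasis_homog.
  rewrite -[RHS]h0 /y (exchange_big_dep xpredT) //=; rewrite big_seq [RHS]big_seq; apply: eq_bigr => k kr.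
  rewrite -big_filter (_ : seq.filter _ _ = [:: tag k]) ?big_seq1 //.
  have : perm_eq (seq.filter (fun d => tag k == d) ds) [:: tag k].
    apply: uniq_perm => //; first by rewrite filter_uniq ?undup_uniq.
    move=> d; rewrite mem_filter inE eq_sym; case: eqP => //= ->.
    by rewrite mem_undup map_f.
  by move=> /perm_size; move: (seq.filter_all (fun d => tag k == d) ds);
     case: (seq.filter _ _) => [|d [|]] //= /andP [/eqP -> _].
case: i ir => d j ir.
have {y0} := y0 d; rewrite mem_undup => /(_ (map_f (fun k : I => tag k) ir)) yd.
pose e k : I := existT (fun d => 'I_(n d)) d k.
have yE : y d = comb (@b d) (\row_k (if e k \in r then c (e k) else 0)).
  rewrite /y /comb -big_filter.
  rewrite (eq_bigr (fun k => if e k \in r then c (e k) *: hbasis (e k) else 0)); last first.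
    by move=> k _; rewrite mxE; case: ifP; rewrite ?scale0r.
  rewrite -big_mkcond -[RHS]big_filter -(big_map e xpredT (fun k => c k *: hbasis k)) /=.
  apply: perm_big; apply: uniq_perm; first by rewrite filter_uniq.
    rewrite map_inj_uniq ?filter_uniq ?index_enum_uniq //.
    by move=> k k' /eqP; rewrite eq_Tagged => /eqP.
  move=> k; rewrite mem_filter; apply/andP/mapP => [[/eqP kd kr]|[k' + ->]].
    case: k kd kr => d' k /= dd; subst d'; exists k => //.
    by rewrite mem_filter kr mem_index_enum.
  by rewrite mem_filter => /andP [h _]; split=> //=.
have [_ _ h] := bP d; have := h _ (etrans (esym yE) yd).
by move=> /rowP /(_ j); rewrite !mxE /e ir.
Qed.

End HomogeneousBasis.

(** * Traces of powers on the graded components *)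

Section TracePowers.
Variables (F : numFieldType) (Gam : addSemigroupType) (A : zmodType).
Variables (theta : A -> A -> F).
Variables (L : lmodType F) (Lg : Gam * A -> set L) (br : L -> L -> L).
Variables (I : choiceType) (disp : Order.disp_t) (K : orderType disp) (key : I -> K).
Variables (deg : I -> (Gam * A)%type) (x : I -> L) (xi : I -> L -> F).
Hypothesis H : adapted_basis theta Lg br key deg x xi.
Variable idx : I -> nat.
Variable g : L -> L.
Hypothesis g_triang : forall i j, xi j (g (x i)) != 0 -> j = i \/ (idx i < idx j)%N.
Hypothesis g_lin : linear g.
Hypothesis g_deg : forall d u, Lg d u -> Lg d (g u).

Lemma iter_linear m : linear (iter m g).
Proof. by elim: m => // m IH a u v; rewrite !iterS IH g_lin. Qed.

Lemma iter_deg m d u : Lg d u -> Lg d (iter m g u).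
Proof. by elim: m => // m IH du; rewrite iterS; apply: g_deg; exact: IH. Qed.

(** Both claims are proved together: the diagonal entry of the next power is a product of diagonal
    entries only because the previous power is triangular. *)
Lemma iter_triang m i : xi i (iter m g (x i)) = eigen x xi g i ^+ m /\
  forall j, xi j (iter m g (x i)) != 0 -> j = i \/ (idx i < idx j)%N.
Proof.
elim: m => [|m [IH1 IH2]].
  rewrite /= (ab_dual H) eqxx; split=> // j; rewrite (ab_dual H).
  by have [->|_] := eqVneq j i; [left|rewrite eqxx].
set v := iter m g (x i) in IH1 IH2.
have E j : xi j (iter m.+1 g (x i)) = \sum_(k <- supp xi v) xi k v * xi j (g (x k)).
  rewrite iterS -/v (lin_eq_ext (ab_fin H) (ab_sum H) v g_lin) (ext_supp (ab_fin H)).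
  rewrite (lin_sum (ab_lin H j)); apply: eq_bigr => k _.
  by rewrite (linZ (ab_lin H j)).
split=> [|j]; last first.
  rewrite E => h; have [k kv] : exists2 k, k \in supp xi v & xi j (g (x k)) != 0.
    apply: contrapT => nk; move: h; rewrite big_seq big1 ?eqxx // => k kv.
    have [-> |h] := eqVneq (xi j (g (x k))) 0; first by rewrite mulr0.
    by case: nk; exists k.
  move: kv; rewrite (mem_supp (ab_fin H)) => /IH2 ik /g_triang kj.
  by case: ik kj => [->|ik] [->|kj]; [left|right|right|right; exact: ltn_trans ik kj].
rewrite E exprSr -IH1.
have off k : k != i -> xi k v * xi i (g (x k)) = 0.
  move=> ki; have [->|/IH2] := eqVneq (xi k v) 0; first by rewrite mul0r.
  case=> [e|ik]; first by rewrite e eqxx in ki.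
  have [->|/g_triang] := eqVneq (xi i (g (x k))) 0; first by rewrite mulr0.
  by case=> [e|]; [rewrite e eqxx in ki|rewrite ltnNge ltnW].
have [iv|iv] := boolP (i \in supp xi v).
  by rewrite (bigD1_seq i) ?supp_uniq //= big1 ?addr0.
have := iv; rewrite (mem_supp (ab_fin H)) negbK => /eqP ->; rewrite mul0r.
rewrite big_seq big1 // => k kv; apply: off; apply: contraNneq iv => <-; exact: kv.
Qed.

Lemma component_span d (l : seq I) : (forall i, (i \in l) = (deg i == d)) ->
  Lg d = span [set x i | i in [set` l]].
Proof.
move=> dl; have hL := grading_subspace (color_lie_grading (ab_lie H)) d.
apply/seteqP; split=> [v dv|]; last first.
  apply: span_image_sub => // i /=; rewrite dl => /eqP <-; exact: ab_deg H i.
have hS := span_subspace [set x i | i in [set` l]].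
rewrite [v](ab_sum H); apply: (ext_mem (ab_fin H) hS) => i iv.
by apply: sub_span; exists i => //=; rewrite dl (ab_hom H dv iv).
Qed.

Lemma trace_on_iter d (l : seq I) m : uniq l -> (forall i, (i \in l) = (deg i == d)) ->
  trace_on (Lg d) (iter m g) = \sum_(i <- l) eigen x xi g i ^+ m.
Proof.
move=> ul dl; have hS := component_span dl.
have hL := grading_subspace (color_lie_grading (ab_lie H)) d.
have := dual_trace (ab_lin H) (fun i j _ _ => ab_dual H i j) ul (f := iter m g).
rewrite -hS => /(_ _) h; apply: trace_modE => //.
- exact: subspace_set0.
- exact: iter_linear.
- by move=> v ->; rewrite /preimage /= (lin0 (iter_linear m)).
rewrite (eq_bigr (fun i => xi i (iter m g (x i)))); last first.
  by move=> i _; case: (iter_triang m i).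
apply: h => i; rewrite dl => /eqP <-; apply: iter_deg; exact: ab_deg H i.
Qed.

End TracePowers.

(** * Choice of an adapted basis and conclusion *)

Theorem mainTheorem1 (R : realType) (Gam : addSemigroupType) (A : zmodType)
  (Gam_countable : countable [set: Gam]) (A_countable : countable [set: A])
  (D_finite : finite_decompositions (Gam * A)%type)
  (theta : A -> A -> R[i]) (theta_coloring : coloring theta)
  (L : lmodType R[i]) (Lg : (Gam * A)%type -> set L) (br : L -> L -> L)
  (L_color_lie : color_lie theta Lg br)
  (L_finite_dim : forall d : (Gam * A)%type, finite_dim (Lg d))
  (G : groupType) (rho : G -> L -> L) (G_action : graded_action Lg br rho)
  (g : G) :
  is_fprod
    (fun d : (Gam * A)%type =>
      fexp (fscale (-1)
        (fsum (fun r : nat =>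
           fscale (r.+1%:R^-1 * str_Lie theta Lg (rho (g ^+ r.+1)%g) d)
                  (fmono (Some (mulS d r)))))))
    (fsub fone
      (fsum (fun d : (Gam * A)%type =>
         fscale (str_H theta Lg br (rho g) d) (fmono (Some d))))).
Proof.
have fL : linear (rho g) by exact: action_linear G_action g.
have fbr u v : rho g (br u v) = br (rho g u) (rho g v) by exact: action_br G_action g u v.
have fdeg d u : Lg d u -> Lg d (rho g u) by exact: action_graded G_action g d u.
have hgr := color_lie_grading L_color_lie.
have hbas d : exists n (b : 'I_n -> L), basis_mod (Lg d) [set 0] b /\
    exists T : 'M[R[i]]_n, (forall i, rho g (b i) = comb b (row i T)) /\
      forall i j : 'I_n, (i < j)%N -> T i j = 0.
  apply: triangular_basis => //; first exact: grading_subspace hgr d.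
  exact: fdeg.
have [n hn] := choice hbas.
pose b d := projT1 (cid (hn d)).
have hb d : basis_mod (Lg d) [set 0] (b d) /\
    exists T : 'M[R[i]]_(n d), (forall i, rho g (b d i) = comb (b d) (row i T)) /\
      forall i j : 'I_(n d), (i < j)%N -> T i j = 0.
  by rewrite /b; case: cid.
pose I := {d : (Gam * A)%type & 'I_(n d)}.
pose x := hbasis (n := n) b.
have [xi [xi_lin xi_fin xi_sum xi_x]] := exists_coordinates
  (hbasis_span hgr (fun d => (hb d).1)) (hbasis_free hgr (fun d => (hb d).1)).
have /countable_injP [cG cG_inj] := Gam_countable.
have /countable_injP [cA cA_inj] := A_countable.
(* The height comes first so that brackets only involve larger keys; the enumerations of Gam and A
   and the position inside the component make the key injective. *)
pose key (i : I) : seqlexi nat := [:: height D_finite (Some (tag i)); cG (tag i).1;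
  cA (tag i).2; nat_of_ord (tagged i)].
have cinj (d e : (Gam * A)%type) : cG d.1 = cG e.1 -> cA d.2 = cA e.2 -> d = e.
  case: d e => [d1 d2] [e1 e2] /= h1 h2.
  have -> : d1 = e1 by apply: cG_inj h1; rewrite in_setT.
  by have -> : d2 = e2 by apply: cA_inj h2; rewrite in_setT.
have H : adapted_basis theta Lg br key (@tag _ _ : I -> _) x xi.
  split=> //.
  - move=> [d k] [e l] [_ h1 h2 /= h3].
    have de := cinj _ _ h1 h2; rewrite /= in de; subst e.
    by congr existT; exact/val_inj.
  - by move=> i; exact: (hbasis_homog hgr (fun d => (hb d).1) i).
  - move=> d v i dv; have [c ->] := hbasis_comp hgr (fun d => (hb d).1) dv.
    rewrite (lin_sum (xi_lin i)) => h.
    apply/eqP/contraT => id; move: h; rewrite big1 ?eqxx // => k _.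
    rewrite (linZ (xi_lin i)) xi_x; case: eqP => [e|_]; last by rewrite scaler0.
    by rewrite e eqxx in id.
  - move=> i j k kij.
    have h : (height D_finite (Some (tag i)) < height D_finite (Some (tag k)))%N.
      by rewrite kij; exact: height_ltl.
    by rewrite /key Order.SeqLexiOrder.Exports.ltxi_cons !leEnat ltnW // leqNgt h.
(* By triangularity, g sends a letter to letters at the same or earlier positions of its component;
   counting positions from the end makes the others larger. *)
pose idx (i : I) := (n (tag i) - tagged i)%N.
have g_triang i j : xi j (rho g (x i)) != 0 -> j = i \/ (idx i < idx j)%N.
  case: i => d k; have [hbd [T [hT tT]]] := hb d.
  rewrite /x /hbasis /= hT /comb (lin_sum (xi_lin j)) => h.
  have [l] : exists l, xi j (row k T 0 l *: b d l) != 0.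
    apply: contrapT => nl; move: h; rewrite big1 ?eqxx // => l _; apply/eqP.
    by apply: contraT => hl; case: nl; exists l.
  rewrite mxE (linZ (xi_lin j)) -[b d l]/(x (existT _ d l)) xi_x.
  have [->|_] := eqVneq j (existT _ d l); last by rewrite scaler0 eqxx.
  move=> hTkl; have lk : (l <= k)%N.
    by rewrite leqNgt; apply/negP => kl; move: hTkl; rewrite tT // scale0r eqxx.
  move: lk; rewrite leq_eqVlt => /orP [/eqP /val_inj ->|lk]; first by left.
  by right; rewrite /idx /=; have := ltn_ord k; lia.
have deg_fin d : finite_set [set i : I | tag i = d].
  apply: (@sub_finite_set _ _ [set` [seq existT (fun d => 'I_(n d)) d k | k <- enum 'I_(n d)]]).
    by move=> [e k] /= ed; subst e; apply/mapP; exists k => //; rewrite mem_enum.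
  exact: finite_seq.
have rho_iter m : rho (g ^+ m)%g = iter m (rho g).
  apply/funext => v; elim: m => [|m IH]; first by rewrite expg0 (action1 G_action).
  by rewrite expgS (actionM G_action) IH iterS.
apply: (denominator H D_finite deg_fin g_triang fL fbr fdeg
  (str := fun d r => str_Lie theta Lg (rho (g ^+ r.+1)%g) d)) => d l r ul dl.
rewrite /str_Lie rho_iter; congr (_ * _).
exact: (trace_on_iter H g_triang fL fdeg).
Qed.
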